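(* Let $\mathrm L_i=(\mathrm D-\alpha_i\mathrm I)^{N_i}$ for $i\in\{1,2\}$, with $N_i\ge 1$ an integer and $\alpha_i\in\mathbb R$, and let $\mathbf K=\mathrm K_1\times\mathrm K_2=[K_1^-,K_1^+]\times[K_2^-,K_2^+]$. Let $\langle\cdot,\boldsymbol\nu\rangle:\mathcal M_{\mathrm L_1\otimes\mathrm L_2}(\mathbb R^2)\to\mathbb R^M$ be linear, weak$^\star$-continuous, surjective, injective on $\mathcal N_{\mathrm L_1}\otimes\mathcal N_{\mathrm L_2}$, and supported in $\mathbf K$. Let $E:\mathbb R^M\times\mathbb R^M\to\mathbb R^+\cup\{\infty\}$ be proper, coercive, lower semicontinuous, and strictly convex in its second argument; let $\mathbf y\in\mathbb R^M$ and $\lambda>0$. Let $|\cdot|_{\mathcal M_{\mathrm L_1\otimes\mathrm L_2}}$ be the seminorm on $\mathcal M_{\mathrm L_1\otimes\mathrm L_2}(\mathbf K)$ associated with the $\mathbf K$-fundamental system (see context). Then the solution set $$\mathcal V=\underset{f\in\mathcal M_{\mathrm L_1\otimes\mathrm L_2}(\mathbf K)}{\mathrm{argmin}}\ \Big(E(\mathbf y,\langle f,\boldsymbol\nu\rangle)+\lambda|f|_{\mathcal M_{\mathrm L_1\otimes\mathrm L_2}}\Big)$$ is nonempty, weak$^\star$-compact, and is the weak$^\star$-closed convex hull of its extreme points, all of which are $[\mathrm L_1\otimes\mathrm L_2]$-splines, i.e. of the form $$\begin{aligned}f(t_1,t_2)=&\sum_{k=1}^Ka_kg_{\mathrm L_1}(t_1-x_{1,k})g_{\mathrm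 L_2}(t_2-x_{2,k})+\sum_{n=1}^{N_1}\sum_{m=1}^{K_{1,n}}b_{n,m}p_{1,n}(t_1)g_{\mathrm L_2}(t_2-y_{n,m})\\&+\sum_{n'=1}^{N_2}\sum_{m'=1}^{K_{2,n'}}c_{n',m'}g_{\mathrm L_1}(t_1-z_{n',m'})p_{2,n'}(t_2)+\sum_{n=1}^{N_1}\sum_{n'=1}^{N_2}d_{n,n'}p_{1,n}(t_1)p_{2,n'}(t_2)\end{aligned}$$ with real weights, such that: (Sparsity) the number of knots satisfies $K+\sum_{n=1}^{N_1}K_{1,n}+\sum_{n'=1}^{N_2}K_{2,n'}\le M-N_1N_2$; (Localization) $(x_{1,k},x_{2,k})\in\mathbf K$, $y_{n,m}\in\mathrm K_2$, and $z_{n',m'}\in\mathrm K_1$.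
   Context: **Operators.** $\mathrm D$ is the derivative on $\mathcal D'(\mathbb R)$. $\mathcal N_{\mathrm L_i}\subset\mathcal D'(\mathbb R)$ is the null space of $\mathrm L_i$ (dimension $N_i$), and $g_{\mathrm L_i}(t)=\frac{t_+^{N_i-1}e^{\alpha_it}}{(N_i-1)!}$ is its causal Green's function ($t_+^0=\mathbf 1_{t\ge0}$). $\mathcal M(X)$ is the space of bounded (signed) Radon measures on $X$ with the total-variation norm; for $X$ compact it is the dual of $\mathcal C(X)$, and $\mathcal M(\mathbb R^d)$ is the dual of $\mathcal C_0(\mathbb R^d)$ (continuous functions vanishing at infinity). **Native space on $\mathbb R^2$.** For $i\in\{1,2\}$ fix a basis $(q_{i,n})_{n=1}^{N_i}$ of $\mathcal N_{\mathrm L_i}$ and functions $\phi_{i,n}\in\mathcal D(\mathbb R)$ (smooth, compactly supported) with $\langle q_{i,n},\phi_{i,m}\rangle=\delta_{n-m}$. Let $g_{\boldsymbol\phi_i}(t,x)=g_{\mathrm L_i}(t-x)-\sum_n\langle g_{\mathrm L_i}(\cdot),\phi_{i,n}(\cdot+x)\rangle q_{i,n}(t)$; for fixed $t$ this is compactly supported in $x$. $\mathcal M_{\mathrm L_1\otimes\mathrm L_2}(\mathbb R^2)$ is the space of all $$f(t_1,t_2)=\int_{\mathbb R^2}g_{\boldsymbol\phi_1}(t_1,x_1)g_{\boldsymbol\phi_2}(t_2,x_2)\,\mathrm dm(x_1,x_2)+\sum_nq_{1,n}(t_1)\int_{\mathbb R}g_{\boldsymbol\phi_2}(t_2,x)\,\mathrm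 dm_{1,n}(x)+\sum_n\int_{\mathbb R}g_{\boldsymbol\phi_1}(t_1,x)\,\mathrm dm_{2,n}(x)\,q_{2,n}(t_2)+\sum_{n,n'}d_{n,n'}q_{1,n}(t_1)q_{2,n'}(t_2)$$ with $m\in\mathcal M(\mathbb R^2)$, $m_{1,n},m_{2,n}\in\mathcal M(\mathbb R)$, $d_{n,n'}\in\mathbb R$. This representation is unique, so the space is identified with $\mathcal M(\mathbb R^2)\times\mathcal M(\mathbb R)^{N_1}\times\mathcal M(\mathbb R)^{N_2}\times\mathbb R^{N_1\times N_2}$, the dual of $\mathcal C_0(\mathbb R^2)\times\mathcal C_0(\mathbb R)^{N_1}\times\mathcal C_0(\mathbb R)^{N_2}\times\mathbb R^{N_1\times N_2}$, and the weak$^\star$ topology is the one given by this duality. The set and its weak$^\star$ topology do not depend on the choice of $(q_{i,n},\phi_{i,n})$. ''$\boldsymbol\nu$ is supported in $\mathbf K$'' means that $\langle f,\boldsymbol\nu\rangle=\mathbf 0$ for every $f\in\mathcal M_{\mathrm L_1\otimes\mathrm L_2}(\mathbb R^2)$ that vanishes on an open neighbourhood of $\mathbf K$. **Localized space and fundamental system.** The $\mathbf K$-fundamental system uses the bases $p_{i,n}(t)=\frac{(t-K_i^-)^{n-1}e^{\alpha_i(t-K_i^-)}}{(n-1)!}$, $n=1,\dots,N_i$, of $\mathcal N_{\mathrm L_i}$, and the analysis functionals $\iota_{i,n}:f\mapsto\big((\mathrm D-\alpha_i\mathrm I)^{n-1}f\big)(K_i^-)$ (understood as a left limit for $n=N_i$);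 for this system the kernel reduces to $g_{\mathrm L_i}(t-x)$ for $x\in\mathrm K_i$. The Banach subspace $\mathcal M_{\mathrm L_1\otimes\mathrm L_2}(\mathbf K)\subset\mathcal M_{\mathrm L_1\otimes\mathrm L_2}(\mathbb R^2)$ is the set of all $f$ of the form $$f(t_1,t_2)=\int_{\mathbf K}g_{\mathrm L_1}(t_1-x_1)g_{\mathrm L_2}(t_2-x_2)\,\mathrm dm(x_1,x_2)+\sum_{n=1}^{N_1}p_{1,n}(t_1)\int_{\mathrm K_2}g_{\mathrm L_2}(t_2-x)\,\mathrm dm_{1,n}(x)+\sum_{n=1}^{N_2}\int_{\mathrm K_1}g_{\mathrm L_1}(t_1-x)\,\mathrm dm_{2,n}(x)\,p_{2,n}(t_2)+\sum_{n,n'}d_{n,n'}p_{1,n}(t_1)p_{2,n'}(t_2)$$ with $m\in\mathcal M(\mathbf K)$, $m_{1,n}\in\mathcal M(\mathrm K_2)$, $m_{2,n}\in\mathcal M(\mathrm K_1)$, $d_{n,n'}\in\mathbb R$; this representation is unique. Its weak$^\star$ topology is that of $\mathcal M(\mathbf K)\times\mathcal M(\mathrm K_2)^{N_1}\times\mathcal M(\mathrm K_1)^{N_2}\times\mathbb R^{N_1\times N_2}$ (equivalently, the topology inherited from $\mathcal M_{\mathrm L_1\otimes\mathrm L_2}(\mathbb R^2)$). The seminorm associated with the $\mathbf K$-fundamental system is $$|f|_{\mathcal M_{\mathrm L_1\otimes\mathrm L_2}}=\|m\|_{\mathcal M}+\sum_{n=1}^{N_1}\|m_{1,n}\|_{\mathcal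 M}+\sum_{n=1}^{N_2}\|m_{2,n}\|_{\mathcal M},$$ with null space $\mathcal N_{\mathrm L_1}\otimes\mathcal N_{\mathrm L_2}$. *)

(* Defs.v *)
From HB Require Import structures.
From mathcomp Require Import all_boot all_order all_algebra.
From mathcomp Require Import all_classical all_reals all_analysis.

Set Implicit Arguments.
Unset Strict Implicit.
Unset Printing Implicit Defensive.

Import Order.TTheory GRing.Theory Num.Theory.
Import numFieldNormedType.Exports.

Local Open Scope classical_set_scope.
Local Open Scope ring_scope.

Section Measures.
Context d (X : measurableType d) (R : realType).
Implicit Types nu : {charge set X -> \bar R}.

Lemma hahn_sets_ex nu :
  {PN : set X * set X | hahn_decomposition nu PN.1 PN.2}.
Proof. by apply: cid; have [P [N h]] := Hahn_decomposition nu; exists (P, N). Qed.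

Definition hahn_setsP nu : hahn_decomposition nu
    (sval (hahn_sets_ex nu)).1 (sval (hahn_sets_ex nu)).2 :=
  svalP (hahn_sets_ex nu).

(* The Jordan parts do not depend on the Hahn decomposition chosen above. *)
Definition charge_Rintegral nu (D : set X) (h : X -> R) : R :=
  Rintegral (jordan_pos (hahn_setsP nu)) D h -
  Rintegral (jordan_neg (hahn_setsP nu)) D h.

Definition total_variation nu : R :=
  fine (charge_variation (hahn_setsP nu) setT).

(* M(D): a charge is finite, and on R or R^2 every finite signed Borel measure
   is Radon.  A measure on D is represented by its extension by zero to X. *)
Record measure_on (D : set X) := MeasureOn {
  charge_of :> {charge set X -> \bar R} ;
  charge_ofP : forall A, measurable A -> A `&` D = set0 -> charge_of A = 0%E }.

End Measures.
Arguments measure_on {d X} R D.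

(* C_0(D), for D closed; this is C(D) when D is compact. The values outside D
   are irrelevant. *)
Definition C0 (R : realType) (X : topologicalType) (D : set X) : set (X -> R) :=
  [set h | {within D, continuous h} /\
    forall e : R, 0 < e ->
      exists2 C, compact C & forall x, D x -> ~ C x -> `|h x| < e].

Section Operators.
Variable R : realType.
Implicit Types (alpha t x : R) (N : nat).

Definition Lop1 alpha (f : R -> R) : R -> R := fun t => derive1 f t - alpha * f t.

(* Null space of (D - alpha I)^N.  Its distributional solutions are smooth
   functions, so it consists of the classical solutions; derive1 is total,
   whence the explicit differentiability. *)
Definition nullspace alpha N : set (R -> R) :=
  [set f | (forall k, (k < N)%N ->
             forall t, derivable (iter k (Lop1 alpha) f) t 1) /\
           iter N (Lop1 alpha) f = cst 0].

Definition green alpha N t : R :=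
  if 0 <= t then t ^+ N.-1 * expR (alpha * t) / (N.-1)`!%:R else 0.

Definition test_function : set (R -> R) :=
  [set phi | (forall k t, derivable (derive1n k phi) t 1) /\
             exists2 C, compact C & forall t, ~ C t -> phi t = 0].

Definition is_basis N (V : set (R -> R)) (q : 'I_N -> R -> R) : Prop :=
  (forall n, V (q n)) /\
  (forall f, V f -> exists! a : 'I_N -> R, f = (fun t => \sum_n a n * q n t)).

Definition pairing (f g : R -> R) : R :=
  Rintegral (@lebesgue_measure R) setT (fun t => f t * g t).

Definition biorthogonal_system alpha N (q phi : 'I_N -> R -> R) : Prop :=
  [/\ is_basis (nullspace alpha N) q,
      forall n, test_function (phi n) &
      forall n m, pairing (q n) (phi m) = (n == m)%:R].

(* The data from which a one-dimensional function is synthesized: knots range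
   over sdom, atoms are t |-> skernel t x, and sbasis spans the null space. *)
Record system N := System {
  sdom : set R ;
  skernel : R -> R -> R ;
  sbasis : 'I_N -> R -> R }.

Definition gphi alpha N (q phi : 'I_N -> R -> R) t x : R :=
  green alpha N (t - x) -
  \sum_n pairing (green alpha N) (fun u => phi n (u + x)) * q n t.

Definition global_system alpha N (q phi : 'I_N -> R -> R) : system N :=
  System setT (gphi alpha q phi) q.

(* 'I_N counts from 0: n stands for the mathematical index n.+1. *)
Definition fundamental_basis alpha a N (n : 'I_N) t : R :=
  (t - a) ^+ n * expR (alpha * (t - a)) / n`!%:R.

Definition local_system alpha N (a b : R) : system N :=
  System `[a, b]%classic (fun t x => green alpha N (t - x))
         (@fundamental_basis alpha a N).

End Operators.

Section Native.
Variables (R : realType) (N1 N2 : nat).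
Variables (S1 : system R N1) (S2 : system R N2).

Record coords := Coords {
  cm : measure_on R (sdom S1 `*` sdom S2) ;
  cm1 : 'I_N1 -> measure_on R (sdom S2) ;
  cm2 : 'I_N2 -> measure_on R (sdom S1) ;
  cd : 'M[R]_(N1, N2) }.

HB.instance Definition _ := gen_eqMixin coords.
HB.instance Definition _ := gen_choiceMixin coords.

Record predual := Predual {
  hm : {h : R * R -> R | C0 (sdom S1 `*` sdom S2) h} ;
  hm1 : 'I_N1 -> {h : R -> R | C0 (sdom S2) h} ;
  hm2 : 'I_N2 -> {h : R -> R | C0 (sdom S1) h} ;
  hd : 'M[R]_(N1, N2) }.

Definition duality (c : coords) (h : predual) : R :=
  charge_Rintegral (cm c) (sdom S1 `*` sdom S2) (sval (hm h)) +
  \sum_n charge_Rintegral (cm1 c n) (sdom S2) (sval (hm1 h n)) +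
  \sum_n charge_Rintegral (cm2 c n) (sdom S1) (sval (hm2 h n)) +
  \sum_n \sum_n' cd c n n' * hd h n n'.

(* Weak-star topology: pointwise convergence on the predual. *)
Definition wcoords : topologicalType :=
  initial_topology (duality : coords -> {ptws predual -> R}).

Definition coords_norm (c : coords) : R :=
  total_variation (cm c) +
  \sum_n total_variation (cm1 c n) + \sum_n total_variation (cm2 c n).

Definition synthesis (c : coords) : R -> R -> R := fun t1 t2 =>
  charge_Rintegral (cm c) (sdom S1 `*` sdom S2)
    (fun x => skernel S1 t1 x.1 * skernel S2 t2 x.2) +
  \sum_n sbasis S1 n t1 *
    charge_Rintegral (cm1 c n) (sdom S2) (fun x => skernel S2 t2 x) +
  \sum_n charge_Rintegral (cm2 c n) (sdom S1) (fun x => skernel S1 t1 x) *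
    sbasis S2 n t2 +
  \sum_n \sum_n' cd c n n' * sbasis S1 n t1 * sbasis S2 n' t2.

Definition native : set (R -> R -> R) := range synthesis.

(* The value of coords_norm at the representation of f, which is unique;
   irrelevant outside native. *)
Definition seminorm (f : R -> R -> R) : R :=
  get [set r | exists2 c, synthesis c = f & r = coords_norm c].

End Native.
Arguments native {R N1 N2} S1 S2.
Arguments seminorm {R N1 N2} S1 S2 f.

(* R -> R -> R with the weak-star topology of native S1 S2, transported from
   wcoords along synthesis, which is one-to-one up to the values of charges on
   nonmeasurable sets.  Functions outside native are isolated points, so that
   native is open and closed: closedness, compactness and continuity on subsets
   of native are those of the weak-star topology. *)
Definition wstar (R : realType) N1 N2 (S1 : system R N1) (S2 : system R N2)
  : Type := R -> R -> R.

Section WeakStar.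
Variables (R : realType) (N1 N2 : nat).
Variables (S1 : system R N1) (S2 : system R N2).

HB.instance Definition _ := Choice.copy (wstar S1 S2) (R -> R -> R).

Definition wstar_open : set (set (wstar S1 S2)) :=
  [set U | open (@synthesis R N1 N2 S1 S2 @^-1` U : set (wcoords S1 S2))].

Lemma wstar_openT : wstar_open setT.
Proof. by rewrite /wstar_open/= preimage_setT; exact: openT. Qed.

Lemma wstar_openI : setI_closed wstar_open.
Proof. by move=> A B oA oB; rewrite /wstar_open/= preimage_setI; exact: openI. Qed.

Lemma wstar_open_bigU (I : Type) (U : I -> set (wstar S1 S2)) :
  (forall i, wstar_open (U i)) -> wstar_open (\bigcup_i U i).
Proof.
move=> oU; rewrite /wstar_open/= preimage_bigcup.
by apply: bigcup_open => i _; exact: oU.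
Qed.

HB.instance Definition _ :=
  isOpenTopological.Build (wstar S1 S2) wstar_openT wstar_openI wstar_open_bigU.

End WeakStar.

Section TwoDim.
Variable R : realType.

Definition tensor_space (V1 V2 : set (R -> R)) : set (R -> R -> R) :=
  [set f | exists (r : nat) (u v : 'I_r -> R -> R),
    [/\ forall k, V1 (u k), forall k, V2 (v k) &
        f = (fun t1 t2 => \sum_k u k t1 * v k t2)]].

Definition supported_in (Z : zmodType) (F : set (R -> R -> R))
    (nu : (R -> R -> R) -> Z) (K : set (R * R)) : Prop :=
  forall f, F f ->
    (exists U : set (R * R), [/\ open U, K `<=` U &
       forall t, U t -> f t.1 t.2 = 0]) -> nu f = 0.

End TwoDim.

Section Convexity.
Context {R : realType}.

Definition linear_on (V W : lmodType R) (F : set V) (nu : V -> W) : Prop :=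
  forall (a : R) f g, F f -> F g -> nu (a *: f + g) = a *: nu f + nu g.

Definition extreme_points (V : lmodType R) (A : set V) : set V :=
  [set f | A f /\ forall g h (t : R), A g -> A h -> 0 < t < 1 ->
    f = t *: g + (1 - t) *: h -> g = f /\ h = f].

Definition argmin (T : Type) (A : set T) (J : T -> \bar R) : set T :=
  [set f | A f /\ forall g, A g -> (J f <= J g)%E].

Definition is_proper (T : Type) (F : T -> \bar R) : Prop :=
  exists z, (F z < +oo)%E.

Definition is_coercive (V : normedModType R) (F : V -> \bar R) : Prop :=
  forall B : R, exists r : R, forall z, r <= `|z| -> (B%:E <= F z)%E.

Definition strictly_convex (V : lmodType R) (F : V -> \bar R) : Prop :=
  forall (z z' : V) (t : R), z != z' -> 0 < t < 1 ->
    (F z < +oo)%E -> (F z' < +oo)%E ->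
    (F (t *: z + (1 - t) *: z')%R < t%:E * F z + (1 - t)%:E * F z')%E.

(* Smallest closed convex set of functions containing A, for the weak-star
   topology of native S1 S2. *)
Definition wstar_closed_convex_hull N1 N2 (S1 : system R N1) (S2 : system R N2)
    (A : set (R -> R -> R)) : set (R -> R -> R) :=
  smallest [set C | closed (C : set (wstar S1 S2)) /\
                    @convex_set R (R -> R -> R) C] A.

End Convexity.

(* Main.v *)
(** An element of the native space is represented by a family of components, one
functional on bounded measurable functions for each pair of options: None stands
for integration against a charge, Some n for the coefficient of the n-th basis
function. On the rectangle K this representation is unique, because the kernels
and the exponential monomials separate measures. Weak-star continuity makes nu
the integration of each component against a continuous function; through the
change of basis between the two systems this carries over to the native space of
K, on which nu is still onto because it is supported in K.

Injectivity of nu on the null space bounds the unpenalized components, so the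
sublevel sets of the cost are weak-star compact: limits along ultrafilters are
measures by Riesz' theorem, and total variation is lower semicontinuous. Hence
minimizers exist; by strict convexity they share the same data and the same
seminorm, and by the Krein-Milman theorem they form the closed convex hull of
their extreme points. If the penalized components of a minimizer f could be cut
into more than M - N1 N2 disjoint nonnull pieces, a linear dependency between the
data of the pieces and of the null space would give g <> 0 such that f + g and
f - g are both minimizers. So for f extreme the penalized components are sums of
point masses, at most M - N1 N2 in total. *)

Require Import Defs.
From HB Require Import structures.
From mathcomp Require Import all_boot all_order all_algebra.
From mathcomp Require Import all_classical all_reals all_analysis.
From mathcomp Require Import measurable_realfun ring lra.

Set Implicit Arguments.
Unset Strict Implicit.
Unset Printing Implicit Defensive.

Import Order.TTheory GRing.Theory Num.Theory.
Import numFieldNormedType.Exports.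

Local Open Scope classical_set_scope.
Local Open Scope ring_scope.

(** * Bounded measurable functions *)

(** Coordinates cannot be compared directly: a charge is arbitrary on nonmeasurable sets, its Hahn
    decomposition is a choice, and the four kinds of coordinates have different types. Functionals
    on bounded measurable functions remove these differences, and continuity under bounded pointwise
    convergence reduces every equality between them to a generating family of test functions. The
    obstacle is that a limit along an ultrafilter is only finitely additive. On a rectangle it can
    be replaced by a countably additive functional with the same values at continuous functions,
    which suffices because [nu] and the predual see the components through continuous functions
    only. A second difficulty is that [nu] is given on the larger space; that it stays onto is
    checked on single atoms, where support in the rectangle can be used, and extended to measures by
    integration. The number [M - N1 * N2] arises by letting each of the [N1 * N2] null-space
    coordinates count as one piece among at most [M]. *)

Lemma eq_cvgr (T : Type) (U : topologicalType) (F : set_system T) (f g : T -> U) (l : U) :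
  f =1 g -> g @ F --> l -> f @ F --> l.
Proof. by move=> /funext ->. Qed.

Lemma cvg_sumr (T I : Type) (R : realType) (F : set_system T) (s : seq I) (P : pred I)
    (f : I -> T -> R) (l : I -> R) : Filter F ->
  (forall i, P i -> f i @ F --> l i) ->
  (fun t => \sum_(i <- s | P i) f i t) @ F --> \sum_(i <- s | P i) l i.
Proof.
move=> FF fl; elim: s => [|i s IH].
  by rewrite big_nil; under eq_fun do rewrite big_nil; exact: cvg_cst.
rewrite big_cons; under eq_fun do rewrite big_cons.
case: ifP => // Pi; by apply: cvgD => //; exact: fl.
Qed.

Section Closures.
Context {X : Type} {R : realType}.
Variable A : set (X -> R).

Definition lin_closed := forall (a : R) h k, A h -> A k -> A (fun x => a * h x + k x).

(** With [lin_closed], the closure conditions of the functional monotone class theorem. Uniqueness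
    statements are obtained by checking them for the set of functions on which a linear relation
    between functionals holds. *)
Definition bounded_limit_closed := forall (h_ : nat -> X -> R) h (B : R),
  (forall n, A (h_ n)) -> (forall n x, `|h_ n x| <= B) ->
  (forall x, h_ ^~ x @ \oo --> h x) -> A h.

Hypothesis Alin : lin_closed.

Lemma lin_closed0 h : A h -> A (fun=> 0).
Proof. by move=> Ah; have := Alin (-1) Ah Ah; under eq_fun do rewrite mulN1r addNr. Qed.

Lemma lin_closedD h k : A h -> A k -> A (fun x => h x + k x).
Proof. by move=> Ah Ak; have := Alin 1 Ah Ak; under eq_fun do rewrite mul1r. Qed.

Lemma lin_closedZ (a : R) h : A h -> A (fun x => a * h x).
Proof. by move=> Ah; have := Alin a Ah (lin_closed0 Ah); under eq_fun do rewrite addr0. Qed.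

Lemma lin_closedB h k : A h -> A k -> A (fun x => h x - k x).
Proof.
move=> Ah Ak; have := Alin (-1) Ak Ah.
by under eq_fun do rewrite mulN1r addrC.
Qed.

Lemma lin_closed_sum (n : nat) (F : nat -> X -> R) : A (fun=> 0) ->
  (forall i, (i < n)%N -> A (F i)) -> A (fun x => \sum_(i < n) F i x).
Proof.
move=> A0; elim: n => [_|n IH AF]; first by under eq_fun do rewrite big_ord0.
under eq_fun do rewrite big_ord_recr/=.
by apply: lin_closedD; [apply: IH => i /ltnW; exact: AF|exact: AF].
Qed.

End Closures.

Section BoundedMeasurable.
Context {d} {X : measurableType d} {R : realType}.
Implicit Types (h k : X -> R) (A : set (X -> R)).

Definition bmeas h := measurable_fun setT h /\ exists B : R, forall x, `|h x| <= B.

Lemma bmeas_cst (r : R) : bmeas (fun=> r).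
Proof. by split; [exact: measurable_cst|exists `|r|]. Qed.

Lemma bmeas_lin (a : R) h k : bmeas h -> bmeas k -> bmeas (fun x => a * h x + k x).
Proof.
move=> [mh [B hB]] [mk [C kC]]; split.
  by apply: measurable_funD => //; apply: measurable_funM => //; exact: measurable_cst.
exists (`|a| * B + C) => x; apply: (le_trans (ler_normD _ _)); apply: lerD => //.
by rewrite normrM ler_wpM2l.
Qed.

Lemma bmeasD h k : bmeas h -> bmeas k -> bmeas (fun x => h x + k x).
Proof.
by move=> bh bk; have := bmeas_lin 1 bh bk; under eq_fun do rewrite mul1r.
Qed.

Lemma bmeasZ (a : R) h : bmeas h -> bmeas (fun x => a * h x).
Proof.
by move=> bh; have := bmeas_lin a bh (bmeas_cst 0); under eq_fun do rewrite addr0.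
Qed.

Lemma bmeasN h : bmeas h -> bmeas (fun x => - h x).
Proof. by move=> /(bmeasZ (-1)); under eq_fun do rewrite mulN1r. Qed.

Lemma bmeasB h k : bmeas h -> bmeas k -> bmeas (fun x => h x - k x).
Proof. by move=> bh /bmeasN; exact: bmeasD. Qed.

Lemma bmeasM h k : bmeas h -> bmeas k -> bmeas (fun x => h x * k x).
Proof.
move=> [mh [B hB]] [mk [C kC]]; split; first exact: measurable_funM.
by exists (B * C) => x; rewrite normrM ler_pM.
Qed.

Lemma bmeas_sum I (s : seq I) (P : pred I) (h : I -> X -> R) :
  (forall i, bmeas (h i)) -> bmeas (fun x => \sum_(i <- s | P i) h i x).
Proof.
move=> bh; elim: s => [|i s IH].
  by under eq_fun do rewrite big_nil; exact: bmeas_cst.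
under eq_fun do rewrite big_cons.
by case: (P i) => //; apply: bmeasD.
Qed.

Lemma bmeas_indic (B : set X) : measurable B -> bmeas \1_B.
Proof.
move=> mB; split; first exact: measurable_indic.
by exists 1 => x; rewrite indicE; case: (x \in B); rewrite ?normr1 ?normr0.
Qed.

Lemma bmeas_lim (h_ : nat -> X -> R) h (B : R) : (forall n, bmeas (h_ n)) ->
  (forall n x, `|h_ n x| <= B) -> (forall x, h_ ^~ x @ \oo --> h x) -> bmeas h.
Proof.
move=> bh hB hh; split.
  by apply: (measurable_fun_cvg (h := h_)) => // n; have [] := bh n.
exists B => x; apply: (cvgr_to_le (cvg_norm (hh x))).
by near=> n; exact: hB.
Unshelve. all: by end_near.
Qed.

(** The sum counts the integers from 1 to [n] that are at most [r]; as [r <= n], it is the integer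
    part of [r]. *)
Lemma staircase (n : nat) (r : R) : 0 <= r <= n%:R ->
  r - 1 <= \sum_(k < n) (k.+1%:R <= r)%R%:R <= r.
Proof.
elim: n r => [|n IH] r; first by rewrite big_ord0; lra.
move=> /andP[r0 rn]; rewrite big_ord_recr/=.
have [rn'|rn'] := lerP r n%:R.
  have := IH r; rewrite r0 rn' => /(_ isT).
  suff -> : (n.+1%:R <= r) = false by rewrite addr0.
  by apply/negbTE; rewrite -ltNge (le_lt_trans rn')// ltr_nat.
rewrite (eq_bigr (fun=> 1)); last first.
  by move=> i _; rewrite (le_trans _ (ltW rn'))// ler_nat.
rewrite sumr_const card_ord; rewrite -natr1 in rn *.
case: (lerP (n%:R + 1) r) => ?/=; lra.
Qed.

(** For [0 <= h <= B], this is [h] rounded down to a multiple of [B / (n + 1)], written as a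
    combination of indicators so that linearity applies. *)
Definition staircase_fun (B : R) h (n : nat) : X -> R :=
  fun x => B / n.+1%:R * \sum_(k < n.+1) \1_[set y | B / n.+1%:R * k.+1%:R <= h y] x.

Lemma staircase_funP (B : R) h x n : 0 < B -> 0 <= h x <= B ->
  h x - B / n.+1%:R <= staircase_fun B h n x <= h x.
Proof.
move=> B0 /andP[h0 hB]; rewrite /staircase_fun.
have n0 : 0 < B / n.+1%:R by rewrite divr_gt0.
have /(@staircase n.+1) : 0 <= h x / (B / n.+1%:R) <= n.+1%:R.
  by rewrite divr_ge0 ?(ltW n0)//= ler_pdivrMr// mulrC divfK.
have -> : \sum_(k < n.+1) (k.+1%:R <= h x / (B / n.+1%:R))%R%:R =
    \sum_(k < n.+1) \1_[set y | B / n.+1%:R * k.+1%:R <= h y] x :> R.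
  apply: eq_bigr => k _; rewrite indicE ler_pdivlMr// mulrC; congr (_%:R)%R.
  by congr nat_of_bool; apply/idP/idP; rewrite inE.
move: (\sum_(k < _) _) => s.
by rewrite -(ler_pM2l n0) -[X in _ && X](ler_pM2l n0) mulrBr mulr1 mulrC divfK ?gt_eqF.
Qed.

Lemma staircase_cvg (B : R) h x : 0 < B -> 0 <= h x <= B ->
  staircase_fun B h ^~ x @ \oo --> h x.
Proof.
move=> B0 hx; apply: (@squeeze_cvgr _ _ _ _ (fun n : nat => h x - B / n.+1%:R) (cst (h x))).
- by near=> n; exact: staircase_funP.
- rewrite -[X in _ --> X]subr0; apply: cvgB; first exact: cvg_cst.
  rewrite -(mulr0 B); apply: cvgM; first exact: cvg_cst.
  exact: cvg_harmonic.
- exact: cvg_cst.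
Unshelve. all: by end_near.
Qed.

Lemma staircase_bound (B : R) h n x : 0 < B -> 0 <= h x <= B -> `|staircase_fun B h n x| <= B.
Proof.
move=> B0 hx; have /andP[_ h1] := staircase_funP n B0 hx.
rewrite ger0_norm; first by apply: le_trans h1 _; case/andP: hx.
by rewrite mulr_ge0 ?divr_ge0 ?(ltW B0)//; apply: sumr_ge0 => i _; rewrite indicE.
Qed.

Lemma measurable_superlevel h (r : R) : measurable_fun setT h -> measurable [set y | r <= h y].
Proof.
move=> mh; rewrite -[X in measurable X]setTI.
rewrite (_ : [set y | _] = h @^-1` `[r, +oo[%classic).
  by apply: mh => //; exact: measurable_itv.
by apply/seteqP; split => x /=; rewrite in_itv/= andbT.
Qed.

Lemma bmeas_staircase (B : R) h n : measurable_fun setT h -> bmeas (staircase_fun B h n).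
Proof.
move=> mh; apply: bmeasZ; apply: bmeas_sum => k; apply: bmeas_indic.
exact: measurable_superlevel.
Qed.

Lemma indic_trivIset (F : nat -> set X) n x : trivIset setT F ->
  \sum_(i < n) \1_(F i) x = \1_(\big[setU/set0]_(i < n) F i) x :> R.
Proof.
move=> tF; elim: n => [|n IH]; first by rewrite !big_ord0 indic0.
rewrite !big_ord_recr/= IH !indicE in_setU.
case: (boolP (x \in \big[setU/set0]_(i < n) F i)); case: (boolP (x \in F n)) => //=; rewrite ?addr0 ?add0r//.
rewrite !inE => Fn; rewrite -bigcup_mkord => -[i /= lin Fi].
by have /(_ n i) := tF; case/(_ I I (ex_intro _ x (conj Fn Fi))) => ni; rewrite ni ltnn in lin.
Qed.

Lemma indic_trivIset_norm (F : nat -> set X) n x : trivIset setT F ->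
  `|\sum_(i < n) \1_(F i) x : R| <= 1.
Proof. by move=> tF; rewrite indic_trivIset// indicE; case: (x \in _); rewrite ?normr1 ?normr0. Qed.

Lemma indic_trivIset_cvg (F : nat -> set X) x : trivIset setT F ->
  (fun n => \sum_(i < n) \1_(F i) x : R) @ \oo --> (\1_(\bigcup_k F k) x : R).
Proof.
move=> tF; have [[m _ Fm]|nF] := pselect ((\bigcup_k F k) x).
  have -> : \1_(\bigcup_k F k) x = 1 :> R by rewrite indicE mem_set//; exists m.
  apply: (cvg_near_cst); exists m.+1 => // n /= mn.
  rewrite indic_trivIset// indicE mem_set// -bigcup_mkord; by exists m.
have -> : \1_(\bigcup_k F k) x = 0 :> R by rewrite indicE memNset.
rewrite (_ : (fun n : nat => _) = cst 0); first exact: cvg_cst.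
apply/funext => n; apply: big1 => i _.
by rewrite indicE memNset// => Fi; apply: nF; exists i.
Qed.

Section monotone_class.
Variables (A : set (X -> R)) (G : set (set X)).
Hypotheses (Alin : lin_closed A) (Alim : bounded_limit_closed A).
Hypotheses (GI : setI_closed G) (GX : @measurable _ X = <<s G >>).
Hypotheses (A1 : A (fun=> 1)) (AG : forall B, G B -> A \1_B).

Let A0 : A (fun=> 0) := lin_closed0 Alin A1.

(** Dynkin's theorem: complements come from the constant 1, and a disjoint union is a limit of
    partial sums of indicators, all bounded by 1. *)
Lemma monotone_class_set B : measurable B -> A \1_B.
Proof.
rewrite GX; apply: (dynkin_induction (P := fun B => A \1_B)) => //.
- suff -> : \1_[set: X] = (fun=> 1) :> (X -> R) by [].
  by apply/funext => x; rewrite indicE in_setT.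
- move=> S mS AS; suff -> : \1_(~` S) = (fun x => -1 * \1_S x + 1) :> (X -> R) by exact: Alin.
  by apply/funext => x; rewrite !indicE in_setC; case: (x \in S); rewrite /= ?mulr1 ?mulr0; lra.
- move=> F mF tF AF.
  apply: (Alim (h_ := fun n x => \sum_(i < n) \1_(F i) x) (B := 1)).
  + by move=> n; exact: (@lin_closed_sum _ _ A Alin n (fun i => \1_(F i))).
  + by move=> n x; exact: indic_trivIset_norm.
  + by move=> x; exact: indic_trivIset_cvg.
Qed.

Lemma monotone_class h : bmeas h -> A h.
Proof.
suff pos k : bmeas k -> (forall x, 0 <= k x) -> A k.
  move=> [mh [B hB]].
  have Ah : A (fun x => h x + B).
    apply: pos; first by apply: bmeasD; [split=> //; exists B|exact: bmeas_cst].
    by move=> x; have := hB x; rewrite ler_norml; lra.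
  have := Alin (- B) A1 Ah; suff -> : (fun x => - B * 1 + (h x + B)) = h by [].
  by apply/funext => x; ring.
move=> [mk [B kB]] k0.
have kB' x : 0 <= k x <= `|B| + 1.
  by rewrite k0/=; have := kB x; rewrite ger0_norm//; have := ler_norm B; lra.
have B0 : 0 < `|B| + 1 by have := normr_ge0 B; lra.
apply: (Alim (h_ := staircase_fun (`|B| + 1) k) (B := `|B| + 1)).
- move=> n; apply: (lin_closedZ Alin); apply: (@lin_closed_sum _ _ A Alin _ (fun i => \1_[set y | (`|B| + 1) / n.+1%:R * i.+1%:R <= k y])) => //.
  by move=> i _; apply: monotone_class_set; exact: measurable_superlevel.
- by move=> n x; exact: staircase_bound.
- by move=> x; exact: staircase_cvg.
Qed.

End monotone_class.

End BoundedMeasurable.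

(** * Functionals continuous under bounded convergence *)

Section Daniell.
Context {d} {X : measurableType d} {R : realType}.
Implicit Types (h k w : X -> R) (L : (X -> R) -> R) (D : set X).

Definition bmeas_linear L := forall (a : R) h k, bmeas h -> bmeas k ->
  L (fun x => a * h x + k x) = a * L h + L k.

(** Continuity under bounded convergence plays the part of countable additivity: these are the
    integrals against finite signed measures, by [daniell_charge] and [charge_of_daniell]. *)
Definition daniell L := bmeas_linear L /\
  (forall (h_ : nat -> X -> R) h (B : R), (forall n, bmeas (h_ n)) ->
    (forall n x, `|h_ n x| <= B) -> (forall x, h_ ^~ x @ \oo --> h x) ->
    L \o h_ @ \oo --> L h).

Definition concentrated D L :=
  forall h, bmeas h -> (forall x, D x -> h x = 0) -> L h = 0.

Definition nonneg_functional L := forall h, bmeas h -> (forall x, 0 <= h x) -> 0 <= L h.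

Section linear_basic.
Variables (L : (X -> R) -> R) (lL : bmeas_linear L).

Lemma bmeas_linear0 : L (fun=> 0) = 0.
Proof.
have := lL 1 (bmeas_cst 0) (bmeas_cst 0).
by under eq_fun do rewrite mul1r addr0; rewrite mul1r; lra.
Qed.

Lemma bmeas_linearD h k : bmeas h -> bmeas k -> L (fun x => h x + k x) = L h + L k.
Proof.
by move=> bh bk; have := lL 1 bh bk; under eq_fun do rewrite mul1r; rewrite mul1r.
Qed.

Lemma bmeas_linearZ (a : R) h : bmeas h -> L (fun x => a * h x) = a * L h.
Proof.
move=> bh; have := lL a bh (bmeas_cst 0).
by rewrite bmeas_linear0 addr0; under eq_fun do rewrite addr0.
Qed.

Lemma bmeas_linearZr (a : R) h : bmeas h -> L (fun x => h x * a) = L h * a.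
Proof. by move=> bh; under eq_fun do rewrite mulrC; rewrite bmeas_linearZ// mulrC. Qed.

Lemma bmeas_linearN h : bmeas h -> L (fun x => - h x) = - L h.
Proof. by move=> bh; have := bmeas_linearZ (-1) bh; under eq_fun do rewrite mulN1r; rewrite mulN1r. Qed.

Lemma bmeas_linearB h k : bmeas h -> bmeas k -> L (fun x => h x - k x) = L h - L k.
Proof. by move=> bh bk; rewrite (bmeas_linearD bh (bmeasN bk)) bmeas_linearN. Qed.

Lemma bmeas_linear_sum I (s : seq I) (P : pred I) (h : I -> X -> R) :
  (forall i, bmeas (h i)) ->
  L (fun x => \sum_(i <- s | P i) h i x) = \sum_(i <- s | P i) L (h i).
Proof.
move=> bh; elim: s => [|i s IH].
  by rewrite big_nil; under eq_fun do rewrite big_nil; exact: bmeas_linear0.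
rewrite big_cons; under eq_fun do rewrite big_cons.
by case: (P i) => //; rewrite bmeas_linearD// ?IH//; exact: bmeas_sum.
Qed.

Lemma bmeas_linear_eq D h k : concentrated D L -> bmeas h -> bmeas k ->
  (forall x, D x -> h x = k x) -> L h = L k.
Proof.
move=> cL bh bk hk; apply/eqP; rewrite -subr_eq0 -bmeas_linearB//; apply/eqP/cL; first exact: bmeasB.
by move=> x /hk ->; rewrite subrr.
Qed.

Hypothesis pL : nonneg_functional L.

Lemma bmeas_linear_le h k : bmeas h -> bmeas k -> (forall x, h x <= k x) -> L h <= L k.
Proof.
move=> bh bk hk; rewrite -subr_ge0 -bmeas_linearB//; apply: pL; first exact: bmeasB.
by move=> x; rewrite subr_ge0.
Qed.

Lemma bmeas_linear_norm h (B : R) : bmeas h -> (forall x, `|h x| <= B) ->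
  `|L h| <= B * L (fun=> 1).
Proof.
move=> bh hB; have bB := bmeasZ B (bmeas_cst 1).
rewrite -bmeas_linearZ; last exact: bmeas_cst.
rewrite ler_norml -bmeas_linearN//; apply/andP; split; apply: bmeas_linear_le => //.
- exact: bmeasN.
- by move=> x; have := hB x; rewrite ler_norml mulr1 => /andP[].
- by move=> x; have := hB x; rewrite ler_norml mulr1 => /andP[].
Qed.

Lemma bmeas_linear_norm_on D h (B : R) : concentrated D L -> measurable D -> bmeas h ->
  0 <= B -> (forall x, D x -> `|h x| <= B) -> `|L h| <= B * L (fun=> 1).
Proof.
move=> cL mD bh B0 hB.
have bDh := bmeasM (bmeas_indic mD) bh.
rewrite (@bmeas_linear_eq D h (fun x => \1_D x * h x))//; last first.
  by move=> x Dx; rewrite indicE mem_set// mul1r.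
apply: bmeas_linear_norm => // x; rewrite indicE; case: (boolP (x \in D)).
  by rewrite inE mul1r; exact: hB.
by rewrite mul0r normr0.
Qed.

End linear_basic.

Section daniell_basic.
Variables (L : (X -> R) -> R) (dL : daniell L).

Lemma daniell_lin (a : R) h k : bmeas h -> bmeas k ->
  L (fun x => a * h x + k x) = a * L h + L k.
Proof. exact: dL.1. Qed.

Definition daniell0 := bmeas_linear0 dL.1.
Definition daniellD := bmeas_linearD dL.1.
Definition daniellZ := bmeas_linearZ dL.1.
Definition daniellZr := bmeas_linearZr dL.1.
Definition daniellB := bmeas_linearB dL.1.
Definition daniell_sum := bmeas_linear_sum dL.1.
Definition concentrated_eq := bmeas_linear_eq dL.1.
Definition nonneg_functional_le := bmeas_linear_le dL.1.
Definition nonneg_functional_norm := bmeas_linear_norm dL.1.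

Lemma nonneg_functional_indic : (forall A, measurable A -> 0 <= L \1_A) -> nonneg_functional L.
Proof.
move=> Lpos h [mh [B hB]] h0.
have hB' x : 0 <= h x <= `|B| + 1.
  by rewrite h0/=; have := hB x; rewrite ger0_norm//; have := ler_norm B; lra.
have B0 : 0 < `|B| + 1 by have := normr_ge0 B; lra.
apply: (cvgr_to_ge (dL.2 (staircase_fun (`|B| + 1) h) h (`|B| + 1) _ _ _)).
- by move=> n; exact: bmeas_staircase.
- by move=> n x; exact: staircase_bound.
- by move=> x; exact: staircase_cvg.
- near=> n => /=; rewrite daniellZ; last first.
    by apply: bmeas_sum => k; apply: bmeas_indic; exact: measurable_superlevel.
  rewrite daniell_sum; last by move=> k; apply: bmeas_indic; exact: measurable_superlevel.
  rewrite mulr_ge0 ?divr_ge0 ?(ltW B0)//; apply: sumr_ge0 => k _; apply: Lpos.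
  exact: measurable_superlevel.
Unshelve. all: by end_near.
Qed.

End daniell_basic.

Lemma daniell_ext L L' (G : set (set X)) : daniell L -> daniell L' ->
  setI_closed G -> @measurable _ X = <<s G >> -> L (fun=> 1) = L' (fun=> 1) ->
  (forall B, G B -> L \1_B = L' \1_B) -> forall h, bmeas h -> L h = L' h.
Proof.
move=> dL dL' GI GX L1 LG h bh.
suff: [set h | bmeas h /\ L h = L' h] h by case.
apply: (monotone_class (G := G)) => //.
- move=> a u v [bu Lu] [bv Lv]; split; first exact: bmeas_lin.
  by rewrite !daniell_lin// Lu Lv.
- move=> h_ u B Ah hB hu; have bh_ n : bmeas (h_ n) by case: (Ah n).
  split; first exact: (bmeas_lim bh_ hB hu).
  have c1 := dL.2 _ _ _ bh_ hB hu; have c2 := dL'.2 _ _ _ bh_ hB hu.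
  rewrite -(cvg_lim _ c1)// -(cvg_lim _ c2)//; congr (lim (_ @ \oo)).
  by apply/funext => n /=; case: (Ah n).
- by split => //; exact: bmeas_cst.
- move=> B GB; split; last exact: LG.
  by apply: bmeas_indic; rewrite GX; exact: sub_gen_smallest.
Qed.

Lemma daniell_eq_indic L L' : daniell L -> daniell L' ->
  (forall A, measurable A -> L \1_A = L' \1_A) -> forall h, bmeas h -> L h = L' h.
Proof.
move=> dL dL' LL'; apply: (daniell_ext dL dL' (G := @measurable _ X)) => //.
- exact: measurableI.
- by rewrite sigma_algebra_id//; exact: sigma_algebra_measurable.
- by have := LL' setT measurableT; rewrite indicT.
Qed.

Lemma daniell_comb (a : R) L L' : daniell L -> daniell L' ->
  daniell (fun h => a * L h + L' h).
Proof.
move=> dL dL'; split=> [b h k bh bk|h_ h B bh hB hh].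
  by rewrite !daniell_lin//; ring.
apply: cvgD; last exact: (dL'.2 _ _ _ bh hB hh).
by apply: cvgM; [exact: cvg_cst|exact: (dL.2 _ _ _ bh hB hh)].
Qed.

Lemma daniell_zero : daniell (fun=> 0).
Proof.
split=> [a h k _ _|h_ h B _ _ _]; first by rewrite mulr0 addr0.
exact: cvg_cst.
Qed.

Lemma daniell_scale (a : R) L : daniell L -> daniell (fun h => a * L h).
Proof.
by move=> dL; have := daniell_comb a dL daniell_zero; under eq_fun do rewrite addr0.
Qed.

Lemma daniell_bigsum I (s : seq I) (L : I -> (X -> R) -> R) :
  (forall i, daniell (L i)) -> daniell (fun h => \sum_(i <- s) L i h).
Proof.
move=> dL; elim: s => [|i s IH].
  by under eq_fun do rewrite big_nil; exact: daniell_zero.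
under eq_fun do rewrite big_cons.
by have := daniell_comb 1 (dL i) IH; under eq_fun do rewrite mul1r.
Qed.

Lemma daniell_mul L w : daniell L -> bmeas w -> daniell (fun h => L (fun x => w x * h x)).
Proof.
move=> dL bw; split=> [a h k bh bk|h_ h B bh hB hh].
  rewrite -daniell_lin//; try exact: bmeasM.
  by congr L; apply/funext => x; ring.
have [_ [C wC]] := bw.
apply: (dL.2 _ _ (C * B)) => [n|n x|x]; first exact: bmeasM.
- by rewrite normrM ler_pM.
- by apply: cvgM; [exact: cvg_cst|exact: hh].
Qed.

Lemma daniell_eval (x : X) : daniell (fun h => h x).
Proof. by split=> [a h k _ _ //|h_ h B bh hB hh]; exact: hh. Qed.

(** The polar decomposition: [s] is the sign of the density of [L] with respect to its variation, so
    that [h |-> L (s h)] is the variation measure. *)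
Definition polar L (s : X -> R) :=
  [/\ bmeas s, forall x, s x * s x = 1 & nonneg_functional (fun h => L (fun x => s x * h x))].

(** The mass of the variation measure. It does not depend on the sign chosen, by [tvarE]; a sign
    exists for every [daniell] functional, by [polar_ex], and the default value is then
    irrelevant. *)
Definition tvar L : R := L (xget (fun=> 1) (polar L)).

Section total_variation.
Variables (L : (X -> R) -> R) (dL : daniell L).

Lemma polar_norm s x : polar L s -> `|s x| = 1.
Proof.
case=> _ /(_ x) s1 _; apply/eqP; rewrite -(@eqrXn2 _ 2)// ?expr1n ?normr_ge0//.
by rewrite -normrX expr2 s1 normr1.
Qed.

Lemma polar_bound s h (B : R) : polar L s -> bmeas h -> (forall x, `|h x| <= B) ->
  `|L h| <= B * L s.
Proof.
move=> ps bh hB; have [bs s1 pos] := ps.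
have := nonneg_functional_norm (daniell_mul dL bs) pos (bmeasM bs bh) (B := B).
under eq_fun do rewrite mulrA s1 mul1r.
under [X in _ * L X]eq_fun do rewrite mulr1.
by apply=> x; rewrite normrM (polar_norm x ps) mul1r.
Qed.

Lemma tvarE s : polar L s -> tvar L = L s.
Proof.
move=> ps; rewrite /tvar; case: xgetP => [t -> pt|/(_ s)//].
have [[bs _ _] [bt _ _]] := (ps, pt).
apply/eqP; rewrite eq_le; apply/andP; split.
  apply: (le_trans (ler_norm _)); rewrite -[leRHS]mul1r; apply: polar_bound => // x.
  by rewrite (polar_norm x pt).
apply: (le_trans (ler_norm _)); rewrite -[leRHS]mul1r; apply: polar_bound => // x.
by rewrite (polar_norm x ps).
Qed.

End total_variation.

End Daniell.

Lemma daniell_comp d d' (X : measurableType d) (Y : measurableType d') (R : realType)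
    (L : (X -> R) -> R) (f : X -> Y) :
  daniell L -> measurable_fun setT f -> daniell (fun h : Y -> R => L (h \o f)).
Proof.
move=> dL mf.
have bf h : bmeas h -> bmeas (h \o f).
  by move=> [mh [B hB]]; split; [exact: measurableT_comp|exists B => x; exact: hB].
split=> [a h k bh bk|h_ h B bh hB hh].
  by rewrite -daniell_lin//; exact: bf.
by apply: (dL.2 _ _ B) => [n|n x|x]; [exact: bf|exact: hB|exact: hh].
Qed.

(** * Charges as functionals *)

Section ChargeIntegral.
Context {d} {X : measurableType d} {R : realType}.
Implicit Types (h k w : X -> R) (L : (X -> R) -> R) (D : set X).

Lemma bmeas_integrable (mu : {measure set X -> \bar R}) D h : measurable D ->
  (mu D < +oo)%E -> bmeas h -> mu.-integrable D (EFin \o h).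
Proof.
move=> mD muD [mh [B hB]]; apply: measurable_bounded_integrable => //.
  exact: measurable_funTS.
exists B; split; first exact: num_real.
by move=> C BC x _; apply: (le_trans (hB x)); exact: ltW.
Qed.

Lemma daniell_Rintegral (mu : {measure set X -> \bar R}) D : measurable D ->
  (mu D < +oo)%E -> daniell (Rintegral mu D).
Proof.
move=> mD muD; split=> [a h k bh bk|h_ h B bh hB hh].
  rewrite RintegralD//; first by rewrite RintegralZl//; exact: bmeas_integrable.
    by have := bmeas_integrable mD muD (bmeasZ a bh).
  exact: bmeas_integrable.
have bhl := bmeas_lim bh hB hh.
rewrite /Rintegral; apply: fine_cvg.
rewrite fineK; last by apply: integrable_fin_num => //; exact: bmeas_integrable.
apply: (@dominated_cvg _ _ _ mu D _ (fun n x => (h_ n x)%:E) (EFin \o h) (cst B%:E)) => //.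
- by move=> n; apply/measurable_EFinP; apply: measurable_funTS; case: (bh n).
- by move=> x _; apply: cvg_EFin; [by near=> n|exact: hh].
- exact: (bmeas_integrable mD muD (bmeas_cst B)).
- by move=> n x _; rewrite /= lee_fin.
Unshelve. all: by end_near.
Qed.

Definition charge_integral (nu : {charge set X -> \bar R}) h := charge_Rintegral nu setT h.

Lemma charge_RintegralE (nu : {charge set X -> \bar R}) D h :
  charge_Rintegral nu D h = charge_integral nu (h \_ D).
Proof.
rewrite /charge_integral /charge_Rintegral.
by rewrite Rintegral_mkcond [X in _ - X]Rintegral_mkcond.
Qed.

Lemma daniell_charge (nu : {charge set X -> \bar R}) : daniell (charge_integral nu).
Proof.
have fin (mu : {finite_measure set X -> \bar R}) : (mu setT < +oo)%E.
  by rewrite ltey_eq fin_num_measure.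
have := daniell_comb (-1) (daniell_Rintegral measurableT (fin (jordan_neg (hahn_setsP nu))))
   (daniell_Rintegral measurableT (fin (jordan_pos (hahn_setsP nu)))).
by congr daniell; apply/funext => h; rewrite /charge_integral /charge_Rintegral; lra.
Qed.

Lemma charge_integral_indic (nu : {charge set X -> \bar R}) A : measurable A ->
  charge_integral nu \1_A = fine (nu A).
Proof.
move=> mA; rewrite /charge_integral /charge_Rintegral /Rintegral !integral_indic// !setIT.
rewrite (jordan_decomp (hahn_setsP nu) mA) /cadd /= /cscale/= mulN1e fineB//; exact: fin_num_measure.
Qed.

Lemma jordan_pos_fine (nu : {charge set X -> \bar R}) A : measurable A ->
  fine (jordan_pos (hahn_setsP nu) A) = fine (nu (A `&` (sval (hahn_sets_ex nu)).1)).
Proof. by move=> mA; rewrite jordan_posE cjordan_posE /crestr0 mem_set. Qed.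

Lemma jordan_neg_fine (nu : {charge set X -> \bar R}) A : measurable A ->
  fine (jordan_neg (hahn_setsP nu) A) = - fine (nu (A `&` (sval (hahn_sets_ex nu)).2)).
Proof. by move=> mA; rewrite jordan_negE cjordan_negE /crestr0 mem_set// fineN. Qed.

(** The sign is 1 on the positive set of a Hahn decomposition and -1 on the negative one. *)
Lemma charge_polar (nu : {charge set X -> \bar R}) :
  exists s, polar (charge_integral nu) s /\ charge_integral nu s = Defs.total_variation nu.
Proof.
have [[mP pP] [mN nN] PN PN0] := hahn_setsP nu.
set P := (sval _).1 in mP pP PN PN0; set N := (sval _).2 in mN nN PN PN0.
have xPN x : \1_P x + \1_N x = 1 :> R /\ \1_P x * \1_N x = 0 :> R.
  have : (P `|` N) x by rewrite PN.
  rewrite !indicE; case: (boolP (x \in P)) => xP; case: (boolP (x \in N)) => xN; rewrite /= ?mul1r ?mul0r ?add0r ?addr0 //.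
    by move: xP xN; rewrite !inE => xP xN; have : (P `&` N) x by []; rewrite PN0.
  by move: xP xN; rewrite !notin_setE => xP xN [].
have bP : bmeas (\1_P : X -> R) by exact: bmeas_indic.
have bN : bmeas (\1_N : X -> R) by exact: bmeas_indic.
have bs := bmeasB bP bN.
have s1 x : (\1_P x - \1_N x) * (\1_P x - \1_N x) = 1 :> R.
  by have [] := xPN x; move: (\1_P x) (\1_N x) => u v uv uv0; nra.
have E A : measurable A -> charge_integral nu (fun x => (\1_P x - \1_N x) * \1_A x) =
    fine (nu (A `&` P)) - fine (nu (A `&` N)).
  move=> mA; rewrite -!charge_integral_indic; try exact: measurableI.
  rewrite -(daniellB (daniell_charge nu)); try by apply: bmeas_indic; exact: measurableI.
  by congr charge_integral; apply/funext => x; rewrite !indicI/=; ring.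
exists (fun x => \1_P x - \1_N x); split.
  split => //; apply: (nonneg_functional_indic (daniell_mul (daniell_charge nu) bs)).
  move=> A mA; rewrite E//; apply: addr_ge0.
    by rewrite fine_ge0//; apply: pP; [exact: measurableI|exact: subIsetr].
  by rewrite oppr_ge0 fine_le0//; apply: nN; [exact: measurableI|exact: subIsetr].
have := E setT measurableT; under eq_fun do rewrite indicT mulr1.
move=> ->; rewrite /Defs.total_variation /charge_variation/=.
by rewrite fineD ?fin_num_measure// jordan_pos_fine// jordan_neg_fine.
Qed.

Lemma tvar_charge (nu : {charge set X -> \bar R}) :
  Defs.total_variation nu = tvar (charge_integral nu).
Proof.
have [s [ps <-]] := charge_polar nu.
by rewrite (tvarE (daniell_charge nu) ps).
Qed.

Lemma charge_ofE D (m : measure_on R D) A : measurable A -> A `&` D = set0 ->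
  charge_of m A = 0%E.
Proof. exact: charge_ofP. Qed.

Lemma concentrated_charge D (m : measure_on R D) : measurable D ->
  concentrated D (charge_integral m).
Proof.
move=> mD h bh h0.
have dm := daniell_charge m; have mC := measurableC mD.
have -> : h = (fun x => \1_(~` D) x * h x).
  apply/funext => x; rewrite indicE; case: (boolP (x \in ~` D)); first by rewrite mul1r.
  by rewrite notin_setE => /contrapT /h0 ->; rewrite mulr0.
have d0 := daniell_mul dm (bmeas_indic mC).
apply: (daniell_eq_indic d0 daniell_zero _ bh) => A mA.
suff -> : (fun x => \1_(~` D) x * \1_A x) = \1_(A `&` ~` D) :> (X -> R).
  rewrite charge_integral_indic; last exact: measurableI.
  by rewrite charge_ofE//; [exact: measurableI|rewrite -setIA setICl setI0].
by apply/funext => x; rewrite indicI /= mulrC.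
Qed.

End ChargeIntegral.

Section DaniellCharge.
Context d (X : measurableType d) (R : realType).
Variables (L : (X -> R) -> R) (dL : daniell L).

(** The indicator of a nonmeasurable set is outside the reach of [L]; 0 is an arbitrary value
    there. *)
Definition daniell_charge_fun (A : set X) : \bar R :=
  if pselect (measurable A) then (L \1_A)%:E else 0%E.

Let cE A : measurable A -> daniell_charge_fun A = (L \1_A)%:E.
Proof. by rewrite /daniell_charge_fun; case: pselect. Qed.

Let c0 : daniell_charge_fun set0 = 0%E.
Proof.
by rewrite cE// indic0 (daniell0 dL).
Qed.

Let cfin A : measurable A -> daniell_charge_fun A \is a fin_num.
Proof. by move=> mA; rewrite cE. Qed.

Let csigma : semi_sigma_additive daniell_charge_fun.
Proof.
move=> F mF tF mUF; rewrite cE//.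
have E (n : nat) : (\sum_(0 <= i < n) daniell_charge_fun (F i))%E =
    (L (fun x => \sum_(i < n) \1_(F i) x))%:E.
  rewrite big_mkord (daniell_sum dL); last by move=> i; exact: bmeas_indic.
  by rewrite -sumEFin; apply: eq_bigr => i _; rewrite cE.
under eq_fun do rewrite E.
apply: cvg_EFin; first by near=> n.
apply: (dL.2 (fun n x => \sum_(i < n) \1_(F i) x) _ 1) => [n|n x|x].
- by apply: bmeas_sum => i; exact: bmeas_indic.
- exact: indic_trivIset_norm.
- exact: indic_trivIset_cvg.
Unshelve. all: by end_near.
Qed.

HB.instance Definition _ := isCharge.Build _ X R daniell_charge_fun c0 cfin csigma.

Lemma charge_of_daniell (D : set X) : measurable D -> concentrated D L ->
  exists m : measure_on R D, forall h, bmeas h -> charge_integral m h = L h.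
Proof.
move=> mD cL.
have cP A : measurable A -> A `&` D = set0 -> daniell_charge_fun A = 0%E.
  move=> mA AD; rewrite cE// cL//; first exact: bmeas_indic.
  move=> x Dx; rewrite indicE memNset// => Ax.
  by have : (A `&` D) x by []; rewrite AD.
exists (@MeasureOn _ _ _ D daniell_charge_fun cP) => h bh.
apply: (daniell_eq_indic (daniell_charge _) dL _ bh) => A mA.
by rewrite charge_integral_indic//= cE.
Qed.

End DaniellCharge.

(** * Total variation and limits along ultrafilters *)

Section TotalVariation.
Context {d} {X : measurableType d} {R : realType}.
Implicit Types (h k w s : X -> R) (L : (X -> R) -> R) (D : set X).

Lemma polar_ex L : daniell L -> exists s, polar L s.
Proof.
move=> dL; have cT : concentrated setT L.
  move=> h bh h0; suff -> : h = (fun=> 0) by exact: daniell0 dL.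
  by apply/funext => x; exact: h0.
have [m mL] := charge_of_daniell dL measurableT cT.
have [s [[bs s1 ps] _]] := charge_polar m; exists s; split => // h bh h0.
by rewrite -mL; [exact: ps|exact: bmeasM].
Qed.

Lemma tvar_norm L h (B : R) : daniell L -> bmeas h -> (forall x, `|h x| <= B) ->
  `|L h| <= B * tvar L.
Proof. by move=> dL bh hB; have [s ps] := polar_ex dL; rewrite (tvarE dL ps); exact: polar_bound. Qed.

Lemma tvar_ge0 L : daniell L -> 0 <= tvar L.
Proof.
move=> dL; have := tvar_norm dL (bmeas_cst 0) (B := 1).
rewrite mul1r => h; apply: (le_trans (normr_ge0 (L (fun=> 0)))).
by apply: h => x; rewrite normr0.
Qed.

Lemma tvar_le L (B : R) : daniell L ->
  (forall h, bmeas h -> (forall x, `|h x| <= 1) -> L h <= B) -> tvar L <= B.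
Proof.
move=> dL LB; have [s ps] := polar_ex dL; rewrite (tvarE dL ps); have [bs _ _] := ps.
by apply: LB => // x; rewrite (polar_norm x ps).
Qed.

Lemma le_tvar L h : daniell L -> bmeas h -> (forall x, `|h x| <= 1) -> L h <= tvar L.
Proof.
move=> dL bh h1; apply: (le_trans (ler_norm _)).
by rewrite -[leRHS]mul1r; exact: tvar_norm.
Qed.

Lemma tvar_eq L L' : daniell L -> daniell L' ->
  (forall h, bmeas h -> L h = L' h) -> tvar L = tvar L'.
Proof.
move=> dL dL' LL'; apply/eqP; rewrite eq_le; apply/andP; split; apply: tvar_le => // h bh h1.
  by rewrite LL'//; exact: le_tvar.
by rewrite -LL'//; exact: le_tvar.
Qed.

(** A nonnegative weight does not change the sign of the density, so total variation is linear in
    such weights. This is what makes the seminorm affine along small perturbations. *)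
Lemma tvar_mul L s w : daniell L -> polar L s -> bmeas w -> (forall x, 0 <= w x) ->
  tvar (fun h => L (fun x => w x * h x)) = L (fun x => s x * w x).
Proof.
move=> dL [bs s1 ps] bw w0; rewrite (@tvarE _ _ _ _ _ s).
- by congr L; apply/funext => x; rewrite mulrC.
- exact: daniell_mul.
- split => // h bh h0; have := ps _ (bmeasM bw bh) (fun x => mulr_ge0 (w0 x) (h0 x)).
  by congr (_ <= L _); apply/funext => x; ring.
Qed.

End TotalVariation.

Lemma bmeas_comp d d' (X : measurableType d) (Y : measurableType d') (R : realType)
    (f : X -> Y) (h : Y -> R) : measurable_fun setT f -> bmeas h -> bmeas (h \o f).
Proof.
by move=> mf [mh [B hB]]; split; [exact: measurableT_comp|exists B => x; exact: hB].
Qed.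

(** The left inverse [g] transports a sign from [X] to [Y]. It serves to place measures on the line
    on an axis of the plane without changing their mass. *)
Lemma tvar_comp d d' (X : measurableType d) (Y : measurableType d') (R : realType)
    (L : (X -> R) -> R) (f : X -> Y) (g : Y -> X) : daniell L ->
  measurable_fun setT f -> measurable_fun setT g -> cancel f g ->
  tvar (fun h : Y -> R => L (h \o f)) = tvar L.
Proof.
move=> dL mf mg fK; have [s ps] := polar_ex dL; have [bs s1 pos] := ps.
rewrite (tvarE dL ps) (@tvarE _ _ _ _ _ (s \o g)).
- by congr L; apply/funext => x /=; rewrite fK.
- exact: daniell_comp.
- split; [exact: bmeas_comp|by move=> y /=|move=> h bh h0].
  have -> : (fun y => (s \o g) y * h y) \o f = fun x => s x * (h \o f) x.
    by apply/funext => x /=; rewrite fK.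
  by apply: pos; [exact: bmeas_comp|move=> x; exact: h0].
Qed.

#[export] Instance ultra_fmap (T U : Type) (f : T -> U) (F : set_system T) :
  UltraFilter F -> UltraFilter (f @ F).
Proof.
move=> FU; split=> [|G PG FG]; first exact: fmap_proper_filter.
 apply/seteqP; split => A; last exact: FG.
move=> GA; have [//|FnA] := in_ultra_setVsetC (f @^-1` A) FU.
have : G (A `&` ~` A) by apply: filterI => //; apply: FG; exact: FnA.
by rewrite setICr => /filter_not_empty.
Qed.

Section UltraLimits.
Context {T : Type} {R : realType} (F : set_system T) {FU : UltraFilter F}.

Lemma ultra_bounded_cvg (f : T -> R) (B : R) : F [set t | `|f t| <= B] -> cvg (f @ F).
Proof.
move=> fB; have fB' : F (f @^-1` `[- B, B]%classic).
  by apply: filterS fB => t /=; rewrite ler_norml in_itv.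
have := @segment_compact _ (- B) B.
by rewrite compact_ultra => /(_ (f @ F) _ fB')[l [_ fl]]; apply/cvg_ex; exists l.
Qed.

End UltraLimits.

(** * Rectangles in the plane and uniform continuity *)

Section Plane.
Context {R : realType}.
Implicit Types (a b : R).

Definition box a1 b1 a2 b2 : set (R * R) := `[a1, b1]%classic `*` `[a2, b2]%classic.

Lemma compact_box a1 b1 a2 b2 : compact (box a1 b1 a2 b2).
Proof. by apply: compact_setX; exact: segment_compact. Qed.

Lemma cvg_pairE (T : Type) (F : set_system T) {FF : Filter F} (u : T -> R * R) (x : R * R) :
  (fun t => (u t).1) @ F --> x.1 -> (fun t => (u t).2) @ F --> x.2 -> u @ F --> x.
Proof.
case: x => x1 x2 /= c1 c2.
have -> : u = fun t => ((u t).1, (u t).2) by apply/funext => t; case: (u t).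
exact: cvg_pair c1 c2.
Qed.

Lemma continuous_fst : continuous (fst : R * R -> R). Proof. by move=> x; exact: cvg_fst. Qed.
Lemma continuous_snd : continuous (snd : R * R -> R). Proof. by move=> x; exact: cvg_snd. Qed.

Lemma within_cvg (T U : topologicalType) (I : Type) (F : set_system I) {FF : Filter F}
    (K : set T) (h : T -> U) (u : I -> T) (x : T) :
  {within K, continuous h} -> K x -> F [set i | K (u i)] -> u @ F --> x -> h \o u @ F --> h x.
Proof.
move=> ch Kx Ku ux A Ahx.
have hA := (@subspace_continuousP T K U h).1 ch x Kx A Ahx.
have uA : F [set i | K (u i) -> A (h (u i))] := ux _ hA.
have : F [set i | A (h (u i))] by apply: filterS2 uA Ku => i; exact.
by [].
Qed.

(* Two families that get close to one another have the same limits along an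
   ultrafilter, whence uniform continuity. *)
Lemma box_unif_continuous a1 b1 a2 b2 (h : R * R -> R) (e : R) (P : nat -> R * R -> R * R -> Prop) :
  {within box a1 b1 a2 b2, continuous h} -> 0 < e ->
  (forall d : R, 0 < d -> exists n0, forall n, (n0 <= n)%N -> forall x y,
    box a1 b1 a2 b2 x -> box a1 b1 a2 b2 y -> P n x y ->
    `|x.1 - y.1| < d /\ `|x.2 - y.2| < d) ->
  exists n, forall x y, box a1 b1 a2 b2 x -> box a1 b1 a2 b2 y -> P n x y -> `|h x - h y| < e.
Proof.
set K := box _ _ _ _ => ch e0 Pd; apply: contrapT => /forallNP H.
have {}H n : {xy : (R * R) * (R * R) | [/\ K xy.1, K xy.2, P n xy.1 xy.2 & e <= `|h xy.1 - h xy.2|]}.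
  apply: cid; have /existsNP[x /existsNP[y]] := H n.
  move=> /not_implyP[Kx /not_implyP[Ky /not_implyP[Pxy /negP]]]; rewrite -leNgt => exy.
  by exists (x, y).
pose u n := (sval (H n)).1; pose v n := (sval (H n)).2.
have [Ku Kv Pn uve] : [/\ forall n, K (u n), forall n, K (v n), forall n, P n (u n) (v n) &
    forall n, e <= `|h (u n) - h (v n)|].
  by split => n; rewrite /u /v; case: (H n) => -[x y] /= [].
have [U [UU oU]] := @ultraFilterLemma nat \oo _.
have := @compact_box a1 b1 a2 b2; have UK : U (u @^-1` K) by apply: oU; near=> n; exact: Ku.
rewrite compact_ultra => /(_ (u @ U) _ UK)[x [Kx ux]].
have vx : v @ U --> x.
  have D (p : R * R -> R) (cp : continuous p) :
      (forall d : R, 0 < d -> \forall n \near \oo, `|p (u n) - p (v n)| < d) -> p \o v @ U --> p x.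
    move=> pd; have : p \o u @ U --> p x by apply: cvg_comp ux _; exact: cp.
    move=> pu; have : (p \o u) \- (p \o v) @ U --> (0 : R).
      apply/cvgr0Pnorm_lt => d d0; apply: oU; exact: pd.
    move=> pv; have := cvgB pu pv; rewrite subr0 => c.
    suff -> : p \o v = (p \o u) - ((p \o u) \- (p \o v)) by exact: c.
    by apply/funext => n /=; rewrite fctE opprB addrC subrK.
  apply: cvg_pairE; apply: D => [|d /Pd[n0 hn0]].
  - exact: continuous_fst.
  - by exists n0 => // n /= nn; have [] := hn0 n nn (u n) (v n) (Ku n) (Kv n) (Pn n).
  - exact: continuous_snd.
  - by exists n0 => // n /= nn; have [] := hn0 n nn (u n) (v n) (Ku n) (Kv n) (Pn n).
have hu : h \o u @ U --> h x by apply: (within_cvg ch) => //; near=> n; exact: Ku.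
have hv : h \o v @ U --> h x by apply: (within_cvg ch) => //; near=> n; exact: Kv.
have c0 : (h \o u) - (h \o v) @ U --> (0 : R) by rewrite -(subrr (h x)); exact: cvgB.
have [n] := filter_ex ((cvgr0Pnorm_lt _).1 c0 e e0); rewrite fctE /= => /lt_le_trans /(_ (uve n)).
by rewrite ltxx.
Unshelve. all: by end_near.
Qed.

End Plane.

(** * Riesz representation on a rectangle *)

Lemma measurable_sublevel d (X : measurableType d) (R : realType) (f : X -> R) (r : R) :
  measurable_fun setT f -> measurable [set x | f x < r].
Proof.
move=> mf; have -> : [set x | f x < r] = ~` [set x | r <= f x].
  by apply/seteqP; split => x /=; rewrite ltNge => /negP.
exact/measurableC/measurable_superlevel.
Qed.

Section Cells.
Context {R : realType}.
Variables (a1 a2 : R).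

Definition coordinate (c : bool) (x : R * R) : R := if c then x.1 - a1 else x.2 - a2.

(* A countable family of half-planes separating the points of any bounded
   part of the quadrant with corner (a1, a2). *)
Definition halfplane (k : nat) : set (R * R) :=
  if (unpickle k : option (nat * nat * bool)) is Some (m, j, c)
  then [set x | coordinate c x < j%:R / m.+1%:R] else set0.

Lemma measurable_coordinate c : measurable_fun setT (coordinate c).
Proof.
rewrite /coordinate; case: c.
  by apply: measurable_funB; [exact: measurable_fst|exact: measurable_cst].
by apply: measurable_funB; [exact: measurable_snd|exact: measurable_cst].
Qed.

Lemma measurable_halfplane k : measurable (halfplane k).
Proof.
rewrite /halfplane; case: unpickle => // -[[m j] c].
exact: measurable_sublevel (measurable_coordinate c).
Qed.

(* The index of the atom of x in the algebra generated by the first n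
   half-planes, in lexicographic order. *)
Fixpoint cell (n : nat) (x : R * R) : nat :=
  if n is n'.+1 then (x \in halfplane n') + (cell n' x).*2 else 0%N.

Lemma cell_half n x : (cell n.+1 x)./2 = cell n x.
Proof. by rewrite /= half_bit_double. Qed.

Lemma cell_lt n x : (cell n x < 2 ^ n)%N.
Proof.
by elim: n => //= n IH; rewrite expnS mul2n -ltn_half_double half_bit_double.
Qed.

Lemma cell_halfplane n x y : cell n x = cell n y ->
  forall k, (k < n)%N -> (x \in halfplane k) = (y \in halfplane k).
Proof.
elim: n => // n IH E k; rewrite ltnS leq_eqVlt => /predU1P[->|kn].
  by have := congr1 odd E; rewrite /= !oddD !odd_double !addbF; do 2 case: (_ \in _).
by apply: IH => //; rewrite -(cell_half n x) -(cell_half n y) E.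
Qed.

Lemma measurable_cell n (P : pred nat) : measurable [set x | P (cell n x)].
Proof.
elim: n P => [|n IH] P /=.
  by case: (P 0%N); [rewrite (_ : [set _ | _] = setT)|rewrite (_ : [set _ | _] = set0)];
   rewrite //; apply/seteqP; split.
rewrite (_ : [set _ | _] = (halfplane n `&` [set x | P (1 + (cell n x).*2)%N]) `|`
   (~` halfplane n `&` [set x | P ((cell n x).*2)%N])).
  apply: measurableU; apply: measurableI.
  - exact: measurable_halfplane.
  - exact: (IH (fun i => P (1 + i.*2)%N)).
  - by apply: measurableC; exact: measurable_halfplane.
  - exact: (IH (fun i => P (i.*2)%N)).
apply/seteqP; split => x /=; have [xT|xT] := boolP (x \in halfplane n).
- by left; split=> //; rewrite inE in xT.
- by right; split=> //; rewrite notin_setE in xT.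
- by case=> [[]//|[]]; rewrite inE in xT.
- by case=> [[]|[]//]; rewrite notin_setE in xT.
Qed.

(** Points with coordinates that differ by at least [e] are separated by a half-plane whose
    threshold is a multiple of [1 / (m + 1) < e]. On a box only finitely many such thresholds
    matter, so all of them occur before some level [n0]. *)
Lemma cell_fine b1 b2 (e : R) : 0 < e -> exists n0, forall n, (n0 <= n)%N -> forall x y,
  box a1 b1 a2 b2 x -> box a1 b1 a2 b2 y -> cell n x = cell n y ->
  `|x.1 - y.1| < e /\ `|x.2 - y.2| < e.
Proof.
move=> e0; pose m := Num.trunc e^-1.
have m0 : 0 < m.+1%:R :> R by [].
have me : m.+1%:R^-1 < e.
  rewrite -[ltRHS]invrK ltf_pV2 ?posrE ?invr_gt0//.
  by have /andP[] := truncn_itv (ltW (etrans (invr_gt0 e) e0)).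
pose C : R := `|b1 - a1| + `|b2 - a2|.
have C0 : 0 <= C * m.+1%:R by rewrite mulr_ge0 ?addr_ge0.
pose J := (Num.trunc (C * m.+1%:R)).+2.
pose n0 := (\max_(j < J) maxn (pickle (m, j : nat, true)) (pickle (m, j : nat, false))).+1.
have coordC c x : box a1 b1 a2 b2 x -> 0 <= coordinate c x <= C.
  rewrite /box /= !in_itv/= => -[/andP[x1 x1'] /andP[x2 x2']].
  have h1 := ler_norm (b1 - a1); have h2 := ler_norm (b2 - a2).
  have h3 := normr_ge0 (b1 - a1); have h4 := normr_ge0 (b2 - a2).
  by rewrite /coordinate /C; case: c; lra.
have key c n x y : (n0 <= n)%N -> box a1 b1 a2 b2 x -> box a1 b1 a2 b2 y ->
    coordinate c x + e <= coordinate c y -> cell n x <> cell n y.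
  move=> nn Kx Ky xy /cell_halfplane E.
  have /andP[x0 xC] := coordC c x Kx; have /andP[y0 yC] := coordC c y Ky.
  have xm0 : 0 <= coordinate c x * m.+1%:R by rewrite mulr_ge0.
  have /andP[j1 j2] := truncn_itv xm0.
  (* Since [j / (m + 1) <= coordinate c x] and [1 / (m + 1) < e], the threshold [(j + 1) / (m + 1)]
     separates the two coordinates. *)
  set j := Num.trunc (coordinate c x * m.+1%:R) in j1 j2.
  have jJ : (j.+1 < J)%N.
    rewrite ltnS ltnS; apply: le_truncn; exact: ler_wpM2r.
  have ltn0 : (pickle (m, j.+1, c) < n0)%N.
    rewrite ltnS; apply: leq_trans (leq_bigmax (Ordinal jJ)) => /=.
    by rewrite leq_max; case: (c); rewrite leqnn ?orbT.
  have := E _ (leq_trans ltn0 nn); rewrite /halfplane pickleK.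
  rewrite mem_set; last by rewrite /= ltr_pdivlMr.
  rewrite memNset // => /=; apply/negP; rewrite -leNgt.
  apply: le_trans xy; rewrite -natr1 mulrDl mul1r lerD// ?(ltW me)//.
  by rewrite ler_pdivrMr.
exists n0 => n nn x y Kx Ky E.
have P c : `|coordinate c x - coordinate c y| < e.
  rewrite ltNge; apply/negP; rewrite ler_normr => /orP[]h.
    by apply: (key c n y x) => //; lra.
  by apply: (key c n x y) => //; lra.
have E1 : x.1 - a1 - (y.1 - a1) = x.1 - y.1 by ring.
have E2 : x.2 - a2 - (y.2 - a2) = x.2 - y.2 by ring.
by have := P true; have := P false; rewrite /coordinate E1 E2.
Qed.

End Cells.

Lemma measurable_box (R : realType) (a1 b1 a2 b2 : R) : measurable (box a1 b1 a2 b2).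
Proof. by apply: measurableX; exact: measurable_itv. Qed.

(* The countably additive representative of a positive functional on C(K) is
   the image of Lebesgue measure under a limit of step functions: in
   lexicographic order, the n-th step function takes a value in each nonempty
   cell of level n, on an interval whose length is the mass of that cell. *)
Section Riesz.
Context {R : realType}.
Variables (a1 b1 a2 b2 : R) (La : (R * R -> R) -> R).
Implicit Types w : R.
Let K := box a1 b1 a2 b2.
Hypotheses (linLa : bmeas_linear La) (posLa : nonneg_functional La)
  (concLa : concentrated K La).

Local Notation cl := (@cell R a1 a2).

(** The mass of the cells of level [n] that precede index [i]: these are the endpoints of the
    intervals assigned to the cells. *)
Let P n i : R := La \1_[set x | (cl n x < i)%N].

Let bcell n (Q : pred nat) : bmeas (\1_[set x | Q (cl n x)] : R * R -> R).
Proof. by apply: bmeas_indic; exact: measurable_cell. Qed.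

Let P0 n : P n 0 = 0.
Proof.
rewrite /P (_ : [set _ | _] = set0); first by rewrite indic0 (bmeas_linear0 linLa).
by apply/seteqP; split.
Qed.

Let M := La (fun=> 1).

Let P1 n : P n (2 ^ n) = M.
Proof.
rewrite /P (_ : [set _ | _] = setT); first by rewrite indicT.
by apply/seteqP; split => // x _; exact: cell_lt.
Qed.

Let Pmono n : {homo P n : i j / (i <= j)%N >-> i <= j}.
Proof.
move=> i j ij; apply: (bmeas_linear_le linLa posLa); [exact: (bcell n (fun c => c < i)%N)| exact: (bcell n (fun c => c < j)%N) |].
move=> x; rewrite !indicE; have [xi|xi] := boolP (cl n x < i)%N.
  by rewrite !mem_set//=; exact: leq_trans xi ij.
by rewrite memNset//=; exact/negP.
Qed.

(** Cell [i] of level [n] consists of the cells [2 i] and [2 i + 1] of the next level, so the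
    partitions into intervals are nested. *)
Let Phalf n i : P n.+1 i.*2 = P n i.
Proof.
have E x : (cl n.+1 x < i.*2)%N = (cl n x < i)%N by rewrite -ltn_half_double cell_half.
by rewrite /P; congr (La \1_ _); apply/seteqP; split => x; rewrite -[X in X -> _]/(is_true _) -[X in _ -> X]/(is_true _) E.
Qed.

Let M0 : 0 <= M. Proof. by apply: posLa => //; exact: bmeas_cst. Qed.

Let J n i : set R := `[P n i, P n i.+1[%classic.

Let Jex n w : 0 <= w < M -> exists i, J n i w.
Proof.
move=> /andP[w0 wM].
have ex : exists i, w < P n i by exists (2 ^ n)%N; rewrite P1.
case: (ex_minnP ex) => -[|i] wi imin; first by rewrite P0 ltNge w0 in wi.
exists i; rewrite /J /= in_itv/= wi andbT leNgt; apply/negP => /imin.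
by rewrite ltnn.
Qed.

Let Juniq n i j w : J n i w -> J n j w -> i = j.
Proof.
rewrite /J /= !in_itv/= => /andP[i1 i2] /andP[j1 j2].
apply/eqP; rewrite eqn_leq; apply/andP; split; rewrite leqNgt; apply/negP => /Pmono.
  by move=> /(_ n) ji; have := le_lt_trans (le_trans ji i1) j2; rewrite ltxx.
by move=> /(_ n) ij; have := le_lt_trans (le_trans ij j1) i2; rewrite ltxx.
Qed.

Let Jbound n i w : J n i w -> (i < 2 ^ n)%N -> 0 <= w < M.
Proof.
rewrite /J /= in_itv/= => /andP[i1 i2] /(@Pmono n); rewrite P1 => i3.
by rewrite -(P0 n) (le_trans (Pmono n (leq0n i)) i1) (lt_le_trans i2).
Qed.

Let Jlt n i w : w < M -> J n i w -> (i < 2 ^ n)%N.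
Proof.
rewrite /J /= in_itv/= => wM /andP[i1 i2]; rewrite ltnNge; apply/negP => /(@Pmono n).
by rewrite P1 => /(lt_le_trans wM) /lt_le_trans /(_ i1); rewrite ltxx.
Qed.

Let Jhalf n j w : J n.+1 j w -> J n j./2 w.
Proof.
rewrite /J /= !in_itv/= => /andP[j1 j2]; apply/andP; split; rewrite -Phalf.
  by apply: le_trans j1; apply: Pmono; rewrite -[leqRHS]odd_double_half leq_addl.
apply: (lt_le_trans j2); apply: Pmono; rewrite -{1}(odd_double_half j) doubleS.
by case: (odd j) => //=; rewrite ltnS leqnSn.
Qed.

Let x n i : R * R := xget (0, 0) [set y | K y /\ cl n y = i].

Let Pdiff n i : La \1_[set y | cl n y == i] = P n i.+1 - P n i.
Proof.
rewrite /P -(bmeas_linearB linLa); last 2 first.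
- exact: (bcell n (fun c => c < i.+1)%N).
- exact: (bcell n (fun c => c < i)%N).
congr La; apply/funext => y; rewrite !indicE.
have E (Q : pred (R * R)) : (y \in [set y | Q y]) = Q y by apply/idP/idP; rewrite inE.
rewrite (E (fun y => cl n y == i)) (E (fun y => cl n y < i.+1)%N) (E (fun y => cl n y < i)%N).
by rewrite ltnS; case: (ltngtP (cl n y) i) => _ /=; rewrite ?subr0 ?subrr.
Qed.

(** An interval that contains a point has positive length, so its cell has positive mass and, [La]
    being concentrated on [K], meets [K]. *)
Let xP n i w : J n i w -> K (x n i) /\ cl n (x n i) = i.
Proof.
rewrite /J /= in_itv/= => /andP[i1 i2]; rewrite /x; case: xgetP => [y _ //|noy].
have : P n i < P n i.+1 by exact: le_lt_trans i1 i2.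
rewrite -subr_gt0 -Pdiff (concLa (bcell n (fun c => c == i))) ?ltxx// => y Ky.
by rewrite indicE memNset//= => /eqP cy; exact: (noy y).
Qed.

Let I n w : nat := xget 0%N [set i | J n i w].

Let IP n w : 0 <= w < M -> J n (I n w) w.
Proof. by move=> /(Jex n)[i Ji]; rewrite /I; case: xgetP => [//|/(_ i)]. Qed.

Let G n w := x n (I n w).

Let KG n w : 0 <= w < M -> K (G n w).
Proof. by move=> /(IP n) /xP[]. Qed.

(** Nested intervals correspond to nested cells: from level [n] on, the step functions stay in the
    cell of level [n] assigned to [w]. With [cell_fine] this makes them uniformly Cauchy. *)
Let cellG n m w : 0 <= w < M -> (n <= m)%N -> cl n (G m w) = I n w.
Proof.
move=> wM /subnK <-; set d := (m - n)%N.
have clE z : cl n z = iter d half (cl (d + n) z).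
  by elim: d => // d IH; rewrite iterSr addSn cell_half.
have IE : I n w = iter d half (I (d + n) w).
  elim: d {clE} => // d IH; rewrite iterSr IH; congr iter.
  by apply: (@Juniq (d + n) _ _ w); [exact: IP|exact/Jhalf/IP].
by rewrite clE IE; have /xP[_ ->] := IP (d + n) wM.
Qed.

Let p (c : bool) (z : R * R) := if c then z.1 else z.2.

Let Gfine (e : R) : 0 < e -> exists n0, forall w n m, 0 <= w < M -> (n0 <= n)%N -> (n0 <= m)%N ->
  forall c, `|p c (G n w) - p c (G m w)| < e.
Proof.
move=> e0; have [n0 hn0] := cell_fine a1 a2 b1 b2 e0.
exists n0 => w n m wM nn mm c.
have [] := hn0 n0 (leqnn _) (G n w) (G m w) (KG n wM) (KG m wM).
  by rewrite !cellG.
by case: c.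
Qed.

(* Written as a sum of indicators for measurability; equal to p c (G n w) on [0, M[. *)
Let S c n (w : R) : R := \sum_(i < 2 ^ n) p c (x n i) * \1_(J n i) w.

Let Jsum n (f : nat -> R) w : 0 <= w < M -> \sum_(i < 2 ^ n) f i * \1_(J n i) w = f (I n w).
Proof.
move=> wM; have /andP[_ wM'] := wM; have Ii := IP n wM.
rewrite (bigD1 (Ordinal (Jlt wM' Ii)))//= indicE mem_set// mulr1 big1 ?addr0// => i iI.
rewrite indicE memNset ?mulr0// => Ji; move/eqP: iI; apply; apply/val_inj => /=.
exact: Juniq Ji Ii.
Qed.

Let Scvg c w : cvg (S c ^~ w @ \oo).
Proof.
have [wM|wM] := boolP (0 <= w < M); last first.
  have -> : S c ^~ w = cst 0; last exact: is_cvg_cst.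
  apply/funext => n; apply: big1 => i _; rewrite indicE memNset ?mulr0//.
  by move=> /Jbound /(_ (ltn_ord i)); exact/negP.
have -> : S c ^~ w = fun n => p c (G n w) by apply/funext => n; exact: (Jsum n (fun i => p c (x n i)) wM).
apply/cauchy_cvgP; apply: cauchy_exP => e /Gfine[n0 hn0].
exists (p c (G n0 w)); exists n0 => // n /= nn; rewrite /ball/=; exact: hn0.
Qed.

Let gam w : R * R := (lim (S true ^~ w @ \oo), lim (S false ^~ w @ \oo)).

Let mgam : measurable_fun setT gam.
Proof.
apply: measurable_fun_pair.
  apply: (measurable_fun_cvg (h := S true)) => [n|w _]; last exact: Scvg.
  apply: measurable_sum => i; apply: measurable_funM; first exact: measurable_cst.
  by apply: measurable_indic; exact: measurable_itv.
apply: (measurable_fun_cvg (h := S false)) => [n|w _]; last exact: Scvg.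
apply: measurable_sum => i; apply: measurable_funM; first exact: measurable_cst.
by apply: measurable_indic; exact: measurable_itv.
Qed.

Let gamG w : 0 <= w < M -> G ^~ w @ \oo --> gam w.
Proof.
move=> wM; have E c : S c ^~ w = fun n => p c (G n w) by apply/funext => n; exact: (Jsum n (fun i => p c (x n i)) wM).
apply: cvg_pairE.
  by have H := (@Scvg true w); rewrite /gam /= (E true) in H *; exact: H.
by have H := (@Scvg false w); rewrite /gam /= (E false) in H *; exact: H.
Qed.

Let Kgam w : 0 <= w < M -> K (gam w).
Proof.
move=> wM; apply: (@closed_cvg _ _ \oo _ (G ^~ w) K _ _ _ (gamG wM)).
  by apply: compact_closed; [exact: norm_hausdorff|exact: compact_box].
by near=> n; exact: KG.
Unshelve. all: by end_near.
Qed.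

Let Lb (f : R -> R) := Rintegral (@lebesgue_measure R) `[0, M[%classic f.

Let leb_fin : (@lebesgue_measure R `[0%R, M[%classic < +oo)%E.
Proof. by rewrite lebesgue_measure_itv/=; case: ifP => _; rewrite ltry. Qed.

Let dLb : daniell Lb.
Proof. by apply: (daniell_Rintegral (mu := @lebesgue_measure R)); [exact: measurable_itv|exact: leb_fin]. Qed.

Let LbJ n i : (i < 2 ^ n)%N -> Lb \1_(J n i) = P n i.+1 - P n i.
Proof.
move=> i2; rewrite /Lb /Rintegral integral_indic; [|exact: measurable_itv|exact: measurable_itv].
rewrite setIidl; last by move=> w /Jbound /(_ i2); rewrite /= in_itv.
have := lebesgue_measure_itv `[P n i, P n i.+1[; rewrite /= lte_fin => ->.
case: ltP => // Pi.
by apply/esym/eqP; rewrite subr_eq0 eq_le Pi Pmono.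
Qed.

Let Lb1 : Lb (fun=> 1) = M.
Proof.
rewrite /Lb Rintegral_cst; last exact: measurable_itv.
rewrite mul1r; have := lebesgue_measure_itv `[0%R, M[; rewrite /= lte_fin => ->.
case: ltP => [_|M1] /=; first by rewrite subr0.
by apply/esym/eqP; rewrite eq_le M0 M1.
Qed.

Let posLb : nonneg_functional Lb.
Proof. by move=> f bf f0; apply: Rintegral_ge0 => w _; exact: f0. Qed.

Let concLb : concentrated `[0, M[%classic Lb.
Proof.
move=> f bf f0; rewrite /Lb (@eq_Rintegral _ _ _ _ _ (cst 0)); last by move=> w; rewrite inE; exact: f0.
by rewrite Rintegral_cst ?mul0r//; exact: measurable_itv.
Qed.

(** For [h] continuous on [K], both sides are within [e M] of one Riemann sum, obtained by sampling
    [h] once in each cell of a level so fine that [h] varies by less than [e] on the part of a cell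
    in [K]. *)
Lemma riesz_representation : exists L : (R * R -> R) -> R,
  [/\ daniell L, nonneg_functional L, concentrated K L &
    forall h, bmeas h -> {within K, continuous h} -> L h = La h].
Proof.
exists (fun h => Lb (h \o gam)); split.
- exact: daniell_comp.
- by move=> h bh h0; apply: posLb; [exact: bmeas_comp|move=> w; exact: h0].
- move=> h bh h0; apply: concLb; first exact: bmeas_comp.
  by move=> w /=; rewrite in_itv/= => wM; apply: h0; exact: Kgam.
move=> h bh ch; apply/eqP; rewrite -subr_eq0 -normr_le0 leNgt; apply/negP => d0.
set d := `|_| in d0; have M1 : 0 < 2 * (M + 1) by have := M0; lra.
(* Chosen so that [2 e M < d]; [M + 1] avoids division by zero. *)
pose e := d / (2 * (M + 1)); have e0 : 0 < e by rewrite divr_gt0.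
have [n hn] := box_unif_continuous ch e0 (fun d' d0' => cell_fine a1 a2 b1 b2 d0').
pose s : R := \sum_(i < 2 ^ n) h (x n i) * (P n i.+1 - P n i).
have s1 : `|La h - s| <= e * M.
  pose k y := \sum_(i < 2 ^ n) h (x n i) * \1_[set z | cl n z == i] y.
  have bk : bmeas k by apply: bmeas_sum => i; apply: bmeasZ; exact: (bcell n (fun c => c == i)).
  have -> : s = La k.
    rewrite (bmeas_linear_sum linLa); last by move=> i; apply: bmeasZ; exact: (bcell n (fun c => c == i)).
    apply: eq_bigr => i _; rewrite (bmeas_linearZ linLa) ?Pdiff//.
    exact: (bcell n (fun c => c == i)).
  rewrite -(bmeas_linearB linLa)//; apply: (bmeas_linear_norm_on linLa posLa concLa).
  - exact: measurable_box.
  - exact: bmeasB.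
  - exact: ltW.
  move=> y Ky; have -> : k y = h (x n (cl n y)).
    rewrite /k (bigD1 (Ordinal (cell_lt a1 a2 n y)))//= indicE mem_set//=.
    rewrite mulr1 big1 ?addr0// => i iy; rewrite indicE memNset ?mulr0//= => /eqP yi.
    by move/eqP: iy; apply; apply/val_inj.
  have [Kx cx] : K (x n (cl n y)) /\ cl n (x n (cl n y)) = cl n y.
    by rewrite /x; case: xgetP => [//|/(_ y)[]].
  by apply/ltW/hn.
have s2 : `|Lb (h \o gam) - s| <= e * M.
  pose k w := \sum_(i < 2 ^ n) h (x n i) * \1_(J n i) w.
  have bJ i : bmeas (\1_(J n i) : R -> R) by apply: bmeas_indic; exact: measurable_itv.
  have bk : bmeas k by apply: bmeas_sum => i; exact: bmeasZ.
  have bhg : bmeas (h \o gam) by exact: bmeas_comp.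
  have -> : s = Lb k.
    rewrite (daniell_sum dLb); last by move=> i; exact: bmeasZ.
    by apply: eq_bigr => i _; rewrite (daniellZ dLb) ?LbJ.
  rewrite -(daniellB dLb)// -Lb1; apply: (bmeas_linear_norm_on dLb.1 posLb concLb).
  - exact: measurable_itv.
  - exact: bmeasB.
  - exact: ltW.
  move=> w; rewrite /= in_itv/= => wM; rewrite /k (Jsum n (fun i => h (x n i)) wM).
  (* The estimate on cells is applied to [G m w] and passed to the limit, since [gam w] itself may
     lie outside the cell. *)
  have hG : (fun m => h (G m w)) @ \oo --> h (gam w).
    apply: (within_cvg ch (Kgam wM) _ (gamG wM)).
    by near=> m; exact: KG.
  apply: (cvgr_to_le (cvg_norm (cvgB hG (cvg_cst (h (x n (I n w))))))).
  near=> m; apply/ltW/hn; [exact: KG|exact: (KG n)|].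
  have nm : (n <= m)%N by near: m; exists n.
  by rewrite (cellG wM nm) (cellG wM (leqnn n)).
have : d <= e * M + e * M.
  rewrite /d (_ : _ - La h = (Lb (h \o gam) - s) - (La h - s)); last by ring.
  by apply: (le_trans (ler_normB _ _)); exact: lerD.
rewrite -mulr2n -mulr_natr -mulrA -[X in X <= _]mulr1 => H.
have dE : d = e * (2 * (M + 1)) by rewrite /e divfK// gt_eqF.
by have := M0; nra.
Unshelve. all: by end_near.
Qed.

End Riesz.

(** * Limits of measures on a rectangle *)

Section UltraDaniell.
Context {R : realType} {T : Type} (F : set_system T) {FU : UltraFilter F}.
Variables (a1 b1 a2 b2 : R).
Let K := box a1 b1 a2 b2.
Variable L : T -> (R * R -> R) -> R.
Hypotheses (dL : forall t, daniell (L t)) (cL : forall t, concentrated K (L t)).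

(** The limit along [F] exists at every bounded measurable function and is positive and linear, but
    need not respect bounded limits. Riesz' theorem replaces it by a [daniell] functional with the
    same values at continuous functions. *)
Lemma ultra_limit_nonneg (B : R) : (forall t, nonneg_functional (L t)) ->
  F [set t | L t (fun=> 1) <= B] ->
  exists L0, [/\ daniell L0, nonneg_functional L0, concentrated K L0 &
    forall h, bmeas h -> {within K, continuous h} -> L t h @[t --> F] --> L0 h].
Proof.
move=> pL LB; pose La h := lim (L t h @[t --> F]).
have cvgLa h : bmeas h -> L t h @[t --> F] --> La h.
  move=> bh; have [_ [C hC]] := bh; apply: (@ultra_bounded_cvg _ _ F _ _ (`|C| * B)).
  apply: filterS LB => t /= tB.
  apply: (le_trans (nonneg_functional_norm (dL t) (pL t) bh hC)).
  apply: (@le_trans _ _ (`|C| * L t (fun=> 1))); last exact: ler_wpM2l.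
  by apply: ler_wpM2r; [apply: pL => //; exact: bmeas_cst|exact: ler_norm].
have [L0 [d0 p0 c0 L0E]] : exists L0, [/\ daniell L0, nonneg_functional L0, concentrated K L0 &
    forall h, bmeas h -> {within K, continuous h} -> L0 h = La h].
  apply: riesz_representation.
  - move=> a h k bh bk; apply/cvg_lim => //.
    apply: (eq_cvgr (fun t => daniell_lin (dL t) a bh bk)).
    apply: cvgD; last exact: cvgLa.
    by apply: cvgM; [exact: cvg_cst|exact: cvgLa].
  - move=> h bh h0; apply: (cvgr_to_ge (cvgLa h bh)).
    by near=> t; exact: pL.
  - move=> h bh h0; apply/cvg_lim => //.
    by apply: (eq_cvgr (fun t => cL t bh h0)); exact: cvg_cst.
by exists L0; split => // h bh ch; rewrite L0E//; exact: cvgLa.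
Unshelve. all: by end_near.
Qed.

End UltraDaniell.

Section UltraSigned.
Context {R : realType} {T : Type} (F : set_system T) {FU : UltraFilter F}.
Variables (a1 b1 a2 b2 : R).
Let K := box a1 b1 a2 b2.
Variable L : T -> (R * R -> R) -> R.
Hypotheses (dL : forall t, daniell (L t)) (cL : forall t, concentrated K (L t)).

(** Positive and negative parts are passed to the limit separately. The limits [L1] and [L2] need
    not be mutually singular, so their masses together only bound the variation of [L1 - L2]; this
    is lower semicontinuity. *)
Lemma ultra_limit (B : R) : F [set t | tvar (L t) <= B] ->
  exists L0, [/\ daniell L0, concentrated K L0,
    forall h, bmeas h -> {within K, continuous h} -> L t h @[t --> F] --> L0 h &
    tvar L0 <= lim (tvar (L t) @[t --> F])].
Proof.
move=> LB; pose s t := sval (cid (polar_ex (dL t))).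
have ps t : polar (L t) (s t) by rewrite /s; case: cid.
have bs t : bmeas (s t) by have [] := ps t.
(* After multiplication by the sign, the weight [(1 + e s) / 2] selects the positive part for
   [e = 1] and the negative part for [e = -1]. *)
pose w (e : R) t x := 2^-1 * (1 + e * s t x).
have bw e t : bmeas (w e t).
  by apply: bmeasZ; apply: bmeasD; [exact: bmeas_cst|exact: bmeasZ].
pose Le (e : R) t h := L t (fun x => s t x * (w e t x * h x)).
have dLe e t : daniell (Le e t) by exact: (daniell_mul (daniell_mul (dL t) (bs t)) (bw e t)).
have cLe e t : concentrated K (Le e t).
  move=> h bh h0; apply: cL; first by apply: bmeasM => //; exact: bmeasM.
  by move=> x Kx; rewrite h0// !mulr0.
have ss t x : s t x * s t x = 1 by have [] := ps t.
have pLe e t : e * e = 1 -> nonneg_functional (Le e t).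
  move=> e1 h bh h0; have [_ _ pos] := ps t; apply: pos; first exact: bmeasM.
  move=> x; rewrite mulr_ge0//; have := ss t x; rewrite /w; move: (s t x) => u; nra.
have LeD t h : bmeas h -> L t h = Le 1 t h - Le (-1) t h.
  move=> bh; rewrite -(daniellB (dL t)); try by apply: bmeasM => //; exact: bmeasM.
  congr (L t); apply/funext => x; rewrite /w.
  by transitivity (s t x * s t x * h x); [rewrite ss mul1r|field].
have LeS t : Le 1 t (fun=> 1) + Le (-1) t (fun=> 1) = tvar (L t).
  rewrite (tvarE (dL t) (ps t)) -(daniellD (dL t)); try by apply: bmeasM => //; apply: bmeasM => //; exact: bmeas_cst.
  by congr (L t); apply/funext => x; rewrite /w; field.
have LeB e t : e = 1 \/ e = -1 -> tvar (L t) <= B -> Le e t (fun=> 1) <= B.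
  move=> ee tB; have bo := bmeas_cst (X := (R * R)%type) (1 : R).
  have h1 := pLe 1 t (mulr1 1) _ bo (fun=> ler01); have h2 := pLe (-1) t (etrans (mulrNN 1 1) (mulr1 1)) _ bo (fun=> ler01).
  by have := LeS t; case: ee => ->; lra.
have [L1 [d1 p1 c1 cv1]] := ultra_limit_nonneg (dLe 1) (cLe 1) (fun t => pLe 1 t (mulr1 1))
  (filterS (fun t => LeB 1 t (or_introl erefl)) LB).
have [L2 [d2 p2 c2 cv2]] := ultra_limit_nonneg (dLe (-1)) (cLe (-1)) (fun t => pLe (-1) t (etrans (mulrNN 1 1) (mulr1 1)))
  (filterS (fun t => LeB (-1) t (or_intror erefl)) LB).
pose L0 h := -1 * L2 h + L1 h.
have dL0 : daniell L0 by exact: daniell_comb.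
exists L0; split => //.
- by move=> h bh h0; rewrite /L0 c1// c2//; ring.
- move=> h bh ch; apply: (eq_cvgr (fun t => LeD t h bh)).
  rewrite /L0 mulN1r addrC.
  by apply: cvgB; [exact: cv1|exact: cv2].
have bo := bmeas_cst (X := (R * R)%type) (1 : R).
have ct : {within K, continuous (fun=> 1 : R)} by apply: continuous_subspaceT => x; exact: cvg_cst.
have -> : lim (tvar (L t) @[t --> F]) = L1 (fun=> 1) + L2 (fun=> 1).
  apply/cvg_lim => //; apply: (eq_cvgr (fun t => esym (LeS t))).
  by apply: cvgD; [exact: cv1|exact: cv2].
apply: tvar_le => // h bh h1; rewrite /L0 mulN1r addrC.
apply: (le_trans (ler_norm _)); apply: (le_trans (ler_normB _ _)).
apply: lerD; rewrite -[leRHS]mul1r; exact: nonneg_functional_norm.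
Qed.

End UltraSigned.

(** * Product functions and ramps as test functions *)

Section Tensor.
Context {R : realType}.

Definition tens (u v : R -> R) : R * R -> R := fun x => u x.1 * v x.2.

Lemma bmeas_tens u v : bmeas u -> bmeas v -> bmeas (tens u v).
Proof.
move=> bu bv; apply: bmeasM; first exact: (bmeas_comp measurable_fst bu).
exact: (bmeas_comp measurable_snd bv).
Qed.

Lemma tensor_ext (L L' : (R * R -> R) -> R) : daniell L -> daniell L' ->
  (forall u v, bmeas u -> bmeas v -> L (tens u v) = L' (tens u v)) ->
  forall h, bmeas h -> L h = L' h.
Proof.
move=> dL dL' LL'.
apply: (daniell_ext dL dL' (G := [set A `*` B | A in measurable & B in measurable])).
- move=> _ _ [A mA [B mB <-]] [A' mA' [B' mB' <-]].
  exists (A `&` A'); first exact: measurableI.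
  by exists (B `&` B'); [exact: measurableI|rewrite setXI].
- exact: measurable_prod_measurableType.
- have := LL' _ _ (bmeas_cst 1) (bmeas_cst 1); rewrite /tens.
  suff -> : (fun x : R * R => (fun=> 1 : R) x.1 * (fun=> 1 : R) x.2) = (fun=> 1) by [].
  by apply/funext => x; rewrite mulr1.
- move=> _ [A mA [B mB <-]].
  have -> : \1_(A `*` B) = tens \1_A \1_B :> (R * R -> R).
    by apply/funext => -[x y]; rewrite /tens !indicE in_setX /=; case: (x \in A); case: (y \in B); rewrite /= ?mulr0 ?mul0r ?mulr1.
  by apply: LL'; exact: bmeas_indic.
Qed.

(** Equal to 1 up to [k.2 / (k.1 + 1)], to 0 from [(k.2 + 1) / (k.1 + 1)] on, and affine in between.
    The family is countable, as the Krein-Milman argument requires of a separating family, and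
    continuous, hence it gives weak-star continuous pairings. *)
Definition ramp (k : nat * int) (x : R) : R :=
  Num.min 1 (Num.max 0 (k.2%:~R + 1 - k.1.+1%:R * x)).

Lemma ramp_bound k x : `|ramp k x| <= 1.
Proof.
rewrite /ramp ger0_norm ?ge_min ?lexx//.
by rewrite le_min ler01 le_max lexx.
Qed.

Lemma continuous_ramp k : continuous (ramp k).
Proof.
move=> x; have c1 : {for x, continuous (fun y : R => Num.max 0 (k.2%:~R + 1 - k.1.+1%:R * y) : R^o)}.
  apply: (@continuous_max R R (fun=> 0 : R^o) (fun y => k.2%:~R + 1 - k.1.+1%:R * y : R^o)).
    exact: cvg_cst.
  by apply: cvgB; [exact: cvg_cst|apply: cvgM; [exact: cvg_cst|exact: cvg_id]].
have c0 : {for x, continuous (fun y : R => 1 : R^o)} by exact: cvg_cst.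
exact: (@continuous_min R R _ _ x c0 c1).
Qed.

Lemma bmeas_ramp k : bmeas (ramp k).
Proof.
split; first by apply: continuous_measurable_fun; exact: continuous_ramp.
by exists 1; exact: ramp_bound.
Qed.

Lemma ramp_total (A : set (R -> R)) : lin_closed A -> bounded_limit_closed A ->
  (forall k, A (ramp k)) -> forall h, bmeas h -> A h.
Proof.
move=> Alin Alim Ar.
have Aray t : A \1_(`]-oo, t[%classic).
  (* The descent ends at [floor((m + 1) t) / (m + 1) <= t], so these ramps vanish from [t] on; the
     shift by 1 puts its beginning within [2 / (m + 1)] of [t]. *)
  pose k (m : nat) := (m, Num.floor (m.+1%:R * t) - 1).
  apply: (Alim (fun m => ramp (k m)) _ 1) => [m|m x|x]; [exact: Ar|exact: ramp_bound|].
  have fl m := floor_itv (m.+1%:R * t).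
  rewrite indicE; have [tx|xt] := leP t x.
    rewrite memNset; last by rewrite /= in_itv/= ltNge tx.
    apply: (cvg_near_cst); near=> m.
    rewrite /ramp /k /= intrB subrK (max_l _) ?min_r// subr_le0.
    have /andP[h _] := fl m; apply: (le_trans h).
    by rewrite ler_pM2l.
  rewrite mem_set; last by rewrite /= in_itv.
  apply: (cvg_near_cst); near=> m.
  rewrite /ramp /k /= intrB subrK min_l// le_max; apply/orP; right.
  have /andP[_ h] := fl m; rewrite intrD in h.
  have : 2 <= m.+1%:R * (t - x).
    rewrite -ler_pdivrMr ?subr_gt0//; near: m.
    exists (Num.trunc (2 / (t - x))) => // m /= km.
    have /andP[_ h1] := truncn_itv (divr_ge0 (ler0n _ 2) (ltW (etrans (subr_gt0 x t) xt))).
    by apply/ltW/(lt_le_trans h1); rewrite ler_nat.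
  by move: h; lra.
apply: (monotone_class (G := RGenInftyO.G (R := R))) => //.
- move=> _ _ [x ->] [y ->]; exists (Num.min x y); apply/seteqP; split => z /=; rewrite !in_itv/= lt_min.
    by case=> -> ->.
  by move=> /andP.
- exact: RGenInftyO.measurableE.
- apply: (Alim (fun m => \1_(`]-oo, m%:R[%classic)) _ 1) => [m|m x|x]; first exact: Aray.
    by rewrite indicE; case: (_ \in _); rewrite ?normr1 ?normr0.
  apply: (cvg_near_cst); exists (Num.trunc `|x|).+1 => // m /= km.
  rewrite indicE mem_set//= in_itv/=; apply: (le_lt_trans (ler_norm x)).
  have /andP[_ h1] := truncn_itv (normr_ge0 x).
  by apply: (lt_le_trans h1); rewrite ler_nat.
- by move=> _ [x ->]; exact: Aray.
Unshelve. all: by end_near.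
Qed.

End Tensor.

(** Annihilation survives linear combinations and bounded limits as long as the other factor [w] is
    fixed. This lets test functions be enlarged in one variable at a time; [Y] may be a union of
    lines indexed by components, reached through [y]. *)
Lemma kernel_closed (R : realType) d (X : measurableType d) (Y : Type) (J : finType)
    (L : J -> (X -> R) -> R) (y : J -> X -> Y) (w : J -> X -> R) :
  (forall j, daniell (L j)) -> (forall j, bmeas (w j)) ->
  let A := [set u : Y -> R | (forall j, bmeas (u \o y j)) /\
    \sum_j L j (fun x => u (y j x) * w j x) = 0] in
  lin_closed A /\ bounded_limit_closed A.
Proof.
move=> dL bw A; split=> [a h k [bh hE] [bk kE]|h_ h B Ah hB hh].
  split; first by move=> j; exact: (bmeas_lin a (bh j) (bk j)).
  transitivity (a * 0 + 0 : R); last by rewrite mulr0 addr0.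
  rewrite -[X in a * X]hE -[X in _ = _ + X]kE mulr_sumr -big_split/=; apply: eq_bigr => j _.
  rewrite -(daniell_lin (dL j)) ; [|exact: (bmeasM (bh j))|exact: (bmeasM (bk j))].
  by congr (L j); apply/funext => x; ring.
have bh_ j n : bmeas (h_ n \o y j) by case: (Ah n).
have bh j : bmeas (h \o y j).
  by apply: (bmeas_lim (bh_ j) (B := B)) => [n x|x]; [exact: hB|exact: hh].
split => //.
have c : (fun n => \sum_j L j (fun x => h_ n (y j x) * w j x)) @ \oo -->
    \sum_j L j (fun x => h (y j x) * w j x).
  apply: cvg_sumr => j _; have [_ [C wC]] := bw j.
  apply: ((dL j).2 (fun n x => h_ n (y j x) * w j x) _ (B * C)) => [n|n x|x].
  - exact: (bmeasM (bh_ j n)).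
  - by rewrite normrM ler_pM.
  - by apply: cvgM; [exact: hh|exact: cvg_cst].
rewrite -(cvg_lim _ c)//; apply/cvg_lim => //.
by apply: (eq_cvgr (fun n => (Ah n).2)); exact: cvg_cst.
Qed.

Section TotalExt.
Context {R : realType}.

Definition total (C : set (R -> R)) := forall A, lin_closed A -> bounded_limit_closed A ->
  C `<=` A -> bmeas `<=` A.

Lemma total_ext (C1 C2 : set (R -> R)) (L L' : (R * R -> R) -> R) : daniell L -> daniell L' ->
  C1 `<=` bmeas -> C2 `<=` bmeas -> total C1 -> total C2 ->
  (forall u v, C1 u -> C2 v -> L (tens u v) = L' (tens u v)) ->
  forall h, bmeas h -> L h = L' h.
Proof.
move=> dL dL' C1b C2b t1 t2 LL'.
pose M h := -1 * L' h + L h.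
have dM : daniell M by exact: daniell_comb.
have bs (u : R -> R) (f : R * R -> R) : measurable_fun setT f -> bmeas u -> bmeas (u \o f).
  exact: bmeas_comp.
have M0 (h : R * R -> R) : L h = L' h <-> M h = 0 by rewrite /M; split; lra.
suff E (u v : R -> R) : bmeas u -> bmeas v -> M (tens u v) = 0.
  by apply: tensor_ext => // u v bu bv; apply/M0; exact: E.
have E1 (k w : R -> R) : C2 k -> bmeas w -> M (tens w k) = 0.
  move: k w => {}v {}u Cv; have bv := C2b _ Cv.
  have [|Al Ab] := @kernel_closed R _ (R * R)%type R 'I_1 (fun=> M)
      (fun _ x => x.1) (fun _ x => v x.2) (fun=> dM).
    by move=> _; apply: (bs v) => //; exact: measurable_snd.
  move=> /(t1 _ Al Ab)[|_]; last by rewrite big_ord1.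
  move=> k Ck; split; first by move=> _; apply: bs; [exact: measurable_fst|exact: C1b].
  by rewrite big_ord1; apply/M0; exact: LL'.
move=> bu; have [|Al Ab] := @kernel_closed R _ (R * R)%type R 'I_1 (fun=> M)
    (fun _ x => x.2) (fun _ x => u x.1) (fun=> dM).
  by move=> _; apply: (bs u) => //; exact: measurable_fst.
have sw k : (fun x : R * R => k x.2 * u x.1) = tens u k.
  by apply/funext => x; rewrite /tens mulrC.
move=> /(t2 _ Al Ab)[|_]; last by rewrite big_ord1 sw.
move=> k Ck; split; first by move=> _; apply: bs; [exact: measurable_snd|exact: C2b].
by rewrite big_ord1 sw; exact: E1.
Qed.

Lemma ramp_ext (L L' : (R * R -> R) -> R) : daniell L -> daniell L' ->
  (forall k k', L (tens (ramp k) (ramp k')) = L' (tens (ramp k) (ramp k'))) ->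
  forall h, bmeas h -> L h = L' h.
Proof.
move=> dL dL' LL'; apply: (total_ext (C1 := range ramp) (C2 := range ramp) dL dL').
- by move=> _ [k _ <-]; exact: bmeas_ramp.
- by move=> _ [k _ <-]; exact: bmeas_ramp.
- by move=> A Al Ab Ar h; apply: ramp_total => // k; apply: Ar; exists k.
- by move=> A Al Ab Ar h; apply: ramp_total => // k; apply: Ar; exists k.
- by move=> _ _ [k _ <-] [k' _ <-]; exact: LL'.
Qed.

End TotalExt.

(** * Kernels of the local system *)

Section BoxContinuous.
Context {R : realType}.

(** By uniform continuity on the box, the function is a uniform limit of functions that are constant
    on cells within the box; nothing is assumed of [h] outside it. *)
Lemma bmeas_within_box (a1 b1 a2 b2 : R) (h : R * R -> R) :
  {within box a1 b1 a2 b2, continuous h} -> bmeas (fun x => \1_(box a1 b1 a2 b2) x * h x).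
Proof.
set K := box _ _ _ _ => ch.
have mK : measurable K by exact: measurable_box.
have approx (e : R) : 0 < e -> exists g : R * R -> R, bmeas g /\ forall x, `|g x - \1_K x * h x| <= e.
  move=> e0; have [n hn] := box_unif_continuous ch e0 (fun d d0 => cell_fine a1 a2 b1 b2 d0).
  pose p i : R * R := xget (0, 0) [set y | K y /\ cell a1 a2 n y = i].
  pose k y := \sum_(i < 2 ^ n) h (p i) * \1_[set z | cell a1 a2 n z == i] y.
  exists (fun y => \1_K y * k y); split.
    apply: bmeasM; first exact: bmeas_indic.
    apply: bmeas_sum => i; apply: bmeasZ; apply: bmeas_indic.
    exact: (measurable_cell a1 a2 n (fun c => c == i)).
  move=> y; rewrite -mulrBr indicE; case: (boolP (y \in K)); last first.
    by rewrite mul0r normr0 ltW.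
  rewrite inE mul1r => Ky; have -> : k y = h (p (cell a1 a2 n y)).
    rewrite /k (bigD1 (Ordinal (cell_lt a1 a2 n y)))//= indicE mem_set//=.
    rewrite mulr1 big1 ?addr0// => i iy; rewrite indicE memNset ?mulr0//= => /eqP yi.
    by move/eqP: iy; apply; apply/val_inj.
  have [Kx cx] : K (p (cell a1 a2 n y)) /\ cell a1 a2 n (p (cell a1 a2 n y)) = cell a1 a2 n y.
    by rewrite /p; case: xgetP => [//|/(_ y)[]].
  by rewrite distrC; apply/ltW/hn.
have m0 (m : nat) : 0 < m.+1%:R^-1 :> R by rewrite invr_gt0.
pose g m := sval (cid (approx _ (m0 m))).
have [bg gh] : (forall m, bmeas (g m)) /\ (forall m x, `|g m x - \1_K x * h x| <= m.+1%:R^-1).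
  by split=> m; rewrite /g; case: cid => f /= [].
have [_ [B gB]] := bg 0%N.
have m1 (m : nat) : m.+1%:R^-1 <= 1 :> R by rewrite invf_le1// ler1n.
apply: (bmeas_lim bg (B := 1 + (1 + B))) => [m x|x].
  rewrite -[g m x](subrK (\1_K x * h x)); apply: (le_trans (ler_normD _ _)).
  apply: lerD; first exact: le_trans (gh m x) (m1 m).
  rewrite -[_ * h x](subrK (g 0%N x)); apply: (le_trans (ler_normD _ _)).
  apply: lerD; last exact: gB.
  by rewrite distrC; apply: le_trans (gh 0%N x) (m1 0%N).
apply/cvgrPdistC_le => e e0; near=> m; apply: (le_trans (gh m x)).
apply/ltW; near: m; apply: (cvgr_lt _ (@cvg_harmonic R)); exact: e0.
Unshelve. all: by end_near.
Qed.

Lemma bmeas_within_itv (a b : R) (h : R -> R) :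
  {within `[a, b]%classic, continuous h} -> bmeas (fun x => \1_(`[a, b]%classic) x * h x).
Proof.
move=> ch; have ch2 : {within box 0 0 a b, continuous (h \o snd)}.
  apply/subspace_continuousP => x [_ xab].
  apply: (within_cvg ch xab); last first.
    by apply: cvg_within_filter; exact: continuous_snd.
  by rewrite /within /=; near=> y => -[].
have mf : measurable_fun setT (fun x : R => (0 : R, x)).
  by apply: measurable_fun_pair; [exact: measurable_cst|exact: measurable_id].
have := bmeas_comp mf (bmeas_within_box ch2); congr bmeas; apply/funext => x /=.
by rewrite /box !indicE in_setX mem_set//= in_itv/= lexx.
Unshelve. all: by end_near.
Qed.

End BoxContinuous.

Section Components.
Context {R : realType} {N : nat}.
Variable S : system R N.
Implicit Types (i : option 'I_N) (t x : R).

(* The component None carries a measure on sdom S; the components Some n carry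
   the coefficients of the basis, as point masses at 0. *)
Definition kdom i : set R := if i is Some _ then [set 0] else sdom S.

Definition kern i t x : R := if i is Some n then sbasis S n t else skernel S t x.

Definition mkern i t x : R := kern i t x * \1_(kdom i) x.

End Components.

(** * Generating families: monomials and truncated powers *)

Section MonomialSpan.
Context {R : realType} {N : nat}.
Variable C : set ('I_N -> R).
Hypotheses (Clin : lin_closed C) (Clim : bounded_limit_closed C).
Hypothesis Cmon : forall s : R, s < 0 -> C (fun i => s ^+ i / i`!%:R).

(** By induction on the number of leading coordinates allowed to be nonzero: removing the first [m]
    coordinates of the vector of monomials, dividing by [s ^ m] and letting [s] tend to 0 leaves a
    multiple of the unit vector of index [m]. Only negative [s] are available because they will
    stand for points to the left of the interval. *)
Lemma monomial_span (c : 'I_N -> R) : C c.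
Proof.
suff H m (e : 'I_N -> R) : (forall i : 'I_N, (m <= i)%N -> e i = 0) -> C e.
  by apply: (H N) => i; rewrite leqNgt ltn_ord.
have C0 : C (fun=> 0).
  by have /(lin_closed0 Clin) := Cmon (ltrN10 R).
elim: m e => [|m IH] e em.
  by have -> : e = (fun=> 0) by apply/funext => i; exact: em.
have [Nm|mN] := leqP N m.
  by apply: IH => i mi; have := leq_trans Nm mi; rewrite leqNgt ltn_ord.
pose d (s : R) (i : 'I_N) : R := if (i < m)%N then 0 else s ^+ (i - m) / i`!%:R.
have Cd s : s < 0 -> C (d s).
  move=> s0.
  have C1 : C (fun i : 'I_N => if (i < m)%N then s ^+ i / i`!%:R else 0).
    by apply: IH => i mi; rewrite ltnNge mi.
  have := lin_closedZ Clin (s ^- m) (lin_closedB Clin (Cmon s0) C1).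
  congr C; apply/funext => i; rewrite /d; case: ltnP => im; first by rewrite subrr mulr0.
  rewrite subr0 mulrA; congr (_ / _); rewrite -{1}(subnK im) exprD mulrC mulfK//.
  by rewrite expf_neq0// lt_eqF.
pose s (n : nat) : R := - n.+1%:R^-1.
have s0 n : s n < 0 by rewrite oppr_lt0 invr_gt0.
have slim : s @ \oo --> (0 : R).
  by rewrite -oppr0; apply: cvgN; exact: cvg_harmonic.
have Cm : C (d 0).
  apply: (Clim (fun n => Cd _ (s0 n)) (B := 1)) => [n i|i].
    rewrite /d; case: ifP => _; first by rewrite normr0.
    rewrite normrM normrX normrN normfV !ger0_norm//.
    rewrite -[leRHS](mulr1 1); apply: ler_pM => //.
      by apply: exprn_ile1; rewrite ?invr_ge0// invf_le1// ler1n.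
    by rewrite invf_le1 ?ltr0n ?ler1n fact_gt0.
  rewrite /d; case: ifP => _; first exact: cvg_cst.
  apply: cvgM; last exact: cvg_cst.
  have := @exprn_continuous R (i - m) 0; apply: cvg_comp; exact: slim.
have Ce : C (fun i => if (i < m)%N then e i else 0).
  by apply: IH => i mi; rewrite ltnNge mi.
have := Clin (e (Ordinal mN) * m`!%:R) Cm Ce.
congr C; apply/funext => i; rewrite /d; case: ltnP => im; first by rewrite mulr0 add0r.
rewrite addr0; case: (ltngtP i m) im => // [mi _|im _].
  by rewrite [RHS]em// expr0n subn_eq0 leqNgt mi mul0r mulr0.
rewrite im subnn expr0 mul1r mulfK ?pnatr_eq0 -?lt0n ?fact_gt0//.
by congr e; exact/val_inj.
Qed.

End MonomialSpan.

Section TruncatedPowers.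
Context {R : realType}.
Variables (a b : R) (C : set (R -> R)).
Hypothesis Clin : lin_closed C.
Hypothesis Clim : forall (u_ : nat -> R -> R) u (B : R), (forall n, C (u_ n)) ->
  (forall n x, a <= x <= b -> `|u_ n x| <= B) ->
  (forall x, a <= x <= b -> u_ ^~ x @ \oo --> u x) -> C u.

(** The truncated power [(t - x)_+ ^ k], equal to 1 at [x = t] for [k = 0], in accordance with
    [green]. *)
Definition tpow k (t x : R) : R := if 0 <= t - x then (t - x) ^+ k else 0.

Let pp (s : R) := Num.max 0 s.

Let tpowS k t x : tpow k.+1 t x = pp (t - x) ^+ k.+1.
Proof.
rewrite /tpow /pp; case: leP => // s0.
by rewrite expr0n.
Qed.

(** Differentiation in [t]: [(k + 1) (t - x)_+ ^ k] is the limit, boundedly on [[a, b]], of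
    difference quotients of the next power. Forward differences give the right value 1 at [x = t]
    when [k = 0]. *)
Lemma tpow_down k : (forall t, C (tpow k.+1 t)) -> forall t, C (tpow k t).
Proof.
move=> Ck t; pose h (n : nat) : R := n.+1%:R^-1.
have h0 n : 0 < h n by rewrite invr_gt0.
have h1 n : h n <= 1 by rewrite invf_le1// ler1n.
have hlim : h @ \oo --> (0 : R) by exact: cvg_harmonic.
pose u n x := (h n)^-1 / k.+1%:R * (tpow k.+1 (t + h n) x - tpow k.+1 t x).
have uE n x : u n x = (pp (t + h n - x) - pp (t - x)) / h n *
    ((\sum_(i < k.+1) pp (t + h n - x) ^+ (k - i) * pp (t - x) ^+ i) / k.+1%:R).
  by rewrite /u !tpowS subrXX; ring.
have ppd n x : 0 <= pp (t + h n - x) - pp (t - x) <= h n.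
  rewrite /pp; have := h0 n; case: (leP 0 (t + h n - x)); case: (leP 0 (t - x)); lra.
pose M : R := `|t| + 1 + `|a| + `|b|.
have ppM s x : a <= x <= b -> s <= t + 1 -> 0 <= pp (s - x) <= M.
  move=> /andP[ax xb] st; rewrite /pp le_max lexx/= ge_max.
  have := ler_norm t; have := ler_norm (- a); have := ler_norm b; rewrite normrN.
  have := normr_ge0 t; have := normr_ge0 a; have := normr_ge0 b.
  by rewrite /M => *; apply/andP; split; lra.
apply: (Clim (u_ := u) (B := M ^+ k)).
- move=> n; apply: (lin_closedZ Clin); exact: (lin_closedB Clin).
- move=> n x xab; rewrite uE normrM -[leRHS]mul1r; apply: ler_pM => //.
    have /andP[d0 d1] := ppd n x.
    by rewrite ger0_norm ?divr_ge0// ?(ltW (h0 n))// ler_pdivrMr ?h0// mul1r.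
  have h1n := h1 n.
  have /andP[A0 AM] := ppM (t + h n) x xab ltac:(lra).
  have /andP[B0 BM] := ppM t x xab ltac:(lra).
  rewrite ger0_norm; last by rewrite divr_ge0// sumr_ge0// => i _; rewrite mulr_ge0 ?exprn_ge0.
  rewrite ler_pdivrMr// mulr_natr -[k.+1 in leRHS]card_ord -sumr_const; apply: ler_sum => i _.
  have ik : (i <= k)%N by rewrite -ltnS.
  have -> : M ^+ k = M ^+ (k - i) * M ^+ i by rewrite -exprD subnK.
  apply: ler_pM; rewrite ?exprn_ge0//.
    by apply: lerXn2r; rewrite ?nnegrE// (le_trans A0).
  by apply: lerXn2r; rewrite ?nnegrE// (le_trans B0).
- move=> x _; have [tx|tx] := leP x t; last first.
    rewrite /tpow leNgt subr_lt0 tx /=; apply: cvg_near_cst; near=> n.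
    rewrite /u !tpowS /pp !max_l; [by rewrite subrr mulr0|lra|].
    rewrite addrAC -lerBrDl sub0r opprB; apply/ltW.
    near: n; apply: (cvgr_lt _ hlim); lra.
  have -> : tpow k t x = 1 * ((\sum_(i < k.+1) (t - x) ^+ (k - i) * (t - x) ^+ i) / k.+1%:R).
    rewrite /tpow subr_ge0 tx mul1r (eq_bigr (fun=> (t - x) ^+ k)).
      by rewrite sumr_const card_ord -[_ *+ _]mulr_natr mulfK// pnatr_eq0.
    by move=> i _; rewrite -exprD subnK// -ltnS.
  apply: (eq_cvgr (uE^~ x)); apply: cvgM.
    apply: cvg_near_cst; near=> n; rewrite /pp !max_r; [|by rewrite subr_ge0|by have := h0 n; lra].
    by rewrite (_ : _ - _ - _ = h n) ?divff ?gt_eqF//; lra.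
  apply: cvgM; last exact: cvg_cst.
  apply: cvg_sumr => i _; apply: cvgM; last first.
    by rewrite /pp max_r ?subr_ge0//; exact: cvg_cst.
  have c : (fun n => pp (t + h n - x)) @ \oo --> t - x.
    have E n : pp (t + h n - x) = t - x + h n by rewrite /pp max_r; have := h0 n; lra.
    apply: (eq_cvgr E); rewrite -[X in _ --> X]addr0; apply: cvgD => //; exact: cvg_cst.
  have := @exprn_continuous R (k - i) (t - x); apply: cvg_comp; exact: c.
Unshelve. all: by end_near.
Qed.

(** Descending to [k = 0] yields indicators of closed rays, whose limits include those of open
    rays. *)
Lemma tpow_total k : (forall t, C (tpow k t)) -> bmeas `<=` C.
Proof.
move=> Ck u bu.
have {Ck} C0 : forall t, C (tpow 0 t) by elim: k Ck => // k IH Ck; apply: IH; exact: tpow_down.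
have tpow0E t x : tpow 0 t x = (x <= t)%R%:R by rewrite /tpow subr_ge0; case: ifP.
have tpow0n t x : `|tpow 0 t x| <= 1 by rewrite tpow0E; case: (x <= t); rewrite ?normr1 ?normr0.
apply: (monotone_class (G := RGenInftyO.G (R := R))) => //.
- by move=> u_ v B Cu uB uv; apply: (Clim Cu (B := B)) => // n x _.
- move=> _ _ [x ->] [y ->]; exists (Num.min x y); apply/seteqP; split => z /=; rewrite !in_itv/= lt_min.
    by case=> -> ->.
  by move=> /andP.
- exact: RGenInftyO.measurableE.
(* On [[a, b]], where alone limits are required, the constant 1 is the indicator of the ray ending
   at [b]. *)
- apply: (Clim (u_ := fun=> tpow 0 b) (B := 1)) => // x /andP[_ xb].
  by rewrite tpow0E xb; exact: cvg_cst.
- move=> _ [t ->]; apply: (Clim (u_ := fun n => tpow 0 (t - n.+1%:R^-1)) (B := 1)) => // x _.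
  have hlim : (fun n : nat => n.+1%:R^-1) @ \oo --> (0 : R) by exact: cvg_harmonic.
  rewrite indicE; have [xt|tx] := ltP x t.
    rewrite mem_set; last by rewrite /= in_itv.
    apply: cvg_near_cst; near=> n; rewrite tpow0E.
    suff -> : x <= t - n.+1%:R^-1 by [].
    rewrite lerBrDl -lerBrDr; apply/ltW.
    near: n; apply: (cvgr_lt _ hlim); by rewrite subr_gt0.
  rewrite memNset; last by rewrite /= in_itv/= ltNge tx.
  apply: cvg_near_cst; near=> n; rewrite tpow0E.
  suff -> : (x <= t - n.+1%:R^-1) = false by [].
  apply/negbTE; rewrite -ltNge; apply: lt_le_trans tx.
  by rewrite ltrBlDr ltrDl invr_gt0.
Unshelve. all: by end_near.
Qed.

End TruncatedPowers.

Section LocalSystem.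
Context {R : realType} {N : nat}.
Variables (alpha a b : R).
Let S := local_system alpha N a b.
Let K : set R := `[a, b]%classic.
Implicit Types (i : option 'I_N) (t x : R).

Lemma indic_expR_bound (c : R) x : `|\1_K x * expR (c * x)| <= expR (`|c| * (`|a| + `|b|)).
Proof.
rewrite indicE; case: (boolP (x \in K)); last by rewrite mul0r normr0 expR_ge0.
rewrite inE /K /= in_itv/= mul1r ger0_norm ?expR_ge0// ler_expR => /andP[ax xb].
apply: (le_trans (ler_norm _)); rewrite normrM ler_wpM2l// ler_norml.
have := ler_norm (- a); have := ler_norm b; rewrite normrN.
have := normr_ge0 a; have := normr_ge0 b; lra.
Qed.

Lemma bmeas_indic_expR (c : R) : bmeas (fun x => \1_K x * expR (c * x)).
Proof.
split; last by exists (expR (`|c| * (`|a| + `|b|))); exact: indic_expR_bound.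
apply: measurable_funM; first by apply: measurable_indic; exact: measurable_itv.
apply: continuous_measurable_fun => x; apply: continuous_comp; last exact: continuous_expR.
by apply: cvgM; [exact: cvg_cst|exact: cvg_id].
Qed.

Lemma greenE t x : (0 < N)%N ->
  green alpha N (t - x) = expR (alpha * t) / N.-1`!%:R * (expR (- alpha * x) * tpow N.-1 t x).
Proof.
move=> N0; rewrite /green /tpow; case: ifP => _; last by rewrite !mulr0.
by rewrite mulrBr expRD mulNr; ring.
Qed.

(** Functions on the disjoint union of all components are treated at once. For [t < a] no Green
    kernel with knot in [[a, b]] is active, so evaluation there isolates the basis coefficients;
    once these are subtracted, the kernels leave truncated powers. *)
Lemma local_total (A : set (option 'I_N * R -> R)) : (0 < N)%N ->
  lin_closed A -> bounded_limit_closed A ->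
  (forall t, A (fun y => mkern S y.1 t y.2)) ->
  forall i u, bmeas u -> A (fun y => (y.1 == i)%:R * (\1_(kdom S i) y.2 * u y.2)).
Proof.
move=> N0 Alin Alim Ak.
have A0 := lin_closed0 Alin (Ak 0).
pose dsum (c : 'I_N -> R) (y : option 'I_N * R) := if y.1 is Some n then c n * \1_[set 0] y.2 else 0 : R.
have Ad c : A (dsum c).
  apply: (monomial_span (C := [set c | A (dsum c)])).
  - move=> e h k Ah Ak'; have := Alin e _ _ Ah Ak'.
    by congr A; apply/funext => -[[n|] x]; rewrite /dsum/=; ring.
  - move=> h_ h B Ah hB hh; apply: (Alim _ _ `|B| Ah) => [n [[m|] x]|[[m|] x]]; rewrite /dsum /=.
    + rewrite normrM -[leRHS]mulr1; apply: ler_pM => //; first exact: le_trans (hB _ _) (ler_norm _).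
      by rewrite indicE; case: (_ \in _); rewrite ?normr1 ?normr0.
    + by rewrite normr0.
    + by apply: cvgM; [exact: hh|exact: cvg_cst].
    + exact: cvg_cst.
  (* At [t = a + s] with [s < 0] the component [None] vanishes, and the factor [expR (alpha * s)] of
     the basis is divided out. *)
  - move=> s s0 /=; have := lin_closedZ Alin (expR (- (alpha * s))) (Ak (a + s)).
    congr A; apply/funext => -[[n|] x]; rewrite /dsum /mkern/=.
      rewrite /fundamental_basis addrC addKr mulrA; congr (_ * _).
      by rewrite expRN mulrC mulrAC mulfK ?gt_eqF ?expR_gt0.
    rewrite indicE; case: (boolP (x \in _)); last by rewrite !mulr0.
    rewrite inE /= in_itv/= => /andP[ax _]; rewrite /green ifF ?mul0r ?mulr0//.
    by apply/negbTE; rewrite -ltNge; lra.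
(* With the weight [expR (- alpha * x)], the image of a truncated power is the Green kernel on [K],
   up to a factor depending on [t] only. *)
pose emb (u : R -> R) (y : option 'I_N * R) := if y.1 is None then \1_K y.2 * expR (- alpha * y.2) * u y.2 else 0 : R.
have Ae : bmeas `<=` [set u | A (emb u)].
  apply: (@tpow_total _ a b _ _ _ N.-1).
  - move=> e h k Ah Ak'; have := Alin e _ _ Ah Ak'.
    by congr A; apply/funext => -[[n|] x]; rewrite /emb/=; ring.
  - move=> h_ h B Ah hB hh.
    apply: (Alim _ _ (expR (`|- alpha| * (`|a| + `|b|)) * `|B|) Ah) => [n [[m|] x]|[[m|] x]]; rewrite /emb /=.
    + by rewrite normr0 mulr_ge0// expR_ge0.
    + have [xK|xK] := boolP (x \in K); last by rewrite indicE (negbTE xK) !mul0r normr0 mulr_ge0// expR_ge0.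
      rewrite normrM; apply: ler_pM => //; first exact: indic_expR_bound.
      apply: le_trans (hB _ _ _) (ler_norm _).
      by move: xK; rewrite inE /K /= in_itv.
    + exact: cvg_cst.
    + have [xK|xK] := boolP (x \in K).
        apply: cvgM; [exact: cvg_cst|apply: hh].
        by move: xK; rewrite inE /K /= in_itv.
      by rewrite indicE (negbTE xK) !mul0r; under eq_cvg do rewrite !mul0r; exact: cvg_cst.
  - move=> t /=.
    have := lin_closedB Alin (Ak t) (Ad (fun n => fundamental_basis alpha a n t)).
    move=> /(lin_closedZ Alin (N.-1`!%:R / expR (alpha * t))).
    congr A; apply/funext => -[[n|] x]; rewrite /emb /mkern /dsum/=; first by rewrite subrr mulr0.
    rewrite subr0 greenE//.
    rewrite !mulrA divfK ?gt_eqF ?expR_gt0// divff ?mul1r ?pnatr_eq0 -?lt0n ?fact_gt0//.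
    by ring.
move=> [n|] u bu /=.
  have := Ad (fun m => (m == n)%:R * u 0); congr A; apply/funext => -[[m|] x]; rewrite /dsum/=.
    rewrite -mulrA; congr (_%:R * _) => //.
    rewrite indicE; case: (boolP (x \in _)); last by rewrite mulr0 mul0r.
    by rewrite inE => /= ->; rewrite mulrC.
  by rewrite mul0r.
have bu' : bmeas (fun x => \1_K x * expR (alpha * x) * u x) by apply: bmeasM => //; exact: bmeas_indic_expR.
have := Ae _ bu'; rewrite /=; congr A; apply/funext => -[[m|] x]; rewrite /emb/=; first by rewrite mul0r.
rewrite mul1r indicE; case: (x \in K); last by rewrite !mul0r.
by rewrite !mul1r !mulrA -expRD mulNr addNr expR0 mul1r.
Qed.

Lemma local_bmeas i t : bmeas (mkern S i t).
Proof.
rewrite /mkern; case: i => [n|] /=; first by apply: bmeasZ; exact: bmeas_indic.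
pose G x := (t - x) ^+ N.-1 * expR (alpha * (t - x)) / N.-1`!%:R.
have bG : bmeas (fun x => \1_K x * G x).
  apply: bmeas_within_itv; apply: continuous_subspaceT => x.
  have ct : (fun y : R => t - y) @ x --> t - x by apply: cvgB; [exact: cvg_cst|exact: cvg_id].
  apply: cvgM; last exact: cvg_cst.
  apply: cvgM; first by have := @exprn_continuous R N.-1 (t - x); apply: cvg_comp; exact: ct.
  have := @continuous_expR R (alpha * (t - x)); apply: cvg_comp.
  by apply: cvgM; [exact: cvg_cst|exact: ct].
have := bmeasM (bmeas_indic (measurable_itv `]-oo, t])) bG.
congr bmeas; apply/funext => x; rewrite /green /G subr_ge0 !indicE; have [xt|tx] := leP x t.
  by rewrite mem_set ?mul1r 1?mulrC//= in_itv.
by rewrite memNset ?mul0r//= in_itv/= leNgt tx.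
Qed.

End LocalSystem.

(** * Uniqueness of the representation; atoms *)

Section LocalUnique.
Context {R : realType} {N1 N2 : nat}.
Variables (alpha1 alpha2 a1 b1 a2 b2 : R).
Let S1 := local_system alpha1 N1 a1 b1.
Let S2 := local_system alpha2 N2 a2 b2.
Let J := (option 'I_N1 * option 'I_N2)%type.

(** [local_total] is applied in the first variable with the second kernel fixed, then in the second
    variable. The functions so obtained live on one component in each variable, which reduces the
    sum to a single term. *)
Lemma local_unique (L : J -> (R * R -> R) -> R) : (0 < N1)%N -> (0 < N2)%N ->
  (forall j, daniell (L j)) ->
  (forall j, concentrated (kdom S1 j.1 `*` kdom S2 j.2) (L j)) ->
  (forall t1 t2, \sum_j L j (tens (mkern S1 j.1 t1) (mkern S2 j.2 t2)) = 0) ->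
  forall j h, bmeas h -> L j h = 0.
Proof.
move=> N10 N20 dL cL L0.
have bfst (u : R -> R) : bmeas u -> bmeas (fun x : R * R => u x.1).
  by move=> bu; exact: (bmeas_comp measurable_fst bu).
have bsnd (u : R -> R) : bmeas u -> bmeas (fun x : R * R => u x.2).
  by move=> bu; exact: (bmeas_comp measurable_snd bu).
have mK N (al a b : R) (i : option 'I_N) : measurable (kdom (local_system al N a b) i).
  by case: i => [n|]; [exact: measurable_set1|exact: measurable_itv].
have bD N (al a b : R) (i : option 'I_N) (u : R -> R) : bmeas u ->
    bmeas (fun x => \1_(kdom (local_system al N a b) i) x * u x).
  by move=> bu; apply: bmeasM => //; exact: bmeas_indic.
have E1 t2 i u : bmeas u ->
    \sum_j L j (fun x => (j.1 == i)%:R * (\1_(kdom S1 i) x.1 * u x.1) * mkern S2 j.2 t2 x.2) = 0.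
  move=> bu.
  have [|Al Ab] := @kernel_closed R _ (R * R)%type (option 'I_N1 * R)%type J L
      (fun j x => (j.1, x.1)) (fun j x => mkern S2 j.2 t2 x.2) dL.
    by move=> j; apply: bsnd; exact: local_bmeas.
  have := local_total N10 Al Ab _ i bu; move=> /(_ alpha1 a1 b1) H.
  have /H[] // : forall t, [set u : option 'I_N1 * R -> R | (forall j : J, bmeas (u \o (fun x : R * R => (j.1, x.1)))) /\
      \sum_j L j (fun x => u (j.1, x.1) * mkern S2 j.2 t2 x.2) = 0]
      (fun y => mkern (local_system alpha1 N1 a1 b1) y.1 t y.2).
  move=> t; split; last exact: L0.
  by move=> j; exact: (bfst _ (local_bmeas alpha1 a1 b1 j.1 t)).
have E2 i i' u v : bmeas u -> bmeas v ->
    \sum_j L j (fun x => (j.2 == i')%:R * (\1_(kdom S2 i') x.2 * v x.2) *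
       ((j.1 == i)%:R * (\1_(kdom S1 i) x.1 * u x.1))) = 0.
  move=> bu bv.
  have bDu : bmeas (fun x : R * R => \1_(kdom S1 i) x.1 * u x.1).
    by apply: (bfst (fun x => \1_(kdom S1 i) x * u x)); exact: bD.
  have [|Al Ab] := @kernel_closed R _ (R * R)%type (option 'I_N2 * R)%type J L
      (fun j x => (j.2, x.2)) (fun j x => (j.1 == i)%:R * (\1_(kdom S1 i) x.1 * u x.1)) dL.
    by move=> j; exact: bmeasZ.
  have := local_total N20 Al Ab _ i' bv; move=> /(_ alpha2 a2 b2) H.
  have /H[] // : forall t, [set u0 : option 'I_N2 * R -> R | (forall j : J, bmeas (u0 \o (fun x : R * R => (j.2, x.2)))) /\
      \sum_j L j (fun x => u0 (j.2, x.2) * ((j.1 == i)%:R * (\1_(kdom S1 i) x.1 * u x.1))) = 0]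
      (fun y => mkern (local_system alpha2 N2 a2 b2) y.1 t y.2).
  move=> t; split; first by move=> j; exact: (bsnd _ (local_bmeas alpha2 a2 b2 j.2 t)).
  rewrite -[RHS](E1 t i u bu); apply: eq_bigr => j _; congr (L j).
  by apply/funext => x; rewrite mulrC.
move=> [i i']; apply: (tensor_ext (dL (i, i')) daniell_zero) => u v bu bv.
rewrite -[RHS](E2 i i' u v bu bv) (bigD1 (i, i'))//= [X in _ = _ + X]big1.
  rewrite addr0 !eqxx; apply: (concentrated_eq (dL _) (cL _)).
  - exact: bmeas_tens.
  - by apply: bmeasM; apply: bmeasZ; [apply: (bsnd (fun x => \1_(kdom S2 i') x * v x))|apply: (bfst (fun x => \1_(kdom S1 i) x * u x))]; exact: bD.
  - by move=> x [/= x1 x2]; rewrite /tens !indicE !mem_set//= !mul1r mulrC.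
move=> [k k'] ne; rewrite -[RHS](daniell0 (dL (k, k'))); congr (L (k, k')).
apply/funext => x /=; case: (eqVneq k' i') => [k'i|_]; last by rewrite !mul0r.
case: (eqVneq k i) => [ki|_]; last by rewrite !mul0r mulr0.
by move: ne; rewrite ki k'i eqxx.
Qed.

End LocalUnique.

Lemma measurable_point (R : realType) (p : R * R) : measurable [set p].
Proof.
case: p => p1 p2; have -> : [set (p1, p2)] = [set p1] `*` [set p2].
  by apply/seteqP; split=> [_ ->//|[x y] [/= -> ->]].
by apply: measurableX; exact: measurable_set1.
Qed.

(** * Splitting a positive measure into pieces or point masses *)

Section Atoms.
Context {R : realType}.
Variables (a1 b1 a2 b2 : R).
Let K := box a1 b1 a2 b2.
Implicit Type mu : (R * R -> R) -> R.

Definition splits n mu := exists F : nat -> set (R * R),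
  [/\ forall i, measurable (F i), forall i j, (i < n)%N -> (j < n)%N -> i != j -> F i `&` F j = set0 &
      forall i, (i < n)%N -> 0 < mu \1_(F i)].

Definition dirac_sum n mu := exists (p : nat -> R * R) (w : nat -> R),
  (forall i, (i < n)%N -> K (p i)) /\
  forall h, bmeas h -> mu h = \sum_(i < n) w i * h (p i).

Definition restr (B : set (R * R)) mu : (R * R -> R) -> R := fun h => mu (fun x => \1_B x * h x).

Lemma restr_indic B A mu : restr B mu \1_A = mu \1_(B `&` A).
Proof. by congr mu; apply/funext => x; rewrite indicI. Qed.

Section Restriction.
Variable mu : (R * R -> R) -> R.
Hypotheses (dmu : daniell mu) (pmu : nonneg_functional mu) (cmu : concentrated K mu).
Variable B : set (R * R).
Hypothesis mB : measurable B.

Lemma restr_daniell : daniell (restr B mu).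
Proof. by apply: daniell_mul => //; exact: bmeas_indic. Qed.

Lemma restr_nonneg : nonneg_functional (restr B mu).
Proof.
move=> h bh h0; apply: pmu; first by apply: bmeasM => //; exact: bmeas_indic.
by move=> x; rewrite mulr_ge0// indicE.
Qed.

Lemma restr_concentrated : concentrated K (restr B mu).
Proof.
move=> h bh h0; apply: cmu; first by apply: bmeasM => //; exact: bmeas_indic.
by move=> x Kx; rewrite h0// mulr0.
Qed.

Lemma restr_splits n : 0 < mu \1_B -> splits n (restr (~` B) mu) -> splits n.+1 mu.
Proof.
move=> B0 [F [mF tF F0]].
exists (fun i => if i is i'.+1 then ~` B `&` F i' else B); split.
- by case=> // i; apply: measurableI => //; exact: measurableC.
- move=> [|i] [|j] //; rewrite ?ltnS => ii jj ij.
  + by rewrite setIA setICr set0I.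
  + by rewrite setIAC setICl set0I.
  + by rewrite setIACA tF// setI0.
- by case=> // i; rewrite ltnS -restr_indic; exact: F0.
Qed.

End Restriction.

Lemma indic_mu_le mu (A B : set (R * R)) : daniell mu -> nonneg_functional mu ->
  measurable A -> measurable B -> A `<=` B -> mu \1_A <= mu \1_B.
Proof.
move=> dmu pmu mA mB AB; apply: nonneg_functional_le => //; try exact: bmeas_indic.
move=> x; rewrite !indicE; have [xA|xA] := boolP (x \in A).
  by rewrite mem_set//; apply: AB; rewrite inE in xA.
by rewrite /= ler0n.
Qed.

(* A 0-1 measure charges the intersection of the half-planes, or complements of
   half-planes, of full measure; this intersection is a point. *)
Lemma atomless_split mu : daniell mu -> nonneg_functional mu -> concentrated K mu ->
  (forall p, mu \1_[set p] = 0) -> 0 < mu (fun=> 1) ->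
  exists2 B, measurable B & 0 < mu \1_B /\ 0 < mu \1_(~` B).
Proof.
move=> dmu pmu cmu at0 mu0; apply: contrapT => H.
have H' B : measurable B -> mu \1_B <= 0 \/ mu \1_(~` B) <= 0.
  move=> mB; apply: contrapT => /not_orP[/negP h1 /negP h2]; apply: H.
  by exists B => //; rewrite !ltNge.
pose T k := if mu \1_(halfplane a1 a2 k) <= 0 then ~` halfplane a1 a2 k else halfplane a1 a2 k.
have mT k : measurable (T k).
  rewrite /T; case: ifP => _; last exact: measurable_halfplane.
  by apply: measurableC; exact: measurable_halfplane.
have T0 k : mu \1_(~` T k) <= 0.
  rewrite /T; case: ifP => h; first by rewrite setCK.
  by have [|//] := H' _ (measurable_halfplane a1 a2 k); rewrite h.
have mK : measurable K by exact: measurable_box.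
pose E n := \big[setI/setT]_(k < n) T k.
have mE n : measurable (E n) by exact: bigsetI_measurable.
have ES n : E n.+1 = E n `&` T n by rewrite /E big_ord_recr.
have muE n : mu \1_(E n) = mu (fun=> 1).
  elim: n => [|n IH]; first by rewrite /E big_ord0 indicT.
  rewrite ES -IH.
  apply/eqP; rewrite eq_le; apply/andP; split.
    by apply: indic_mu_le => //; exact: measurableI.
  have : mu (fun x => \1_(E n `&` T n) x + \1_(~` T n) x) <= mu \1_(E n `&` T n).
    rewrite (daniellD dmu) ?gerDl//; try by apply: bmeas_indic => //; first [exact: measurableI|exact: measurableC].
  apply: le_trans; apply: nonneg_functional_le => //.
  - exact: bmeas_indic.
  - by apply: bmeasD; apply: bmeas_indic; [exact: measurableI|exact: measurableC].
  - move=> x; rewrite !indicE in_setI in_setC.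
    by case: (x \in E n); case: (x \in T n); rewrite /= ?addr0 ?add0r.
pose I := \bigcap_k T k.
have mI : measurable I by exact: bigcapT_measurable.
have muI : mu \1_I = mu (fun=> 1).
  have c : (fun n => mu \1_(E n)) @ \oo --> mu \1_I.
    apply: (dmu.2 (fun n => \1_(E n)) _ 1) => [n|n x|x].
    - exact: bmeas_indic.
    - by rewrite indicE; case: (_ \in _); rewrite ?normr1 ?normr0.
    - have [xI|/existsNP[k /not_implyP[_ Tk]]] := pselect (I x).
        rewrite indicE mem_set//; apply: cvg_near_cst; near=> n.
        by rewrite indicE mem_set// /E -bigcap_mkord => k _; exact: xI.
      rewrite indicE memNset; last by move=> /(_ k Logic.I)/Tk.
      apply: cvg_near_cst; exists k.+1 => // n /= kn.
      by rewrite indicE memNset// /E -bigcap_mkord => /(_ k kn)/Tk.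
  rewrite -(cvg_lim _ c)//; under eq_fun do rewrite muE.
  by apply/cvg_lim => //; exact: cvg_cst.
have uniq x y : K x -> K y -> I x -> I y -> x = y.
  move=> Kx Ky Ix Iy.
  have c n : cell a1 a2 n x = cell a1 a2 n y.
    elim: n => //= n ->; congr ((_ : bool) + _)%N.
    have := Ix n Logic.I; have := Iy n Logic.I; rewrite /T; case: ifP => _ /=.
      by move=> h1 h2; rewrite !memNset.
    by move=> h1 h2; rewrite !mem_set.
  have d (e : R) : 0 < e -> `|x.1 - y.1| < e /\ `|x.2 - y.2| < e.
    by move=> /(cell_fine a1 a2 b1 b2)[n /(_ n (leqnn n) x y Kx Ky)]; apply.
  have z (r : R) : (forall e, 0 < e -> `|r| < e) -> r = 0.
    move=> h; apply/eqP; rewrite -normr_eq0; apply/negPn/negP => r0.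
    have := h `|r|; rewrite ltxx lt_def r0 normr_ge0 /= => h'.
    by have := h' isT.
  rewrite [x]surjective_pairing [y]surjective_pairing; congr pair; apply/eqP; rewrite -subr_eq0; apply/eqP/z => e /d[].
    by [].
  by [].
have [[p [Kp Ip]]|nop] := pselect (exists p, K p /\ I p).
  move: mu0; rewrite -muI -(at0 p) (@concentrated_eq _ _ _ _ dmu K \1_I \1_[set p])// ?ltxx//; try by apply: bmeas_indic => //; exact: measurable_point.
  move=> x Kx; rewrite !indicE; have [xI|xI] := pselect (I x).
    by rewrite !mem_set//=; exact: uniq.
  by rewrite !memNset//= => xp; apply: xI; rewrite xp.
move: mu0; rewrite -muI cmu ?ltxx//; first exact: bmeas_indic.
by move=> x Kx; rewrite indicE memNset// => Ix; apply: nop; exists x.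
Unshelve. all: by end_near.
Qed.

(** One piece is cut off, and the rest, still atomless and nonnull, is split again. *)
Lemma atomless_splits n mu : daniell mu -> nonneg_functional mu -> concentrated K mu ->
  (forall p, mu \1_[set p] = 0) -> 0 < mu (fun=> 1) -> splits n mu.
Proof.
elim: n mu => [|n IH] mu dmu pmu cmu at0 mu0.
  by exists (fun=> set0); split.
have [B mB [B0 B1]] := atomless_split dmu pmu cmu at0 mu0.
apply: (restr_splits mB B0); apply: IH.
- by apply: restr_daniell => //; exact: measurableC.
- by apply: restr_nonneg => //; exact: measurableC.
- by apply: restr_concentrated => //; exact: measurableC.
- move=> p; apply/eqP; rewrite eq_le; apply/andP; split.
    rewrite restr_indic -(at0 p); apply: indic_mu_le => //; last exact: measurable_point.
    by apply: measurableI; [exact: measurableC|exact: measurable_point].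
  rewrite restr_indic; apply: pmu; last by move=> x; rewrite indicE.
  by apply: bmeas_indic; apply: measurableI; [exact: measurableC|exact: measurable_point].
- by rewrite /restr; under eq_fun do rewrite mulr1.
Qed.

(** Atoms are removed one at a time, each counting as one piece. If a nonnull remainder without
    atoms is met on the way, it can be cut into as many pieces as desired. In the first alternative
    the same [n] counts points and pieces, so that bounds on pieces become bounds on knots. *)
Lemma dirac_or_split m mu : daniell mu -> nonneg_functional mu -> concentrated K mu ->
  (exists n, [/\ (n <= m)%N, dirac_sum n mu & splits n mu]) \/ splits m.+1 mu.
Proof.
have zero nu : daniell nu -> nonneg_functional nu -> nu (fun=> 1) <= 0 ->
    exists n, [/\ (n <= 0)%N, dirac_sum n nu & splits n nu].
  move=> dnu pnu nu0; exists 0%N; split => //; last by exists (fun=> set0); split.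
  exists (fun=> (0, 0)), (fun=> 0); split => // h bh; rewrite big_ord0.
  have [_ [B hB]] := bh; apply/eqP; rewrite -normr_le0.
  apply: (le_trans (nonneg_functional_norm dnu pnu bh (B := `|B|) _)).
    by move=> x; apply: le_trans (hB x) (ler_norm _).
  by rewrite mulr_ge0_le0.
elim: m mu => [|m IH] mu dmu pmu cmu.
  have [mu0|mu0] := ltP 0 (mu (fun=> 1)); last by left; exact: zero.
  right; exists (fun=> setT); split=> //; first by move=> [|i] [|j].
  by move=> i _; rewrite indicT.
have [mu0|mu0] := ltP 0 (mu (fun=> 1)); last first.
  by left; have [n [n0 dn sn]] := zero mu dmu pmu mu0; exists n; split => //; exact: leq_trans n0 _.
have [[p p0]|nop] := pselect (exists p, 0 < mu \1_[set p]); last first.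
  right; apply: atomless_splits => // p; apply/eqP; rewrite eq_le; apply/andP; split.
    by rewrite leNgt; apply/negP => p0; apply: nop; exists p.
  by apply: pmu; [apply: bmeas_indic; exact: measurable_point|move=> x; rewrite indicE].
have m1 : measurable [set p] by exact: measurable_point.
have mC : measurable (~` [set p]) by exact: measurableC.
have [[n [nm [q [w [Kq qw]] sn]]]|sm] := IH (restr (~` [set p]) mu) (restr_daniell dmu mC)
    (restr_nonneg pmu mC) (restr_concentrated cmu mC); last first.
  by right; exact: restr_splits p0 sm.
left; exists n.+1; split => //; last exact: restr_splits p0 sn.
exists (fun i => if i is i'.+1 then q i' else p), (fun i => if i is i'.+1 then w i' else mu \1_[set p]).
split=> [[_|i]|h bh]; last 1 first.
- rewrite big_ord_recl/=.
  rewrite -(qw _ bh) /restr mulrC -(daniellZ dmu); last exact: bmeas_indic.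
  rewrite -(daniellD dmu).
  + congr mu; apply/funext => x; rewrite !indicE in_setC.
    have [xp|xp] := boolP (x \in [set p]); last by rewrite /= mulr0 add0r mul1r.
    by rewrite /= mul0r mulr1 addr0; rewrite inE in xp; rewrite xp.
  + by apply: bmeasZ; exact: bmeas_indic.
  + by apply: bmeasM => //; exact: bmeas_indic.
- apply: contrapT => Kp; move: p0; rewrite cmu ?ltxx//; first exact: bmeas_indic.
  by move=> x Kx; rewrite indicE memNset// => xp; apply: Kp; rewrite -xp.
- by rewrite ltnS; exact: Kq.
Qed.

End Atoms.

(** * Components of an element of the native space *)

Lemma big_option (V : nmodType) (T : finType) (F : option T -> V) :
  \sum_i F i = F None + \sum_x F (Some x).
Proof.
rewrite (bigD1 None)//=; congr (_ + _).
rewrite (reindex_omap Some id); last by case.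
by apply: eq_bigl => x; rewrite eqxx.
Qed.

Lemma big_option2 (V : nmodType) (T1 T2 : finType) (F : option T1 * option T2 -> V) :
  \sum_j F j = F (None, None) + \sum_x F (Some x, None) + \sum_y F (None, Some y) +
    \sum_x \sum_y F (Some x, Some y).
Proof.
transitivity (\sum_i1 \sum_i2 F (i1, i2)).
  by rewrite pair_big/=; apply: eq_bigr => -[].
rewrite big_option big_option; under [X in _ + X]eq_bigr do rewrite big_option.
by rewrite big_split/= addrACA addrA.
Qed.

Section NativeComponents.
Context {R : realType} {N1 N2 : nat}.
Variables (S1 : system R N1) (S2 : system R N2).
Notation J := (option 'I_N1 * option 'I_N2)%type.
Notation coords := (coords S1 S2).
Notation predual := (predual S1 S2).
Implicit Types (c : coords) (j : J).

Definition jdom j : set (R * R) := kdom S1 j.1 `*` kdom S2 j.2.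

Definition jkern j t1 t2 : R * R -> R := tens (mkern S1 j.1 t1) (mkern S2 j.2 t2).

(* The components that enter the seminorm. *)
Definition penal j : bool := ~~ (isSome j.1 && isSome j.2).

(** All components act on functions on the plane, so that they form one family: measures on a line
    are placed on an axis and coefficients at the origin. *)
Definition comp c j : (R * R -> R) -> R :=
  match j with
  | (None, None) => charge_integral (cm c)
  | (Some n, None) => fun h => charge_integral (cm1 c n) (fun x => h (0, x))
  | (None, Some n) => fun h => charge_integral (cm2 c n) (fun x => h (x, 0))
  | (Some n, Some n') => fun h => cd c n n' * h (0, 0)
  end.

Definition dualfun (h : predual) j : R * R -> R :=
  match j with
  | (None, None) => fun x => \1_(sdom S1 `*` sdom S2) x * sval (hm h) x
  | (Some n, None) => fun x => \1_(sdom S2) x.2 * sval (hm1 h n) x.2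
  | (None, Some n) => fun x => \1_(sdom S1) x.1 * sval (hm2 h n) x.1
  | (Some n, Some n') => fun=> hd h n n'
  end.

(** What makes duality and synthesis integrals of bounded measurable functions; the global and the
    local systems both satisfy it. *)
Record tame := Tame {
  tame_dom1 : measurable (sdom S1) ;
  tame_dom2 : measurable (sdom S2) ;
  tame_kern1 : forall i t, bmeas (mkern S1 i t) ;
  tame_kern2 : forall i t, bmeas (mkern S2 i t) ;
  tame_C01 : forall h : R -> R, C0 (sdom S1) h -> bmeas (fun x => \1_(sdom S1) x * h x) ;
  tame_C02 : forall h : R -> R, C0 (sdom S2) h -> bmeas (fun x => \1_(sdom S2) x * h x) ;
  tame_C0 : forall h : R * R -> R, C0 (sdom S1 `*` sdom S2) h ->
    bmeas (fun x : R * R => \1_(sdom S1 `*` sdom S2) x * h x) }.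

Lemma patch_indic d (X : measurableType d) (D : set X) (h : X -> R) :
  h \_ D = fun x => \1_D x * h x.
Proof.
by apply/funext => x; rewrite patchE indicE; case: (x \in D); rewrite ?mul1r ?mul0r.
Qed.

Lemma charge_RintegralEi d (X : measurableType d) (nu : {charge set X -> \bar R}) (D : set X) (h : X -> R) :
  charge_Rintegral nu D h = charge_integral nu (fun x => \1_D x * h x).
Proof. by rewrite charge_RintegralE patch_indic. Qed.

Lemma duality_comp c h : duality c h = \sum_j comp c j (dualfun h j).
Proof.
rewrite big_option2 /duality !charge_RintegralEi /=; congr (_ + _ + _ + _).
- by apply: eq_bigr => n _; rewrite charge_RintegralEi.
- by apply: eq_bigr => n _; rewrite charge_RintegralEi.
Qed.

Lemma measurable_pair0l : measurable_fun setT (fun x : R => (0 : R, x)).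
Proof. by apply: measurable_fun_pair; [exact: measurable_cst|exact: measurable_id]. Qed.

Lemma measurable_pair0r : measurable_fun setT (fun x : R => (x, 0 : R)).
Proof. by apply: measurable_fun_pair; [exact: measurable_id|exact: measurable_cst]. Qed.

Lemma comp_daniell c j : daniell (comp c j).
Proof.
case: j => -[n|] [n'|] /=.
- by apply: daniell_scale; exact: daniell_eval.
- exact: (daniell_comp (daniell_charge _) measurable_pair0l).
- exact: (daniell_comp (daniell_charge _) measurable_pair0r).
- exact: daniell_charge.
Qed.

Hypothesis tS : tame.

Lemma comp_concentrated c j : concentrated (jdom j) (comp c j).
Proof.
move=> h bh h0; case: j h0 => -[n|] [n'|] h0 /=.
- by rewrite h0 ?mulr0.
- apply: (@concentrated_charge _ _ _ _ (cm1 c n) (tame_dom2 tS) (h \o pair 0)); first exact: (bmeas_comp measurable_pair0l bh).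
  by move=> x x2; apply: h0; split.
- apply: (@concentrated_charge _ _ _ _ (cm2 c n') (tame_dom1 tS) (h \o pair^~ 0)); first exact: (bmeas_comp measurable_pair0r bh).
  by move=> x x2; apply: h0; split.
- apply: (@concentrated_charge _ _ _ _ (cm c)) => //; apply: measurableX; [exact: tame_dom1|exact: tame_dom2].
Qed.

Lemma bmeas_jkern j t1 t2 : bmeas (jkern j t1 t2).
Proof. by apply: bmeas_tens; [exact: tame_kern1|exact: tame_kern2]. Qed.

Lemma bmeas_dualfun h j : bmeas (dualfun h j).
Proof.
case: j => -[n|] [n'|] /=; first exact: bmeas_cst.
- exact: (bmeas_comp measurable_snd (tame_C02 tS (svalP (hm1 h n)))).
- exact: (bmeas_comp measurable_fst (tame_C01 tS (svalP (hm2 h n')))).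
- exact: (tame_C0 tS (svalP (hm h))).
Qed.

Lemma synthesis_comp c t1 t2 : synthesis c t1 t2 = \sum_j comp c j (jkern j t1 t2).
Proof.
have i0 : \1_([set 0] : set R) (0 : R) = 1 :> R by rewrite indicE mem_set.
rewrite big_option2 /synthesis !charge_RintegralEi /=; congr (_ + _ + _ + _).
- congr charge_integral; apply/funext => x; rewrite /jkern /tens /mkern /= !indicE in_setX.
  by rewrite -mulnb natrM; ring.
- apply: eq_bigr => n _; rewrite charge_RintegralEi -(daniellZ (daniell_charge _)).
    congr charge_integral; apply/funext => x; rewrite /jkern /tens /mkern /= i0 mulr1.
    by congr (_ * _); rewrite mulrC.
  by have := tame_kern2 tS None t2; congr bmeas; apply/funext => x; rewrite /mkern mulrC.
- apply: eq_bigr => n _; rewrite charge_RintegralEi -(daniellZr (daniell_charge _)).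
    congr charge_integral; apply/funext => x; rewrite /jkern /tens /mkern /= i0 mulr1.
    by congr (_ * _); rewrite mulrC.
  by have := tame_kern1 tS None t1; congr bmeas; apply/funext => x; rewrite /mkern mulrC.
- apply: eq_bigr => n _; apply: eq_bigr => n' _.
  by rewrite /jkern /tens /mkern /= !i0; ring.
Qed.

Lemma coords_norm_comp c : coords_norm c = \sum_(j | penal j) tvar (comp c j).
Proof.
rewrite big_mkcond big_option2 /penal/= /coords_norm !tvar_charge -[LHS]addr0; congr (_ + _ + _ + _).
- apply: eq_bigr => n _; rewrite tvar_charge.
  by rewrite -(tvar_comp (daniell_charge _) measurable_pair0l measurable_snd).
- apply: eq_bigr => n _; rewrite tvar_charge.
  by rewrite -(tvar_comp (daniell_charge _) measurable_pair0r measurable_fst).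
- by rewrite big1// => n _; rewrite big1.
Qed.

(** The converse of [comp_daniell] and [comp_concentrated]. Elements of the native space, from
    linear combinations to limits, are constructed by prescribing their components. *)
Lemma comp_onto (L : J -> (R * R -> R) -> R) : (forall j, daniell (L j)) ->
  (forall j, concentrated (jdom j) (L j)) ->
  exists c, forall j h, bmeas h -> comp c j h = L j h.
Proof.
move=> dL cL.
have [m0 m0E] := charge_of_daniell (dL (None, None))
  (measurableX (tame_dom1 tS) (tame_dom2 tS)) (cL (None, None)).
have m1ex n : exists m : measure_on R (sdom S2), forall h : R -> R, bmeas h ->
    charge_integral m h = L (Some n, None) (h \o snd).
  apply: charge_of_daniell; [exact: (daniell_comp (dL _) measurable_snd)|exact: tame_dom2|].
  move=> h bh h0; apply: (cL (Some n, None)); first exact: (bmeas_comp measurable_snd bh).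
  by move=> x [_ x2]; exact: h0.
have m2ex n : exists m : measure_on R (sdom S1), forall h : R -> R, bmeas h ->
    charge_integral m h = L (None, Some n) (h \o fst).
  apply: charge_of_daniell; [exact: (daniell_comp (dL _) measurable_fst)|exact: tame_dom1|].
  move=> h bh h0; apply: (cL (None, Some n)); first exact: (bmeas_comp measurable_fst bh).
  by move=> x [x1 _]; exact: h0.
exists (Coords m0 (fun n => sval (cid (m1ex n))) (fun n => sval (cid (m2ex n)))
  (\matrix_(n, n') L (Some n, Some n') (fun=> 1))) => -[[n|] [n'|]] h bh /=.
- rewrite mxE -(daniellZr (dL _)); last exact: bmeas_cst.
  apply: (concentrated_eq (dL _) (cL _)) => //; first by apply: bmeasM; exact: bmeas_cst.
  by move=> [x1 x2] [/= -> ->]; rewrite mul1r.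
- case: cid => m /= mE; rewrite mE; last exact: (bmeas_comp measurable_pair0l bh).
  apply: (concentrated_eq (dL _) (cL _)) => //.
    exact: (bmeas_comp measurable_snd (bmeas_comp measurable_pair0l bh)).
  by move=> [x1 x2] [/= -> _].
- case: cid => m /= mE; rewrite mE; last exact: (bmeas_comp measurable_pair0r bh).
  apply: (concentrated_eq (dL _) (cL _)) => //.
    exact: (bmeas_comp measurable_fst (bmeas_comp measurable_pair0r bh)).
  by move=> [x1 x2] [/= _ ->].
- exact: m0E.
Qed.

Lemma coords_comb_ex (a : R) c c' : exists c'', forall j h, bmeas h ->
  comp c'' j h = a * comp c j h + comp c' j h.
Proof.
apply: (@comp_onto (fun j h => a * comp c j h + comp c' j h)) => j.
  by apply: daniell_comb; exact: comp_daniell.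
by move=> h bh h0; rewrite !comp_concentrated// mulr0 addr0.
Qed.

Definition coords_comb (a : R) c c' : coords := sval (cid (coords_comb_ex a c c')).

Lemma comp_comb a c c' j h : bmeas h ->
  comp (coords_comb a c c') j h = a * comp c j h + comp c' j h.
Proof. by rewrite /coords_comb; case: cid => c'' /= E; exact: E. Qed.

Lemma synthesis_comb a c c' : synthesis (coords_comb a c c') = a *: synthesis c + synthesis c'.
Proof.
apply/funext => t1; apply/funext => t2.
rewrite !fctE !synthesis_comp scaler_sumr -big_split/=; apply: eq_bigr => j _.
by rewrite comp_comb//; exact: bmeas_jkern.
Qed.

Lemma duality_comb a c c' h : duality (coords_comb a c c') h = a * duality c h + duality c' h.
Proof.
rewrite !duality_comp mulr_sumr -big_split/=; apply: eq_bigr => j _.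
by rewrite comp_comb//; exact: bmeas_dualfun.
Qed.

Lemma native_comb a f g : native S1 S2 f -> native S1 S2 g -> native S1 S2 (a *: f + g).
Proof.
by move=> [c _ <-] [c' _ <-]; exists (coords_comb a c c') => //; exact: synthesis_comb.
Qed.

Lemma dirac_coords j x : jdom j x -> exists c,
  (forall k h, bmeas h -> comp c k h = (k == j)%:R * h x) /\
  synthesis c = (fun t1 t2 => kern S1 j.1 t1 x.1 * kern S2 j.2 t2 x.2).
Proof.
move=> Dx.
have [c cE] : exists c, forall k h, bmeas h -> comp c k h = (k == j)%:R * h x.
  apply: (@comp_onto (fun k h => (k == j)%:R * h x)) => k.
    by apply: daniell_scale; exact: daniell_eval.
  move=> h bh h0; case: eqP => [kj|_]; last by rewrite mul0r.
  by rewrite h0 ?mulr0// kj.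
exists c; split => //; apply/funext => t1; apply/funext => t2.
rewrite synthesis_comp (bigD1 j)//= big1 ?addr0 => [|k kj].
  rewrite cE ?eqxx ?mul1r; last exact: bmeas_jkern.
  by case: Dx => x1 x2; rewrite /jkern /tens /mkern !indicE !mem_set// !mulr1.
by rewrite cE ?(negbTE kj) ?mul0r//; exact: bmeas_jkern.
Qed.

Lemma native_kern j x : jdom j x -> native S1 S2 (fun t1 t2 => kern S1 j.1 t1 x.1 * kern S2 j.2 t2 x.2).
Proof. by move=> /dirac_coords[c [_ cE]]; exists c. Qed.

End NativeComponents.

(** * Convergence and neighbourhoods in the weak-star topology *)

Section WeakStarCoords.
Context {R : realType} {N1 N2 : nat} {S1 : system R N1} {S2 : system R N2}.

Lemma wcoords_cvg (T : Type) (F : set_system T) (c_ : T -> wcoords S1 S2) (c : wcoords S1 S2) :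
  Filter F -> (forall h, duality (c_ t) h @[t --> F] --> duality c h) -> c_ @ F --> c.
Proof.
move=> FF H A; rewrite nbhsE => -[_ [[C Cop <-] Cc] sCA].
have Cn : nbhs (duality c : {ptws predual S1 S2 -> R}) C by apply: open_nbhs_nbhs; split.
have cv : (fun t => duality (c_ t) : {ptws predual S1 S2 -> R}) @ F -->
    (duality c : {ptws predual S1 S2 -> R}).
  apply/cvg_sup => h U /= [_ [[B oB <-] Bc sBU]].
  have FB : F [set t | B (duality (c_ t) h)] by apply: (H h); apply: open_nbhs_nbhs.
  have FU : F [set t | U (duality (c_ t))] by apply: filterS FB => t Bt; exact: sBU.
  exact: FU.
have FC : F [set t | C (duality (c_ t))] by exact: cv.
have FA : F [set t | A (c_ t)] by apply: filterS FC => t /= Ct; exact: sCA.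
exact: FA.
Qed.

(** The basic sets generate a filter along which every pairing converges, so by [wcoords_cvg] this
    filter contains all neighbourhoods of [c]. *)
Lemma wcoords_nbhs (c : wcoords S1 S2) (A : set (wcoords S1 S2)) : nbhs c A ->
  exists (T : finType) (s : T -> predual S1 S2) (e : R), 0 < e /\
    forall c' : coords S1 S2, (forall i, `|duality c' (s i) - duality c (s i)| < e) -> A c'.
Proof.
pose F : set_system (coords S1 S2) := [set A | exists (T : finType) (s : T -> predual S1 S2) (e : R),
  0 < e /\ forall c' : coords S1 S2, (forall i, `|duality c' (s i) - duality c (s i)| < e) -> A c'].
have FF : Filter F.
  split.
  - by exists void, (fun i : void => match i with end), 1.
  - move=> B C [T [s [e [e0 sB]]]] [T' [s' [e' [e'0 sC]]]].
    exists (T + T')%type, (fun i => match i with inl i => s i | inr i => s' i end), (Num.min e e').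
    split; first by rewrite lt_min e0.
    move=> c' H; split; first by apply: sB => i; have := H (inl i); rewrite lt_min => /andP[].
    by apply: sC => i; have := H (inr i); rewrite lt_min => /andP[].
  - move=> B C BC [T [s [e [e0 sB]]]]; exists T, s, e; split => // c' H.
    by apply: BC; exact: sB.
have : (id : coords S1 S2 -> wcoords S1 S2) @ F --> c.
  apply: wcoords_cvg => h; apply/cvgrPdistC_lt => e e0.
  by exists unit, (fun=> h), e; split => // c' /(_ tt).
by move=> /[apply].
Qed.

End WeakStarCoords.

(** * The global kernels *)

Section NullSpace.
Context {R : realType}.
Variables (alpha a : R).

Definition expmon k (t : R) : R := (t - a) ^+ k * expR (alpha * (t - a)) / k`!%:R.

Lemma is_derive_expmon k (t : R) : is_derive t (1 : R) (expmon k)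
  ((if k is k'.+1 then expmon k' t else 0) + alpha * expmon k t : R).
Proof.
have dx : is_derive t 1 (fun t : R => t - a) 1.
  by have := is_deriveB (is_derive_id t 1) (is_derive_cst a t 1); rewrite subr0.
have de : is_derive t 1 (fun t : R => expR (alpha * (t - a))) (expR (alpha * (t - a)) * alpha).
  have da : is_derive t 1 (fun t : R => alpha * (t - a)) alpha.
    by have := is_deriveZ alpha dx; rewrite /GRing.scale/= mulr1.
  exact: (is_derive1_comp (is_derive_expR _) da).
have := is_deriveZ (k`!%:R^-1) (is_deriveM (is_deriveX k dx) de).
have -> : k`!%:R^-1 \*: ((fun t : R => t - a) ^+ k * (fun t : R => expR (alpha * (t - a)))) = expmon k.
  by apply/funext => s; rewrite /expmon !fctE /GRing.scale/=; rewrite [LHS]mulrC; congr (_ * _).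
move=> H; apply: (is_derive_eq H).
transitivity (k`!%:R^-1 * ((t - a) ^+ k * (expR (alpha * (t - a)) * alpha) +
    expR (alpha * (t - a)) * (k%:R * (t - a) ^+ k.-1 * 1))); first by rewrite fctE.
rewrite /expmon; case: k {H} => [|k] /=; first by rewrite expr0 fact0; field.
rewrite exprS factS natrM; field.
by rewrite nat1r !pnatr_eq0 -lt0n fact_gt0.
Qed.

Lemma derivable_expmon k t : derivable (expmon k) t 1.
Proof. by have [] := is_derive_expmon k t. Qed.

Lemma continuous_expmon k : continuous (expmon k).
Proof.
by move=> t; apply: differentiable_continuous; apply/derivable1_diffP; exact: derivable_expmon.
Qed.

Lemma Lop1_expmon k : Lop1 alpha (expmon k) = if k is k'.+1 then expmon k' else cst 0.
Proof.
apply/funext => t; rewrite /Lop1 derive1E (@derive_val _ _ _ _ _ _ _ (is_derive_expmon k t)).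
by case: k => [|k] /=; rewrite addrK.
Qed.

Lemma iter_Lop1_expmon k m : iter k (Lop1 alpha) (expmon m) =
  if (k <= m)%N then expmon (m - k) else cst 0.
Proof.
have L0 : Lop1 alpha (cst 0) = cst 0.
  by apply/funext => t; rewrite /Lop1 derive1_cst mulr0 subr0.
elim: k => [|k IH] /=; first by rewrite subn0.
rewrite IH; case: (ltngtP k m) => km.
- by rewrite Lop1_expmon -(subnSK km).
- exact: L0.
- by rewrite km subnn Lop1_expmon.
Qed.

Lemma nullspace_expmon N k : (k < N)%N -> nullspace alpha N (expmon k).
Proof.
move=> kN; split=> [m _ t|]; rewrite iter_Lop1_expmon; last by rewrite leqNgt kN.
by case: ifP => _; [exact: derivable_expmon|exact: derivable_cst].
Qed.

End NullSpace.

Lemma green_expmon (R : realType) (alpha : R) N t x :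
  green alpha N (t - x) = if x <= t then expmon alpha x N.-1 t else 0.
Proof. by rewrite /green /expmon subr_ge0. Qed.

Lemma nullspace_continuous (R : realType) (alpha : R) N f : (0 < N)%N ->
  nullspace alpha N f -> continuous f.
Proof.
move=> N0 [df _] t; apply: differentiable_continuous; apply/derivable1_diffP.
exact: (df 0%N).
Qed.

(** Bounded convergence speaks of sequences only; this carries it over to continuity. *)
Lemma seq_continuous (R : realType) (f : R -> R) (x : R) :
  (forall u : nat -> R, u @ \oo --> x -> (fun n => f (u n)) @ \oo --> f x) ->
  f @ x --> f x.
Proof.
move=> H; apply/left_right_continuousP; split.
  by apply/cvg_at_leftP => u [_ ux]; exact: H.
by apply/cvg_at_rightP => u [_ ux]; exact: H.
Qed.

(** * Test functions and the kernels [gphi] *)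

Section TestFunctions.
Context {R : realType}.
Implicit Types (phi : R -> R).

Lemma test_function_continuous phi : test_function phi -> continuous phi.
Proof.
move=> [dphi _] t; apply: differentiable_continuous; apply/derivable1_diffP.
exact: (dphi 0%N).
Qed.

Lemma test_function_support phi : test_function phi ->
  exists C : R, 0 < C /\ forall t, C < `|t| -> phi t = 0.
Proof.
move=> [_ [C cC C0]]; have [M [_ MC]] := compact_bounded cC.
exists (`|M| + 1); split; first by have := normr_ge0 M; lra.
move=> t tM; apply: C0 => Ct.
have : M < `|M| + 1 by have := ler_norm M; lra.
by move=> /MC /(_ t Ct); rewrite /= leNgt tM.
Qed.

Lemma test_function_bmeas phi : test_function phi -> bmeas phi.
Proof.
move=> tphi; have [C [C0 phi0]] := test_function_support tphi.
have := bmeas_within_itv (@continuous_subspaceT _ _ `[- C, C]%classic _ (test_function_continuous tphi)).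
congr bmeas; apply/funext => t; rewrite indicE; case: (boolP (t \in _)); rewrite ?mul1r ?mul0r//.
move=> /negP tC; rewrite phi0// ltNge ler_norml; apply/negP => /= tC'; apply: tC.
by rewrite inE /= in_itv.
Qed.

Definition Iint (D : R) (h : R -> R) : R := Rintegral (@lebesgue_measure R) `[- D, D]%classic h.

Lemma Iint_daniell D : daniell (Iint D).
Proof.
apply: (daniell_Rintegral (mu := @lebesgue_measure R)); first exact: measurable_itv.
by have := lebesgue_measure_itv `[- D, D]; move=> /= ->; case: ifP => _; rewrite ltry.
Qed.

Lemma pairing_Iint (D : R) (f g : R -> R) :
  (forall u, D < `|u| -> f u * g u = 0) ->
  pairing f g = Iint D (fun u => \1_(`[- D, D]%classic) u * f u * g u).
Proof.
move=> fg0; rewrite /pairing /Iint [RHS]Rintegral_mkcond; apply: eq_Rintegral => u _.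
rewrite patchE; have [uD|uD] := boolP (u \in _); first by rewrite indicE uD mul1r.
apply: fg0; rewrite ltNge ler_norml; apply/negP => uD'; move/negP: uD; apply.
by rewrite inE /= in_itv.
Qed.

Lemma bmeas_green (alpha : R) N D : bmeas (fun u : R => \1_(`[- D, D]%classic) u * green alpha N u).
Proof.
have mo : measurable_fun setT (-%R : R -> R) by apply: continuous_measurable_fun; exact: opp_continuous.
have := bmeas_comp mo (local_bmeas (N := N) alpha (- D) D None 0).
congr bmeas; apply/funext => u /=; rewrite /mkern /= sub0r opprK mulrC; congr (_ * _).
by rewrite !indicE; congr (_ _)%:R; apply/idP/idP; rewrite !inE /= !in_itv/= => /andP[]; lra.
Qed.

Variables (alpha : R) (N : nat) (q phi : 'I_N -> R -> R).
Hypothesis N0 : (0 < N)%N.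
Hypothesis sys : biorthogonal_system alpha q phi.

Definition acoef n x : R := pairing (green alpha N) (fun u => phi n (u + x)).

Let tphi n : test_function (phi n). Proof. by case: sys. Qed.

Let qnull n : nullspace alpha N (q n). Proof. by case: sys => -[]. Qed.

Let qcont n : continuous (q n). Proof. exact: (nullspace_continuous N0 (qnull n)). Qed.

(** Along a sequence converging to [x], the translates of [phi n] are supported in a common
    interval, where bounded convergence applies. *)
Lemma acoef_continuous n : continuous (acoef n).
Proof.
move=> x; apply: seq_continuous => u ux.
have [C [C0 phi0]] := test_function_support (tphi n).
have [r ur] : exists r : R, forall k, `|u k| <= r.
  have [M [_ Mu]] := cvg_seq_bounded ((cvg_ex _).2 (ex_intro _ x ux)).
  by exists (`|M| + 1) => k; apply: Mu => //; have := ler_norm M; lra.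
pose D : R := C + r + `|x|.
have r0 : 0 <= r := le_trans (normr_ge0 _) (ur 0%N).
have aE y : `|y| <= r + `|x| -> acoef n y =
    Iint D (fun v => \1_(`[- D, D]%classic) v * green alpha N v * phi n (v + y)).
  move=> yr; apply: pairing_Iint => v Dv; rewrite phi0 ?mulr0//.
  have : `|v| <= `|v + y| + `|y| by rewrite -{1}(addrK y v); exact: ler_normB.
  by move: Dv; rewrite /D; lra.
rewrite (aE x); last by lra.
have uE k : `|u k| <= r + `|x| by have := ur k; have := normr_ge0 x; lra.
apply: (eq_cvgr (fun k => aE (u k) (uE k))).
have [_ [B phiB]] := test_function_bmeas (tphi n).
have bg := bmeas_green alpha N D; have [_ [B' gB]] := bg.
have bphi (y : R) : bmeas (fun v : R => phi n (v + y)).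
  apply: (@bmeas_comp _ _ _ _ _ (fun v : R => v + y)); last exact: test_function_bmeas.
  by apply: measurable_funD; [exact: measurable_id|exact: measurable_cst].
apply: ((Iint_daniell D).2 (fun k v => \1_(`[- D, D]%classic) v * green alpha N v * phi n (v + u k)) _ (B' * B)).
- by move=> k; apply: bmeasM.
- by move=> k v; rewrite normrM ler_pM.
- move=> v; apply: cvgM; first exact: cvg_cst.
  have := @test_function_continuous _ (tphi n) (v + x); apply: cvg_comp.
  by apply: cvgD => //; exact: cvg_cst.
Qed.

Lemma pairing_null n m : pairing (q n) (phi m) = (n == m)%:R.
Proof. by case: sys. Qed.

(* Far to the left of the supports, the causal Green function coincides with an
   element of the null space, which biorthogonality reproduces. *)
Lemma acoef_left n x C (b : 'I_N -> R) : 0 < C -> (forall t, C < `|t| -> phi n t = 0) -> x < - C ->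
  expmon alpha x N.-1 = (fun t => \sum_m b m * q m t) -> acoef n x = b n.
Proof.
move=> C0 phi0 xC xE.
have cphi := test_function_continuous (tphi n).
pose D : R := C + `|x|.
have xD : x = - `|x| by rewrite ltr0_norm ?opprK//; lra.
have e1 : acoef n x = Rintegral (@lebesgue_measure R) `[0, D]%classic
    (fun u => expmon alpha x N.-1 (u + x) * phi n (u + x)).
  rewrite /acoef /pairing [RHS]Rintegral_mkcond; apply: eq_Rintegral => u _; rewrite patchE.
  have [uD|uD] := boolP (u \in _).
    rewrite inE /= in_itv/= in uD; have /andP[u0 _] := uD.
    have := green_expmon alpha N (u + x) x; rewrite addrK => ->.
    by rewrite lerDr u0.
  have [u0|u0] := ltP u 0; first by rewrite /green leNgt u0 mul0r.
  rewrite phi0 ?mulr0// lter_normr; apply/orP; left.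
  move/negP: uD => uD; rewrite ltNge; apply/negP => h; apply: uD.
  by rewrite inE /= in_itv/= u0 /D; lra.
have e2 : pairing (expmon alpha x N.-1) (phi n) = Rintegral (@lebesgue_measure R) `[x, D + x]%classic
    (fun v => expmon alpha x N.-1 v * phi n v).
  rewrite /pairing [RHS]Rintegral_mkcond; apply: eq_Rintegral => v _; rewrite patchE.
  have [//|vD] := boolP (v \in _).
  rewrite phi0 ?mulr0// ltNge ler_norml; apply/negP => h; move/negP: vD; apply.
  by rewrite inE /= in_itv/= /D; lra.
have sub : Rintegral (@lebesgue_measure R) `[x, D + x]%classic (fun v => expmon alpha x N.-1 v * phi n v) =
   Rintegral (@lebesgue_measure R) `[0, D]%classic (fun u => expmon alpha x N.-1 (u + x) * phi n (u + x)).
  have F1 : derive1 (fun u : R => u + x) = cst 1.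
    apply/funext => u; rewrite derive1E; apply: derive_val.
    by have := is_deriveD (is_derive_id u 1) (is_derive_cst x u 1); rewrite addr0.
  have D0 : 0 <= D by rewrite /D addr_ge0// ltW.
  have := @integration_by_substitution_increasing R (fun u => u + x)
    (fun v => expmon alpha x N.-1 v * phi n v) 0 D D0.
  rewrite F1 add0r /Rintegral => ->.
  - by congr fine; apply: eq_integral => u _; rewrite /= !fctE /= mulr1.
  - by move=> u v _ _ uv; rewrite ltrD2r.
  - by move=> u _; exact: cvg_cst.
  - exact: is_cvg_cst.
  - exact: is_cvg_cst.
  - have cs : continuous (fun u : R => u + x).
      by move=> u; apply: cvgD; [exact: cvg_id|exact: cvg_cst].
    split; last 2 first.
    + by apply: cvg_at_right_filter; exact: cs.
    + by apply: cvg_at_left_filter; exact: cs.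
    by move=> u _; apply: derivableD; [exact: derivable_id|exact: derivable_cst].
  - apply: continuous_subspaceT => v; apply: cvgM; last exact: cphi.
    exact: continuous_expmon.
rewrite e1 -sub -e2 xE (@pairing_Iint C); last by move=> u /phi0 ->; rewrite mulr0.
have bq m : bmeas (fun u => \1_(`[- C, C]%classic) u * q m u).
  by apply: bmeas_within_itv; apply: continuous_subspaceT; exact: qcont.
have bphi := test_function_bmeas (tphi n).
have -> : (fun u => \1_(`[- C, C]%classic) u * (\sum_m b m * q m u) * phi n u) =
    (fun u => \sum_m b m * (\1_(`[- C, C]%classic) u * q m u * phi n u)).
  by apply/funext => u; rewrite mulr_sumr mulr_suml; apply: eq_bigr => m _; ring.
rewrite (daniell_sum (Iint_daniell C)); last by move=> m; apply: bmeasZ; exact: bmeasM.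
rewrite (bigD1 n)//= big1 => [|m mn].
  rewrite addr0 (daniellZ (Iint_daniell C)); last exact: bmeasM.
  by rewrite -pairing_Iint ?pairing_null ?eqxx ?mulr1// => u /phi0 ->; rewrite mulr0.
rewrite (daniellZ (Iint_daniell C)); last exact: bmeasM.
by rewrite -pairing_Iint ?pairing_null ?(negbTE mn) ?mulr0// => u /phi0 ->; rewrite mulr0.
Qed.

Lemma acoef_right n x C : 0 < C -> (forall t, C < `|t| -> phi n t = 0) -> C < x -> acoef n x = 0.
Proof.
move=> C0 phi0 xC.
have E u : green alpha N u * phi n (u + x) = 0.
  have [u0|u0] := ltP u 0; first by rewrite /green leNgt u0 mul0r.
  by rewrite phi0 ?mulr0// lter_normr; apply/orP; left; lra.
rewrite /acoef (@pairing_Iint 0) => [|u _]; last exact: E.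
rewrite -[RHS](daniell0 (Iint_daniell 0)); congr Iint; apply/funext => u.
by rewrite -mulrA E mulr0.
Qed.

Lemma support_common : exists C : R, 0 < C /\ forall n t, C < `|t| -> phi n t = 0.
Proof.
pose C n := sval (cid (test_function_support (tphi n))).
have C0 n : 0 < C n /\ forall t, C n < `|t| -> phi n t = 0 by rewrite /C; case: cid.
exists (1 + \sum_n C n); split.
  by rewrite ltr_pwDl// sumr_ge0// => n _; apply/ltW; case: (C0 n).
move=> n t tC; have [_] := C0 n; apply; apply: le_lt_trans tC.
rewrite (bigD1 n)//= addrCA lerDl addr_ge0// sumr_ge0// => m _; apply/ltW; by case: (C0 m).
Qed.

(** The kernel vanishes for large [|x|]: to the right both terms do by causality, to the left the
    Green function is at [t] a null-space element whose coefficients are exactly those subtracted.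
    On the remaining interval the coefficients are continuous. *)
Lemma gphi_bmeas t : bmeas (gphi alpha q phi t).
Proof.
have [C [C0 phi0]] := support_common.
pose D : R := C + `|t| + 1.
have g0 x : D < `|x| -> gphi alpha q phi t x = 0.
  rewrite /gphi lter_normr => /orP[xD|xD].
    rewrite big1 => [|n _]; last first.
      rewrite -/(acoef n x) (acoef_right (C := C)) ?mul0r//; first exact: phi0.
      by have := normr_ge0 t; move: xD; rewrite /D; lra.
    rewrite green_expmon subr0 ifF//; apply/negbTE; rewrite -ltNge.
    by have := ler_norm t; move: xD; rewrite /D; lra.
  have xt : x <= t by have := ler_norm (- t); rewrite normrN; move: xD; rewrite /D; lra.
  have [[_ Hb] _ _] := sys.
  have [b [bE _]] := Hb _ (nullspace_expmon alpha x (etrans (ltn_predL N) N0)).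
  rewrite green_expmon xt bE; apply/eqP; rewrite subr_eq0; apply/eqP; apply: eq_bigr => n _; congr (_ * _).
  apply/esym/(acoef_left (C := C)) => //; first exact: phi0.
  by have := normr_ge0 t; move: xD; rewrite /D; lra.
pose K := `[- D, D]%classic : set R.
have ba n : bmeas (fun x => \1_K x * acoef n x).
  by apply: bmeas_within_itv; apply: continuous_subspaceT; exact: acoef_continuous.
have := bmeasB (local_bmeas (N := N) alpha (- D) D None t)
  (bmeas_sum (index_enum _) xpredT (fun n => bmeasZ (q n t) (ba n))).
congr bmeas; apply/funext => x; rewrite /mkern /= -/K.
have [xK|xK] := boolP (x \in K).
  rewrite /gphi !indicE xK mulr1; congr (_ - _); apply: eq_bigr => n _.
  by rewrite mul1r mulrC.
rewrite g0; last first.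
  rewrite ltNge ler_norml; apply/negP => h; move/negP: xK; apply.
  by rewrite inE /K /= in_itv.
by rewrite !indicE (negbTE xK) mulr0 big1 ?subr0// => n _; rewrite mul0r mulr0.
Qed.

End TestFunctions.

(** * Change of basis between the global and the local system *)

Section Tame.
Context {R : realType}.

Lemma C0_bounded (T : topologicalType) (h : T -> R) : C0 setT h -> exists B : R, forall x, `|h x| <= B.
Proof.
move=> [ch /(_ 1 ltr01)[C cC C1]].
have chC : {within C, continuous h} by apply: continuous_subspaceW ch => x _.
have [M [_ MC]] := compact_bounded (continuous_compact chC cC).
exists (`|M| + 1) => x; have [Cx|nCx] := pselect (C x).
  by apply: (MC (`|M| + 1)); [have := ler_norm M; lra|exists x].
by apply: (le_trans (ltW (C1 x I nCx))); have := normr_ge0 M; lra.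
Qed.

Lemma bmeas_exhaust d (X : measurableType d) (h : X -> R) (K : nat -> set X) (B : R) :
  (forall n, bmeas (fun x => \1_(K n) x * h x)) -> (forall x, \forall n \near \oo, K n x) ->
  (forall x, `|h x| <= B) -> bmeas h.
Proof.
move=> bh hK hB; apply: (bmeas_lim bh (B := B)) => [n x|x].
  rewrite indicE; case: (x \in K n); rewrite ?mul1r// mul0r normr0.
  exact: le_trans (hB x).
apply: cvg_near_cst; near=> n; rewrite indicE mem_set ?mul1r//; near: n; exact: hK.
Unshelve. all: by end_near.
Qed.

Lemma near_itv (x : R) : \forall n \near \oo, `[- n%:R, n%:R]%classic x.
Proof.
exists (Num.trunc `|x|).+1 => // n /= xn; rewrite in_itv/= -ler_norml.
have /andP[_ h] := truncn_itv (normr_ge0 x).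
by apply: ltW (lt_le_trans h _); rewrite ler_nat.
Qed.

Lemma C0_bmeas1 (h : R -> R) : C0 setT h -> bmeas h.
Proof.
move=> ch; have [B hB] := C0_bounded ch.
apply: (@bmeas_exhaust _ _ h (fun n => `[- n%:R, n%:R]%classic) B) => // [n|x]; last exact: near_itv.
by apply: bmeas_within_itv; apply: continuous_subspaceW ch.1 => x _.
Qed.

Lemma C0_bmeas2 (h : R * R -> R) : C0 setT h -> bmeas h.
Proof.
move=> ch; have [B hB] := C0_bounded ch.
apply: (@bmeas_exhaust _ _ h (fun n => box (- n%:R) n%:R (- n%:R) n%:R) B) => // [n|x].
  by apply: bmeas_within_box; apply: continuous_subspaceW ch.1 => x _.
by have := near_itv x.1; have := near_itv x.2; apply: filterS2 => n; split.
Qed.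

Lemma tame_local N1 N2 (alpha1 alpha2 a1 b1 a2 b2 : R) :
  tame (local_system alpha1 N1 a1 b1) (local_system alpha2 N2 a2 b2).
Proof.
split.
- exact: measurable_itv.
- exact: measurable_itv.
- by move=> i t; exact: local_bmeas.
- by move=> i t; exact: local_bmeas.
- by move=> h [ch _]; exact: bmeas_within_itv.
- by move=> h [ch _]; exact: bmeas_within_itv.
- by move=> h [ch _]; exact: bmeas_within_box.
Qed.

Lemma global_bmeas (alpha : R) N (q phi : 'I_N -> R -> R) i t : (0 < N)%N ->
  biorthogonal_system alpha q phi -> bmeas (mkern (global_system alpha q phi) i t).
Proof.
move=> N0 sys; rewrite /mkern; case: i => [n|] /=; first by apply: bmeasZ; exact: bmeas_indic.
have := gphi_bmeas N0 sys t; congr bmeas; apply/funext => x.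
by rewrite indicT mulr1.
Qed.

Lemma tame_global N1 N2 (alpha1 alpha2 : R) (q1 phi1 : 'I_N1 -> R -> R) (q2 phi2 : 'I_N2 -> R -> R) :
  (0 < N1)%N -> (0 < N2)%N ->
  biorthogonal_system alpha1 q1 phi1 -> biorthogonal_system alpha2 q2 phi2 ->
  tame (global_system alpha1 q1 phi1) (global_system alpha2 q2 phi2).
Proof.
move=> N10 N20 sys1 sys2; split => //=.
- by move=> i t; exact: global_bmeas.
- by move=> i t; exact: global_bmeas.
- move=> h /C0_bmeas1; congr bmeas; apply/funext => x; by rewrite indicT mul1r.
- move=> h /C0_bmeas1; congr bmeas; apply/funext => x; by rewrite indicT mul1r.
- by move=> h; rewrite setXTT => /C0_bmeas2; congr bmeas; apply/funext => x; rewrite indicT mul1r.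
Qed.

End Tame.

(** * Linear algebra for the data functional *)

Section FunctionalFactor.
Context {R : realType} {C : Type} {V : lmodType R}.
Variable comb : R -> C -> C -> C.

(** A linear map vanishing on the common kernel of finitely many functionals factors through them.
    [comb] stands for the linear structure, which exists on coordinates only up to a choice. *)
Lemma functional_factor (n : nat) (f : nat -> C -> R) (g : C -> V) :
  (forall i a c c', f i (comb a c c') = a * f i c + f i c') ->
  (forall a c c', g (comb a c c') = a *: g c + g c') ->
  (forall c, (forall i, (i < n)%N -> f i c = 0) -> g c = 0) ->
  exists w : nat -> V, forall c, g c = \sum_(i < n) f i c *: w i.
Proof.
move=> lf; elim: n g => [|n IH] g lg ker.
  by exists (fun=> 0) => c; rewrite big_ord0 ker.
have [[c1 [c1z c1n]]|no] := pselect (exists c1, (forall i, (i < n)%N -> f i c1 = 0) /\ f n c1 != 0).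
  (* Subtracting a multiple of [g c1] removes the dependence on [f n], so the first [n] functionals
     suffice. *)
  have [||w wE] := IH (fun c => g c - (f n c / f n c1) *: g c1).
  - move=> a c c'; rewrite lf lg mulrDl scalerDl scalerBr -mulrA scalerA opprD addrACA.
    by [].
  - move=> c cz; have := ker (comb (- (f n c / f n c1)) c1 c).
    rewrite lg scaleNr addrC => -> // i; rewrite ltnS leq_eqVlt => /predU1P[->|iltn].
      by rewrite lf mulNr divfK// addNr.
    by rewrite lf (c1z i iltn) (cz i iltn) mulr0 addr0.
  exists (fun i => if i == n then (f n c1)^-1 *: g c1 else w i) => c.
  rewrite big_ord_recr/= eqxx scalerA; apply/eqP; rewrite -subr_eq; apply/eqP; rewrite wE.
  by apply: eq_bigr => i _; rewrite (ltn_eqF (ltn_ord i)).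
have [|w wE] := IH g lg.
  move=> c cz; apply: ker => i; rewrite ltnS leq_eqVlt => /predU1P[->|iltn]; last exact: cz.
  by apply/eqP; apply: contrapT => /negP h; apply: no; exists c.
exists (fun i => if i == n then 0 else w i) => c.
rewrite big_ord_recr/= eqxx scaler0 addr0 wE.
by apply: eq_bigr => i _; rewrite (ltn_eqF (ltn_ord i)).
Qed.

End FunctionalFactor.

(** A matrix of maximal rank among those with row space inside [W] has row space [W]. *)
Lemma max_subspace (R : fieldType) M (W : set 'rV[R]_M) : W 0 ->
  (forall a u v, W u -> W v -> W (a *: u + v)) ->
  exists A : 'M[R]_M, forall v, W v <-> (v <= A)%MS.
Proof.
move=> W0 Wlin.
pose P n := `[< exists A : 'M[R]_M, (forall v : 'rV_M, (v <= A)%MS -> W v) /\ \rank A = n >].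
have exP : exists n, P n.
  exists 0%N; apply/asboolP; exists 0; split; last exact: mxrank0.
  by move=> v; rewrite submx0 => /eqP ->.
have bP n : P n -> (n <= M)%N by move=> /asboolP[A [_ <-]]; exact: rank_leq_row.
case: (ex_maxnP exP bP) => n /asboolP[A [AW An]] nmax.
exists A => v; split; last exact: AW.
move=> Wv; apply: contrapT => /negP vA.
have AvP : P (\rank (A + v)%MS).
  apply/asboolP; exists (A + v)%MS; split => // u /sub_addsmxP[[u1 u2]/= ->].
  have := Wlin (u2 0 0) v (u1 *m A) Wv (AW _ (submxMl _ _)).
  rewrite addrC; suff -> : u2 *m v = u2 0 0 *: v by [].
  by apply/rowP => i; rewrite !mxE big_ord1.
have := nmax _ AvP; rewrite -An leqNgt; apply/negP; rewrite negbK.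
apply: rank_ltmx; rewrite ltmxE addsmxSl/=; apply/negP => h.
by move/negP: vA; apply; apply: submx_trans h; exact: addsmxSr.
Qed.

Section Change.
Context {R : realType} {N : nat}.
Variables (alpha a b : R) (q phi : 'I_N -> R -> R).
Hypotheses (N0 : (0 < N)%N) (sys : biorthogonal_system alpha q phi).
Let G := global_system alpha q phi.
Let L := local_system alpha N a b.

Let expand f : nullspace alpha N f -> exists c : 'I_N -> R, f = (fun t => \sum_m c m * q m t).
Proof. by case: sys => -[_ H] _ _ /H[c [cE _]]; exists c. Qed.

Definition proj0 (k : option 'I_N) (x : R) : R := if k is Some _ then 0 else x.

Lemma change_kern : exists T : option 'I_N -> option 'I_N -> R -> R,
  (forall i k, continuous (T i k)) /\
  forall i t x, kern L i t x = \sum_k T i k x * kern G k t x.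
Proof.
pose P n := sval (cid (expand (nullspace_expmon alpha a (ltn_ord n)))).
have PE (n : 'I_N) : expmon alpha a n = (fun t => \sum_m P n m * q m t).
  by rewrite /P; case: cid.
exists (fun i k x => match i, k with
  | None, None => 1 | None, Some n => acoef alpha phi n x
  | Some n, None => 0 | Some n, Some m => P n m end); split.
  move=> [n|] [m|] x; try exact: cvg_cst.
  exact: acoef_continuous sys _ _.
move=> [n|] t x; rewrite big_option /=; first by rewrite mul0r add0r -[LHS]/(expmon alpha a n t) PE.
by rewrite mul1r /gphi subrK.
Qed.

(** The points [t = a + s] with [s < 0] already give, by [monomial_span], that [c] is orthogonal to
    every vector. *)
Lemma expmon_indep (c : 'I_N -> R) : (forall t, \sum_n c n * expmon alpha a n t = 0) -> forall n, c n = 0.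
Proof.
move=> c0 n.
have /(_ (fun m => (m == n)%:R)) : forall d, [set d : 'I_N -> R | \sum_m c m * d m = 0] d.
  apply: monomial_span.
  - move=> e h k /= h0 k0; transitivity (e * \sum_m c m * h m + \sum_m c m * k m).
      by rewrite mulr_sumr -big_split/=; apply: eq_bigr => m _; ring.
    by rewrite h0 k0 mulr0 addr0.
  - move=> h_ h B /= h0 _ hh.
    have cv : (fun n => \sum_m c m * h_ n m) @ \oo --> \sum_m c m * h m.
      by apply: cvg_sumr => m _; apply: cvgM; [exact: cvg_cst|exact: hh].
    rewrite -(cvg_lim _ cv)//; apply/cvg_lim => //.
    by apply: (eq_cvgr h0); exact: cvg_cst.
  - move=> s s0 /=; have := c0 (a + s); rewrite /expmon addrAC subrr add0r => cs.
    apply: (mulIf (x := expR (alpha * s))); first by rewrite gt_eqF// expR_gt0.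
    rewrite mul0r -[RHS]cs mulr_suml; apply: eq_bigr => m _; ring.
rewrite /= (bigD1 n)//= eqxx mulr1 big1 ?addr0// => m mn.
by rewrite (negbTE mn) mulr0.
Qed.

Lemma basis_expmon n : exists c : 'I_N -> R, q n = (fun t => \sum_m c m * expmon alpha a m t).
Proof.
pose P : 'M[R]_N := \matrix_(n, m) sval (cid (expand (nullspace_expmon alpha a (ltn_ord n)))) m.
have PE m t : expmon alpha a (m : 'I_N) t = \sum_k P m k * q k t.
  under eq_bigr do rewrite mxE; by case: cid => c /= ->.
have Pu : P \in unitmx.
  rewrite -row_free_unit; apply: inj_row_free => v vP; apply/rowP => i; rewrite mxE.
  apply: (expmon_indep (c := fun i => v 0 i)) => t.
  under eq_bigr do rewrite PE mulr_sumr.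
  rewrite exchange_big/= big1// => k _.
  under eq_bigr do rewrite mulrA.
  rewrite -mulr_suml; have := congr1 (fun u : 'rV[R]_N => u 0 k) vP.
  by rewrite !mxE => ->; rewrite mul0r.
exists (fun m => invmx P n m); apply/funext => t.
under eq_bigr do rewrite PE mulr_sumr.
rewrite exchange_big/= (bigD1 n)//=.
have E k : \sum_i invmx P n i * (P i k * q k t) = (n == k)%:R * q k t.
  under eq_bigr do rewrite mulrA.
  rewrite -mulr_suml; congr (_ * _); have := congr1 (fun A : 'M[R]_N => A n k) (mulVmx Pu).
  by rewrite !mxE.
by rewrite E eqxx mul1r big1 ?addr0// => k kn; rewrite E eq_sym (negbTE kn) mul0r.
Qed.

(* The linear span of the functions kern S i ^~ x, for knots x in kdom S i. *)
Definition kspan (S : system R N) (u : R -> R) := forall P : set (R -> R), P (fun=> 0) ->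
  (forall c f g, P f -> P g -> P (fun t => c * f t + g t)) ->
  (forall i x, kdom S i x -> P (kern S i ^~ x)) -> P u.

Lemma kspan0 S : kspan S (fun=> 0). Proof. by move=> P. Qed.

Lemma kspan_lin S c f g : kspan S f -> kspan S g -> kspan S (fun t => c * f t + g t).
Proof. by move=> sf sg P P0 Pl Pk; exact: (Pl c f g (sf P P0 Pl Pk) (sg P P0 Pl Pk)). Qed.

Lemma kspan_kern S i x : kdom S i x -> kspan S (kern S i ^~ x).
Proof. by move=> Dx P P0 Pl; apply. Qed.

Lemma kspan_sum S (c : 'I_N -> R) (f : 'I_N -> R -> R) : (forall n, kspan S (f n)) ->
  kspan S (fun t => \sum_n c n * f n t).
Proof.
move=> sf; elim: (index_enum _) => [|n s IH].
  by under eq_fun do rewrite big_nil; exact: kspan0.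
by under eq_fun do rewrite big_cons; exact: kspan_lin.
Qed.

(* A functional supported in [a, b] does not distinguish u from u'. *)
Definition localizable (u : R -> R) := exists u', [/\ kspan L u', kspan G u &
  exists2 d : R, 0 < d & forall t, a - d < t < b + d -> u t = u' t].

Lemma localizable_lin c f g : localizable f -> localizable g ->
  localizable (fun t => c * f t + g t).
Proof.
move=> [f' [Lf Gf [d d0 df]]] [g' [Lg Gg [e e0 eg]]].
exists (fun t => c * f' t + g' t); split; [exact: kspan_lin|exact: kspan_lin|].
exists (Num.min d e); first by rewrite lt_min d0.
have /andP[md me] : (Num.min d e <= d) && (Num.min d e <= e) by rewrite !ge_min !lexx orbT.
move=> t /andP[t1 t2]; rewrite df ?eg//; apply/andP; split; lra.
Qed.

Lemma null_localizable f : nullspace alpha N f -> kspan L f /\ kspan G f.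
Proof.
move=> /expand[c ->].
have Lq n : kspan L (q n).
  have [e ->] := basis_expmon n; apply: kspan_sum => m.
  by apply: (@kspan_kern L (Some m) 0).
by split; apply: kspan_sum => n //; exact: (@kspan_kern G (Some n) 0).
Qed.

(** A Green function with knot in [[a, b]] is itself a local atom. With knot to the left of [a] it
    coincides near [[a, b]] with a null-space element, and with knot to the right of [b] it vanishes
    there. *)
Lemma kern_localizable k x : kdom G k x -> localizable (kern G k ^~ x).
Proof.
have qn n : localizable (q n).
  have [Lq Gq] : kspan L (q n) /\ kspan G (q n) by apply: null_localizable; case: sys => -[].
  by exists (q n); split => //; exists 1.
case: k => [n|] /= _; first exact: qn.
have loc0 : localizable (fun=> 0).
  by exists (fun=> 0); split; [exact: kspan0|exact: kspan0|exists 1].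
have Gg : kspan G (fun t => green alpha N (t - x)).
  have -> : (fun t => green alpha N (t - x)) =
      (fun t => 1 * gphi alpha q phi t x + \sum_n acoef alpha phi n x * q n t).
    by apply/funext => t; rewrite mul1r /gphi subrK.
  apply: kspan_lin; first exact: (@kspan_kern G None x).
  by apply: kspan_sum => n; exact: (@kspan_kern G (Some n) 0).
have gl : localizable (fun t => green alpha N (t - x)).
  have [xa|ax] := ltP x a.
    have [Lx Gx] := null_localizable (nullspace_expmon alpha x (etrans (ltn_predL N) N0)).
    exists (expmon alpha x N.-1); split => //; exists (a - x); first by rewrite subr_gt0.
    by move=> t /andP[xt _]; rewrite green_expmon ifT//; lra.
  have [bx|xb] := ltP b x.
    exists (fun=> 0); split; [exact: kspan0|exact: Gg|].
    exists (x - b); first by rewrite subr_gt0.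
    by move=> t /andP[_ tx]; rewrite green_expmon ifF//; apply/negbTE; rewrite -ltNge; lra.
  exists (fun t => green alpha N (t - x)); split => //; last by exists 1.
  by apply: (@kspan_kern L None x); rewrite /= in_itv/= ax.
suff : localizable (fun t => -1 * (\sum_n acoef alpha phi n x * q n t) + green alpha N (t - x)).
  by congr localizable; apply/funext => t; rewrite /= /gphi mulN1r addrC.
apply: localizable_lin => //.
elim: (index_enum _) => [|n s IH].
  by under eq_fun do rewrite big_nil.
by under eq_fun do rewrite big_cons; exact: localizable_lin.
Qed.

End Change.

(** * Weak-star continuous functionals *)

Definition wcont (T : topologicalType) (R : realType) (D : set T) (f : T -> R) :=
  forall x, D x -> f y @[y --> within D (nbhs x)] --> f x.

Lemma wcontP (T : topologicalType) (R : realType) (D : set T) (f : T -> R) :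
  wcont D f <-> {within D, continuous f}.
Proof. by split=> [h|/subspace_continuousP h]; first exact/subspace_continuousP. Qed.

Section WithinContinuity.
Context {T : topologicalType} {R : realType} (D : set T).
Implicit Types f g : T -> R.

Lemma wcont_eq f g : (forall x, D x -> f x = g x) -> wcont D g -> wcont D f.
Proof.
move=> fg cg x Dx A; rewrite (fg _ Dx) => /(cg x Dx) H.
have : within D (nbhs x) [set y | D y -> A (g y)] by near=> y => _; near: y; exact: H.
rewrite /within /= => H'.
have : nbhs x [set y | D y -> A (f y)].
  by apply: filterS H' => y h Dy; rewrite /= fg//; exact: h.
by [].
Unshelve. all: by end_near.
Qed.

Lemma wcont_cst (r : R) : wcont D (fun=> r). Proof. by move=> x _; exact: cvg_cst. Qed.

Lemma wcontM f g : wcont D f -> wcont D g -> wcont D (fun x => f x * g x).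
Proof. by move=> cf cg x Dx; apply: cvgM; [exact: cf|exact: cg]. Qed.

Lemma wcont_sum I (s : seq I) (F : I -> T -> R) : (forall i, wcont D (F i)) ->
  wcont D (fun x => \sum_(i <- s) F i x).
Proof. by move=> cF x Dx; apply: cvg_sumr => i _; exact: cF. Qed.

Lemma wcont_comp (U : topologicalType) (E : set U) (p : T -> U) (h : U -> R) :
  continuous p -> (forall x, D x -> E (p x)) -> wcont E h -> wcont D (h \o p).
Proof.
move=> cp DE /wcontP ch x Dx; apply: (within_cvg ch (DE _ Dx)); last first.
  by apply: cvg_within_filter; exact: cp.
by rewrite /within /=; near=> y; exact: DE.
Unshelve. all: by end_near.
Qed.

End WithinContinuity.

Section Dual.
Context {R : realType} {N1 N2 : nat}.
Variables (S1 : system R N1) (S2 : system R N2).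
Notation J := (option 'I_N1 * option 'I_N2)%type.

Lemma wcont_dualfun (h : predual S1 S2) j : wcont (jdom S1 S2 j) (dualfun h j).
Proof.
case: j => -[n|] [n'|]; rewrite /jdom /=; first exact: wcont_cst.
- apply: (@wcont_eq _ _ _ _ (sval (hm1 h n) \o snd)).
    by move=> [x1 x2] [_ /= Dx]; rewrite indicE mem_set// mul1r.
  apply: (@wcont_comp _ _ _ _ (sdom S2)); [exact: continuous_snd|by move=> x []|].
  by apply/wcontP; case: (hm1 h n) => f /= [].
- apply: (@wcont_eq _ _ _ _ (sval (hm2 h n') \o fst)).
    by move=> [x1 x2] [/= Dx _]; rewrite indicE mem_set// mul1r.
  apply: (@wcont_comp _ _ _ _ (sdom S1)); [exact: continuous_fst|by move=> x []|].
  by apply/wcontP; case: (hm2 h n') => f /= [].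
- apply: (@wcont_eq _ _ _ _ (sval (hm h))).
    by move=> x Dx; rewrite indicE mem_set// mul1r.
  by apply/wcontP; case: (hm h) => f /= [].
Qed.

Hypothesis tS : tame S1 S2.

Lemma linear_on0 (V W : lmodType R) (F : set V) (nu : V -> W) f : F f -> linear_on F nu -> nu 0 = 0.
Proof.
by move=> Ff lnu; have := lnu (-1) f f Ff Ff; rewrite !scaleN1r !addNr.
Qed.

(** Continuity at 0 bounds [nu] where finitely many pairings are small; by homogeneity [nu] vanishes
    where these pairings vanish, hence is a combination of them. *)
Lemma nu_comp M (nu : (R -> R -> R) -> 'rV[R]_M) :
  linear_on (native S1 S2) nu ->
  {within (native S1 S2 : set (wstar S1 S2)), continuous (nu : wstar S1 S2 -> 'rV[R]_M)} ->
  exists H : 'I_M -> J -> R * R -> R,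
  [/\ forall r j, bmeas (H r j), forall r j, wcont (jdom S1 S2 j) (H r j) &
    forall (c : coords S1 S2) r, nu (synthesis c) 0 r = \sum_j comp c j (H r j)].
Proof.
move=> lnu /subspace_continuousP cnu.
have [c0 c0E] : exists c0 : coords S1 S2, forall j h, bmeas h -> comp c0 j h = 0.
  apply: (comp_onto tS (L := fun _ _ => 0)) => j; first exact: daniell_zero.
  by [].
have s0 : synthesis c0 = 0.
  apply/funext => t1; apply/funext => t2; rewrite (synthesis_comp tS) big1// => j _.
  by rewrite c0E//; exact: bmeas_jkern.
have n0 : native S1 S2 0 by exists c0.
have nu0 : nu 0 = 0 by exact: linear_on0 n0 lnu.
have nsyn (c : coords S1 S2) : native S1 S2 (synthesis c) by exists c.
have lg a (c c' : coords S1 S2) : nu (synthesis (coords_comb tS a c c')) = a *: nu (synthesis c) + nu (synthesis c').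
  by rewrite synthesis_comb lnu.
have [T [s [e [e0 se]]]] : exists (T : finType) (s : T -> predual S1 S2) (e : R), 0 < e /\
    forall c' : coords S1 S2, (forall i, `|duality c' (s i) - duality c0 (s i)| < e) -> `|nu (synthesis c')| < 1.
  apply: (@wcoords_nbhs _ _ _ _ _ (c0 : wcoords S1 S2) [set c' | `|nu (synthesis c')| < 1]).
  have : nbhs (nu 0) [set v | `|v| < 1].
    rewrite nu0; have := nbhsx_ballx (0 : 'rV[R]_M) 1 ltr01.
    by apply: filterS => v; rewrite -ball_normE /ball_/= sub0r normrN.
  move=> /(cnu 0 n0); rewrite /within /= => H.
  have : nbhs (0 : wstar S1 S2) [set x | native S1 S2 x -> `|nu x| < 1] by [].
  rewrite nbhsE => -[B [oB B0] sB].
  have : nbhs (c0 : wcoords S1 S2) (@synthesis R N1 N2 S1 S2 @^-1` B).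
    by apply: open_nbhs_nbhs; split => //; rewrite /preimage/= s0.
  by apply: filterS => c Bc; exact: (sB _ Bc (nsyn c)).
have d0 h : duality c0 h = 0.
  by rewrite duality_comp big1// => j _; rewrite c0E//; exact: bmeas_dualfun.
pose f (i : nat) (c : coords S1 S2) : R :=
  if insub i is Some o then duality c (s (enum_val (o : 'I_#|T|))) else 0.
have lf i a (c c' : coords S1 S2) : f i (coords_comb tS a c c') = a * f i c + f i c'.
  by rewrite /f; case: insub => [k|]; rewrite ?duality_comb// mulr0 addr0.
have [w wE] : exists w : nat -> 'rV[R]_M, forall c : coords S1 S2, nu (synthesis c) = \sum_(i < #|T|) f i c *: w i.
  apply: (functional_factor (comb := coords_comb tS) lf lg) => c cz.
  apply/eqP; rewrite -normr_eq0; apply/negPn/negP => nz.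
  (* Rescaled to have an image of norm 1, a point where all the pairings vanish contradicts the
     strict bound by 1. *)
  have := se (coords_comb tS `|nu (synthesis c)|^-1 c c0).
  rewrite lg s0 nu0 addr0 normrZ normfV normr_id mulVf// ltxx => abs.
  suff : false by []; apply: abs => i; rewrite duality_comb !d0 addr0 subr0.
  have := cz (enum_rank i) (ltn_ord _); rewrite /f (valK (enum_rank i)) enum_rankK => ->.
  by rewrite mulr0 normr0.
pose Hd (i : nat) j : R * R -> R :=
  if insub i is Some o then dualfun (s (enum_val (o : 'I_#|T|))) j else fun=> 0.
have bHd i j : bmeas (Hd i j).
  by rewrite /Hd; case: insub => [k|]; [exact: bmeas_dualfun|exact: bmeas_cst].
exists (fun r j x => \sum_(i < #|T|) w i 0 r * Hd i j x); split.
- by move=> r j; apply: bmeas_sum => i; exact: bmeasZ.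
- move=> r j; apply: wcont_sum => i; apply: wcontM; first exact: wcont_cst.
  by rewrite /Hd; case: insub => [k|]; [exact: wcont_dualfun|exact: wcont_cst].
- move=> c r; rewrite wE summxE.
  transitivity (\sum_j \sum_(i < #|T|) w i 0 r * comp c j (Hd i j)); last first.
    apply: eq_bigr => j _; rewrite (daniell_sum (comp_daniell c j)); last by move=> i; exact: bmeasZ.
    by apply: eq_bigr => i _; rewrite (daniellZ (comp_daniell c j)).
  rewrite exchange_big/=; apply: eq_bigr => i _; rewrite mxE -mulr_sumr mulrC; congr (_ * _).
  by rewrite /f /Hd (valK i); exact: duality_comp.
Qed.

End Dual.

(** * The native space of the rectangle inside the global one *)

Section LocalInGlobal.
Context {R : realType} {N1 N2 : nat}.
Variables (alpha1 alpha2 a1 b1 a2 b2 : R).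
Variables (q1 phi1 : 'I_N1 -> R -> R) (q2 phi2 : 'I_N2 -> R -> R).
Hypotheses (N10 : (0 < N1)%N) (N20 : (0 < N2)%N).
Hypotheses (sys1 : biorthogonal_system alpha1 q1 phi1) (sys2 : biorthogonal_system alpha2 q2 phi2).
Let G1 := global_system alpha1 q1 phi1.
Let G2 := global_system alpha2 q2 phi2.
Let L1 := local_system alpha1 N1 a1 b1.
Let L2 := local_system alpha2 N2 a2 b2.
Let tG : tame G1 G2 := tame_global N10 N20 sys1 sys2.
Let tL : tame L1 L2 := tame_local N1 N2 alpha1 alpha2 a1 b1 a2 b2.
Notation J := (option 'I_N1 * option 'I_N2)%type.

(** Coordinates attached to a basis function are collapsed to 0, where the corresponding component
    lives. *)
Definition proj00 (k : J) (x : R * R) : R * R := (proj0 k.1 x.1, proj0 k.2 x.2).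

Lemma continuous_proj0 N (k : option 'I_N) : continuous (@proj0 R N k).
Proof. by case: k => [n|] x; [exact: cvg_cst|exact: cvg_id]. Qed.

Lemma continuous_proj00 k : continuous (proj00 k).
Proof.
move=> x; apply: cvg_pairE => /=.
  by have := @continuous_proj0 _ k.1 x.1; apply: cvg_comp; exact: continuous_fst.
by have := @continuous_proj0 _ k.2 x.2; apply: cvg_comp; exact: continuous_snd.
Qed.

Lemma measurable_proj00 k : measurable_fun setT (proj00 k).
Proof.
apply: measurable_fun_pair.
  apply: (measurableT_comp (f := @proj0 R N1 k.1)); last exact: measurable_fst.
  by apply: continuous_measurable_fun; exact: continuous_proj0.
apply: (measurableT_comp (f := @proj0 R N2 k.2)); last exact: measurable_snd.
by apply: continuous_measurable_fun; exact: continuous_proj0.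
Qed.

Lemma proj00_jdom k x : jdom G1 G2 k (proj00 k x).
Proof. by split; rewrite /proj00 /kdom /proj0 /=; [case: k.1|case: k.2]. Qed.

Lemma bmeas_kdom_mul N (alpha a b : R) (i : option 'I_N) (T : R -> R) : continuous T ->
  bmeas (fun x => \1_(kdom (local_system alpha N a b) i) x * T x).
Proof.
move=> cT; case: i => [n|] /=; last by apply: bmeas_within_itv; exact: continuous_subspaceT.
have : bmeas (fun x : R => \1_(`[0 : R, 0 : R]%classic) x * T x).
  by apply: bmeas_within_itv; exact: continuous_subspaceT.
by rewrite set_itv1.
Qed.

Lemma kern_mkern_proj0 N (alpha : R) (q phi : 'I_N -> R -> R) k t x :
  mkern (global_system alpha q phi) k t (proj0 k x) = kern (global_system alpha q phi) k t x.
Proof. by rewrite /mkern indicE mem_set ?mulr1//; case: k => //=. Qed.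

(** Expanding both factors of a local atom by [change_kern] turns it into a combination of global
    atoms; integrating the products [W] of the coefficients against the local components gives the
    global ones. *)
Lemma local_in_global : exists W : J -> J -> R * R -> R,
  [/\ forall i k, bmeas (W i k), forall i k, wcont (jdom L1 L2 i) (W i k) &
  forall c : coords L1 L2, exists c' : coords G1 G2, synthesis c' = synthesis c /\
    forall k h, bmeas h ->
      comp c' k h = \sum_i comp c i (fun x => W i k x * h (proj00 k x))].
Proof.
have [T1 [cT1 T1E]] := change_kern a1 b1 sys1.
have [T2 [cT2 T2E]] := change_kern a2 b2 sys2.
pose W (i k : J) : R * R -> R := tens (fun x => \1_(kdom L1 i.1) x * T1 i.1 k.1 x)
  (fun x => \1_(kdom L2 i.2) x * T2 i.2 k.2 x).
have bW i k : bmeas (W i k) by apply: bmeas_tens; apply: bmeas_kdom_mul.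
have bh k (h : R * R -> R) : bmeas h -> bmeas (h \o proj00 k).
  by apply: bmeas_comp; exact: measurable_proj00.
exists W; split => // [i k|c].
  apply: (@wcont_eq _ _ _ _ (fun x => (T1 i.1 k.1 \o fst) x * (T2 i.2 k.2 \o snd) x)).
    by move=> x [x1 x2]; rewrite /W /tens !indicE !mem_set// !mul1r.
  apply: wcontM => x _.
    by apply: cvg_within_filter; have := cT1 i.1 k.1 x.1; apply: cvg_comp; exact: continuous_fst.
  by apply: cvg_within_filter; have := cT2 i.2 k.2 x.2; apply: cvg_comp; exact: continuous_snd.
pose F k h := \sum_i comp c i (fun x => W i k x * h (proj00 k x)).
have dF k : daniell (F k).
  apply: daniell_bigsum => i.
  exact: (daniell_comp (daniell_mul (comp_daniell c i) (bW i k)) (measurable_proj00 k)).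
have cF k : concentrated (jdom G1 G2 k) (F k).
  move=> h bh' h0; rewrite /F big1// => i _; rewrite -[RHS](daniell0 (comp_daniell c i)).
  by congr (comp c i); apply/funext => x; rewrite h0 ?mulr0//; exact: proj00_jdom.
have [c' c'E] := comp_onto tG dF cF.
exists c'; split; last exact: c'E.
apply/funext => t1; apply/funext => t2; rewrite (synthesis_comp tG) (synthesis_comp tL).
transitivity (\sum_k \sum_i comp c i (fun x => W i k x * jkern G1 G2 k t1 t2 (proj00 k x))).
  by apply: eq_bigr => k _; rewrite c'E//; exact: bmeas_jkern.
rewrite exchange_big/=; apply: eq_bigr => i _.
rewrite -(daniell_sum (comp_daniell c i)); last first.
  by move=> k; apply: bmeasM => //; apply: bh; exact: bmeas_jkern.
congr (comp c i); apply/funext => x.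
pose A k1 := \1_(kdom L1 i.1) x.1 * T1 i.1 k1 x.1 * kern G1 k1 t1 x.1.
pose B k2 := \1_(kdom L2 i.2) x.2 * T2 i.2 k2 x.2 * kern G2 k2 t2 x.2.
transitivity (\sum_(k : J) A k.1 * B k.2).
  apply: eq_bigr => k _; rewrite /W /jkern /tens /proj00 /= !kern_mkern_proj0 /A /B; ring.
have -> : \sum_(k : J) A k.1 * B k.2 = (\sum_k1 A k1) * (\sum_k2 B k2).
  by rewrite big_distrlr/= pair_big/=.
rewrite /jkern /tens /mkern !T1E !T2E; congr (_ * _); rewrite mulrC mulr_sumr.
  by apply: eq_bigr => k1 _; rewrite /A mulrA.
by apply: eq_bigr => k1 _; rewrite /B mulrA.
Qed.

Lemma tensor_native N1' N2' (S1 : system R N1') (S2 : system R N2') u v : tame S1 S2 ->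
  kspan S1 u -> kspan S2 v -> native S1 S2 (fun t1 t2 => u t1 * v t2).
Proof.
move=> tS su sv.
have n0 : native S1 S2 (fun _ _ => 0).
  have [c cE] : exists c : coords S1 S2, forall j h, bmeas h -> comp c j h = 0.
    by apply: (comp_onto tS (L := fun _ _ => 0)) => j; [exact: daniell_zero|].
  exists c => //; apply/funext => t1; apply/funext => t2.
  by rewrite (synthesis_comp tS) big1// => j _; rewrite cE//; exact: bmeas_jkern.
have nlin (f g : R -> R -> R) (a : R) : native S1 S2 f -> native S1 S2 g ->
    native S1 S2 (fun t1 t2 => a * f t1 t2 + g t1 t2) := @native_comb _ _ _ _ _ tS a f g.
apply: (su (fun u => native S1 S2 (fun t1 t2 => u t1 * v t2))).
- by move: n0; congr (native S1 S2); apply/funext => t1; apply/funext => t2; rewrite mul0r.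
- move=> c f g nf ng; have := nlin _ _ c nf ng.
  by congr (native S1 S2); apply/funext => t1; apply/funext => t2; ring.
move=> i x Dx; apply: (sv (fun v => native S1 S2 (fun t1 t2 => kern S1 i t1 x * v t2))).
- by move: n0; congr (native S1 S2); apply/funext => t1; apply/funext => t2; rewrite mulr0.
- move=> c f g nf ng; have := nlin _ _ c nf ng.
  by congr (native S1 S2); apply/funext => t1; apply/funext => t2; ring.
- by move=> k y Dy; exact: (@native_kern _ _ _ _ _ tS (i, k) (x, y) (conj Dx Dy)).
Qed.

Lemma native_local_global : native L1 L2 `<=` native G1 G2.
Proof.
move=> _ [c _ <-]; have [W [_ _ /(_ c)[c' [E _]]]] := local_in_global.
by exists c'.
Qed.

Variables (M : nat) (nu : (R -> R -> R) -> 'rV[R]_M).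
Hypothesis lnu : linear_on (native G1 G2) nu.
Hypothesis cnu : {within (native G1 G2 : set (wstar G1 G2)), continuous (nu : wstar G1 G2 -> 'rV[R]_M)}.

Lemma local_linear_on : linear_on (native L1 L2) nu.
Proof. by move=> a f g Lf Lg; apply: lnu; exact: native_local_global. Qed.

Lemma nu_local_comp : exists H : 'I_M -> J -> R * R -> R,
  [/\ forall r j, bmeas (H r j), forall r j, wcont (jdom L1 L2 j) (H r j) &
    forall (c : coords L1 L2) r, nu (synthesis c) 0 r = \sum_j comp c j (H r j)].
Proof.
have [H [bH cH HE]] := nu_comp tG lnu cnu.
have [W [bW cW WE]] := local_in_global.
have bHW r i k : bmeas (fun x => W i k x * H r k (proj00 k x)).
  by apply: bmeasM => //; exact: (bmeas_comp (measurable_proj00 k) (bH r k)).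
exists (fun r i x => \sum_k W i k x * H r k (proj00 k x)); split.
- by move=> r i; apply: bmeas_sum.
- move=> r i; apply: wcont_sum => k; apply: wcontM; first exact: cW.
  apply: (@wcont_comp _ _ _ _ (jdom G1 G2 k) (proj00 k)); [exact: continuous_proj00| |exact: cH].
  by move=> x _; exact: proj00_jdom.
- move=> c r; have [c' [<- c'E]] := WE c; rewrite HE.
  under eq_bigr do rewrite c'E//.
  rewrite exchange_big/=; apply: eq_bigr => i _.
  by rewrite (daniell_sum (comp_daniell c i)).
Qed.

Hypothesis surj : nu @` native G1 G2 = setT.
Hypothesis supp : supported_in (native G1 G2) nu (`[a1, b1]%classic `*` `[a2, b2]%classic).

(** Near the rectangle the global atom agrees with an element of the local space; the difference
    vanishes on a neighbourhood and is annihilated by [nu]. *)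
Lemma nu_kern_local k x : jdom G1 G2 k x ->
  (nu @` native L1 L2) (nu (fun t1 t2 => kern G1 k.1 t1 x.1 * kern G2 k.2 t2 x.2)).
Proof.
move=> [Dx1 Dx2].
have [u' [Lu Gu [d1 d10 uE]]] := kern_localizable a1 b1 N10 sys1 Dx1.
have [v' [Lv Gv [d2 d20 vE]]] := kern_localizable a2 b2 N20 sys2 Dx2.
have nL := tensor_native tL Lu Lv; have nG := tensor_native tG Gu Gv.
exists (fun t1 t2 => u' t1 * v' t2) => //.
apply/eqP; rewrite -subr_eq0 -opprB oppr_eq0; apply/eqP.
rewrite addrC -scaleN1r -(lnu (-1) (native_local_global nL) nG).
apply: supp; first exact: (native_comb tG (-1) (native_local_global nL) nG).
exists ((fst @^-1` `]a1 - d1, b1 + d1[%classic) `&` (snd @^-1` `]a2 - d2, b2 + d2[%classic)); split.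
- apply: openI; apply: open_comp.
  + by move=> t _; exact: continuous_fst.
  + exact: interval_open.
  + by move=> t _; exact: continuous_snd.
  + exact: interval_open.
- move=> t [/= ]; rewrite !in_itv/= => /andP[h1 h2] /andP[h3 h4].
  by split; apply/andP; split; lra.
- move=> t [/= ]; rewrite !in_itv/= => h1 h2.
  by rewrite !fctE/= uE// vE// /GRing.scale/=; lra.
Qed.

(** The image of the local space is the row space of some [A]. It contains the value of [nu] at
    every global atom, so the linear forms given by [cokermx A] kill the densities [H] pointwise and
    hence, by integration, all values of [nu]. *)
Lemma nu_local_surj : nu @` native L1 L2 = setT.
Proof.
have [H [bH cH HE]] := nu_comp tG lnu cnu.
have lL := local_linear_on.
have [f0 Lf0] : exists f, native L1 L2 f.
  by exists (fun _ _ => 0 * 0); apply: (tensor_native tL); exact: kspan0.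
have L0 : native L1 L2 0.
  by have := native_comb tL (-1) Lf0 Lf0; rewrite scaleN1r addNr.
have [||A AE] := @max_subspace R M (nu @` native L1 L2).
- by exists 0 => //; exact: linear_on0 L0 lL.
- move=> a _ _ [f Lf <-] [g Lg <-]; exists (a *: f + g); first exact: native_comb.
  exact: lL.
have Hk k x : jdom G1 G2 k x -> (\row_r H r k x) *m cokermx A = 0.
  move=> Dx; have /AE := nu_kern_local Dx; rewrite submxE => /eqP.
  have [c [cE <-]] := dirac_coords tG Dx.
  suff -> : nu (synthesis c) = \row_r H r k x by [].
  apply/rowP => r; rewrite HE mxE (bigD1 k)//= cE// eqxx mul1r big1 ?addr0// => k' k'k.
  by rewrite cE// (negbTE k'k) mul0r.
apply/seteqP; split => // v _; apply/AE; rewrite submxE.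
have [_ [c _ <-] <-] : (nu @` native G1 G2) v by rewrite surj.
apply/eqP/rowP => s; rewrite !mxE.
transitivity (\sum_k comp c k (fun x => \sum_r cokermx A r s * H r k x)).
  under eq_bigr do rewrite HE mulrC mulr_sumr.
  rewrite exchange_big/=; apply: eq_bigr => k _.
  rewrite (daniell_sum (comp_daniell c k)); last by move=> r; exact: bmeasZ.
  by apply: eq_bigr => r _; rewrite (daniellZ (comp_daniell c k)).
apply: big1 => k _; apply: (comp_concentrated tG); first by apply: bmeas_sum => r; exact: bmeasZ.
move=> x Dx; have := congr1 (fun u : 'rV[R]_M => u 0 s) (Hk k x Dx).
rewrite !mxE => E; rewrite -[RHS]E; apply: eq_bigr => r _.
by rewrite mulrC; congr (_ * _); rewrite mxE.
Qed.

End LocalInGlobal.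

(** * The native space of the rectangle and its weak-star topology *)

Section LocalSpace.
Context {R : realType} {N1 N2 : nat}.
Hypotheses (N10 : (0 < N1)%N) (N20 : (0 < N2)%N).
Variables (alpha1 alpha2 a1 b1 a2 b2 : R).
Let L1 := local_system alpha1 N1 a1 b1.
Let L2 := local_system alpha2 N2 a2 b2.
Let MK := native L1 L2.
Let tL : tame L1 L2 := tame_local N1 N2 alpha1 alpha2 a1 b1 a2 b2.
Notation J := (option 'I_N1 * option 'I_N2)%type.
Implicit Types (f g : R -> R -> R) (j : J) (p : predual L1 L2).

(** A component attached to a basis function lives on a degenerate interval, so the results on
    rectangles apply to every component. *)
Lemma jdom_box j : exists a b c d : R, jdom L1 L2 j = box a b c d.
Proof.
have K N (al a b : R) (i : option 'I_N) : exists c d : R, kdom (local_system al N a b) i = `[c, d]%classic.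
  by case: i => [n|] /=; [exists 0, 0; rewrite set_itv1|exists a, b].
have [a [b Ea]] := K _ alpha1 a1 b1 j.1; have [c [d Ec]] := K _ alpha2 a2 b2 j.2.
by exists a, b, c, d; rewrite /jdom Ea Ec.
Qed.

Lemma zero_coords_ex : exists c : coords L1 L2, forall j h, bmeas h -> comp c j h = 0.
Proof. by apply: (comp_onto tL (L := fun _ _ => 0)) => j; [exact: daniell_zero|]. Qed.

(* Irrelevant outside the native space. *)
Definition rep f : coords L1 L2 := xget (sval (cid zero_coords_ex)) [set c | synthesis c = f].

Definition lcomp f j := comp (rep f) j.

Lemma lcomp_daniell f j : daniell (lcomp f j). Proof. exact: comp_daniell. Qed.

Lemma lcomp_concentrated f j : concentrated (jdom L1 L2 j) (lcomp f j).
Proof. exact: comp_concentrated. Qed.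

Lemma repK f : MK f -> synthesis (rep f) = f.
Proof. by move=> [c _ cf]; rewrite /rep; case: xgetP => [? -> //|/(_ c)]. Qed.

Lemma comp_unique (c c' : coords L1 L2) j h : synthesis c = synthesis c' -> bmeas h ->
  comp c j h = comp c' j h.
Proof.
move=> E bh; have := @local_unique _ _ _ alpha1 alpha2 a1 b1 a2 b2 (comp (coords_comb tL (-1) c' c)) N10 N20.
move=> /(_ (fun j => comp_daniell _ j) (comp_concentrated tL _)) H.
have := H _ j h bh; rewrite comp_comb// mulN1r => /(_ _)/eqP.
rewrite addrC subr_eq0 => H'; apply/eqP/H' => t1 t2.
transitivity (synthesis (coords_comb tL (-1) c' c) t1 t2); first by rewrite (synthesis_comp tL).
by rewrite synthesis_comb E scaleN1r addNr.
Qed.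

Lemma lcomp_synthesis (c : coords L1 L2) j h : bmeas h -> lcomp (synthesis c) j h = comp c j h.
Proof. by apply: comp_unique; apply: repK; exists c. Qed.

Lemma lcompE f t1 t2 : MK f -> f t1 t2 = \sum_j lcomp f j (jkern L1 L2 j t1 t2).
Proof. by move=> /repK {1}<-; rewrite (synthesis_comp tL). Qed.

Lemma lcomp_ext f g : MK f -> MK g -> (forall j h, bmeas h -> lcomp f j h = lcomp g j h) -> f = g.
Proof.
move=> Mf Mg fg; apply/funext => t1; apply/funext => t2; rewrite !lcompE//.
by apply: eq_bigr => j _; apply: fg; exact: bmeas_jkern.
Qed.

Lemma lcomp_onto (L : J -> (R * R -> R) -> R) : (forall j, daniell (L j)) ->
  (forall j, concentrated (jdom L1 L2 j) (L j)) ->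
  exists2 f, MK f & forall j h, bmeas h -> lcomp f j h = L j h.
Proof.
move=> dL cL; have [c cE] := comp_onto tL dL cL.
by exists (synthesis c) => [|j h bh]; [exists c|rewrite lcomp_synthesis// cE].
Qed.

Lemma lcomp_lin a f g j h : MK f -> MK g -> bmeas h ->
  lcomp (a *: f + g) j h = a * lcomp f j h + lcomp g j h.
Proof.
move=> Mf Mg bh; rewrite -{1}(repK Mf) -{1}(repK Mg) -(synthesis_comb tL).
by rewrite lcomp_synthesis// comp_comb.
Qed.

(** All representations of [f] have the same components, so the set in the definition of [seminorm]
    is a singleton. *)
Lemma seminorm_lcomp f : MK f -> seminorm L1 L2 f = \sum_(j | penal j) tvar (lcomp f j).
Proof.
move=> Mf; rewrite /seminorm.
have -> : [set r | exists2 c : coords L1 L2, synthesis c = f & r = coords_norm c] =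
    [set \sum_(j | penal j) tvar (lcomp f j)].
  apply/seteqP; split => [_ [c cf ->]|_ ->].
    rewrite coords_norm_comp /set1 /=; apply: eq_bigr => j _; apply: tvar_eq.
    - exact: comp_daniell.
    - exact: lcomp_daniell.
    - by move=> h bh; rewrite -cf lcomp_synthesis.
  by exists (rep f); [exact: repK|rewrite coords_norm_comp].
exact: xget_unique.
Qed.

Definition pairw p f := duality (rep f) p.

Lemma pairwE p f : pairw p f = \sum_j lcomp f j (dualfun p j).
Proof. exact: duality_comp. Qed.

Lemma pairw_synthesis p (c : coords L1 L2) : pairw p (synthesis c) = duality c p.
Proof.
rewrite pairwE duality_comp; apply: eq_bigr => j _.
by rewrite lcomp_synthesis//; exact: bmeas_dualfun.
Qed.

Lemma pairw_continuous p : continuous (pairw p : wstar L1 L2 -> R).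
Proof.
apply/continuousP => B oB.
suff : wstar_open (pairw p @^-1` B : set (wstar L1 L2)) by [].
rewrite /wstar_open /=.
have -> : @synthesis _ _ _ L1 L2 @^-1` (pairw p @^-1` B) = (fun c : coords L1 L2 => duality c p) @^-1` B.
  by apply/seteqP; split => c; rewrite /preimage /= pairw_synthesis.
have cp : continuous (fun d : {ptws predual L1 L2 -> R} => d p).
  move=> d A; rewrite nbhsE => -[U [oU Ud] UA].
  have /cvg_sup/(_ p) H : (d : {ptws predual L1 L2 -> R}) --> d by exact: cvg_id.
  apply: (H [set e | A (e p)]) => /=; exists (@^~ p @^-1` U); split => //; first by exists U.
  by move=> e Ue; exact: UA.
exists ((fun d : {ptws predual L1 L2 -> R} => d p) @^-1` B) => //.
by apply: open_comp => // d _; exact: cp.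
Qed.

Lemma wstar_cvg (T : Type) (F : set_system T) (f_ : T -> R -> R -> R) f : Filter F ->
  F [set t | MK (f_ t)] -> MK f -> (forall p, pairw p (f_ t) @[t --> F] --> pairw p f) ->
  (f_ : T -> wstar L1 L2) @ F --> (f : wstar L1 L2).
Proof.
move=> FF FM Mf H A; rewrite nbhsE => -[B [oB Bf] BA].
have cv : (fun t => rep (f_ t) : wcoords L1 L2) @ F --> (rep f : wcoords L1 L2).
  exact: wcoords_cvg.
have nB : nbhs (rep f : wcoords L1 L2) (@synthesis _ _ _ L1 L2 @^-1` B).
  by apply: open_nbhs_nbhs; split => //; rewrite /preimage /= repK.
have FB : F [set t | B (synthesis (rep (f_ t)))] := cv _ nB.
suff : F [set t | A (f_ t)] by [].
by apply: filterS (filterI FB FM) => t [/= Bt Mt]; apply: BA; rewrite -(repK Mt).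
Qed.

Lemma wstar_isolated f : ~ MK f -> open ([set f] : set (wstar L1 L2)).
Proof.
move=> Mf; suff : wstar_open ([set f] : set (wstar L1 L2)) by [].
rewrite /wstar_open/=; suff -> : @synthesis _ _ _ L1 L2 @^-1` [set f] = set0 by exact: open0.
by rewrite -subset0 => c /= cf; apply: Mf; exists c.
Qed.

Lemma wstar_isolatedC f : ~ MK f -> open (~` [set f] : set (wstar L1 L2)).
Proof.
move=> Mf; suff : wstar_open (~` [set f] : set (wstar L1 L2)) by [].
rewrite /wstar_open/=; suff -> : @synthesis _ _ _ L1 L2 @^-1` (~` [set f]) = setT by exact: openT.
by rewrite -subTset => c _ /= cf; apply: Mf; exists c.
Qed.

Lemma C0_compact (X : topologicalType) (D : set X) (h : X -> R) : compact D -> wcont D h -> C0 D h.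
Proof. by move=> cD /wcontP ch; split => // e _; exists D. Qed.

Lemma C0_cst0 (X : topologicalType) (D : set X) : C0 D (fun=> 0 : R).
Proof.
split => [|e e0]; first by apply/wcontP; exact: wcont_cst.
by exists set0; [exact: compact0|move=> x _ _; rewrite normr0].
Qed.

(** The predual element has all its other components zero; compactness of the domains makes the
    decay condition void. *)
Lemma local_predual j h : bmeas h -> wcont (jdom L1 L2 j) h ->
  exists p, forall f, pairw p f = lcomp f j h.
Proof.
pose z0 : {k : R * R -> R | C0 (sdom L1 `*` sdom L2) k} := exist _ _ (@C0_cst0 _ _).
pose z1 : {k : R -> R | C0 (sdom L1) k} := exist _ _ (@C0_cst0 _ _).
pose z2 : {k : R -> R | C0 (sdom L2) k} := exist _ _ (@C0_cst0 _ _).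
have dual p : (forall k, k != j -> dualfun p k = fun=> 0) -> bmeas h ->
    (forall x, jdom L1 L2 j x -> dualfun p j x = h x) -> forall f, pairw p f = lcomp f j h.
  move=> pk bh pj f; rewrite pairwE (bigD1 j)//= big1 ?addr0 => [|k kj].
    by apply: (concentrated_eq (lcomp_daniell f j) (@lcomp_concentrated f j)) => //; exact: bmeas_dualfun.
  by rewrite pk//; exact: daniell0 (lcomp_daniell f k).
case: j dual => -[n|] [n'|] dual bh ch.
- exists (Predual z0 (fun=> z2) (fun=> z1) (\matrix_(i, i') (h (0, 0) *+ ((i == n) && (i' == n'))))).
  apply: dual => // [[[i|] [i'|]] k|[x1 x2] [/= -> ->]]; try by apply/funext => x; rewrite /= ?mulr0.
    apply/funext => x; rewrite /= mxE; move: k; rewrite xpair_eqE.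
    by case: (altP (i =P n)) => [->|nin]; case: (altP (i' =P n')) => [->|nin'] //; rewrite !eqxx.
  by rewrite mxE !eqxx mulr1n.
- have cc : C0 (sdom L2) (fun x => h (0, x)).
    apply: C0_compact; first exact: segment_compact.
    apply: (@wcont_comp _ _ _ _ (jdom L1 L2 (Some n, None)) (pair (0 : R)) h) => // x.
    by apply: cvg_pairE; [exact: cvg_cst|exact: cvg_id].
  exists (Predual z0 (fun i => if i == n then exist _ _ cc else z2) (fun=> z1) 0).
  apply: dual => // [[[i|] [i'|]] k|[x1 x2] [/= -> x2D]]; try by apply/funext => x; rewrite /= ?mulr0 ?mxE.
    apply/funext => x; rewrite /=; move: k; case: (altP (i =P n)) => [->|nin _] /=; last by rewrite mulr0.
    by rewrite eqxx.
  by rewrite eqxx /= indicE mem_set// mul1r.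
- have cc : C0 (sdom L1) (fun x => h (x, 0)).
    apply: C0_compact; first exact: segment_compact.
    apply: (@wcont_comp _ _ _ _ (jdom L1 L2 (None, Some n')) (fun x => (x, 0 : R)) h) => // x.
    by apply: cvg_pairE; [exact: cvg_id|exact: cvg_cst].
  exists (Predual z0 (fun=> z2) (fun i => if i == n' then exist _ _ cc else z1) 0).
  apply: dual => // [[[i|] [i'|]] k|[x1 x2] [/= x1D ->]]; try by apply/funext => x; rewrite /= ?mulr0 ?mxE.
    apply/funext => x; rewrite /=; move: k; case: (altP (i' =P n')) => [->|nin _] /=; last by rewrite mulr0.
    by rewrite eqxx.
  by rewrite eqxx /= indicE mem_set// mul1r.
- have cc : C0 (sdom L1 `*` sdom L2) h by apply: C0_compact => //; exact: compact_box.
  exists (Predual (exist _ _ cc) (fun=> z2) (fun=> z1) 0).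
  apply: dual => // [[[i|] [i'|]] k|x xD]; try by apply/funext => x; rewrite /= ?mulr0 ?mxE.
  by rewrite /= indicE mem_set// mul1r.
Qed.

Lemma wcont_ramp j k k' : wcont (jdom L1 L2 j) (tens (ramp k) (ramp k')).
Proof.
move=> x Dx; apply: cvg_within_filter; apply: cvgM.
  by have := @continuous_ramp R k x.1; apply: cvg_comp; exact: continuous_fst.
by have := @continuous_ramp R k' x.2; apply: cvg_comp; exact: continuous_snd.
Qed.

Lemma lcomp_ramp_ext f g : MK f -> MK g -> (forall j k k',
  lcomp f j (tens (ramp k) (ramp k')) = lcomp g j (tens (ramp k) (ramp k'))) -> f = g.
Proof.
move=> Mf Mg fg; apply: lcomp_ext => // j.
by apply: ramp_ext; [exact: lcomp_daniell|exact: lcomp_daniell|exact: fg].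
Qed.

(** Points of the native space are separated by pairings with products of ramps; any other point is
    isolated and forms a closed set. *)
Lemma wstar_hausdorff : hausdorff_space (wstar L1 L2).
Proof.
move=> f g clfg.
have iso u v : ~ MK u -> u <> v -> exists A B : set (wstar L1 L2),
    [/\ nbhs (u : wstar L1 L2) A, nbhs (v : wstar L1 L2) B & A `&` B = set0].
  move=> Mu uv; exists [set u], (~` [set u]); split; last exact: setICr.
    by apply: open_nbhs_nbhs; split => //; exact: wstar_isolated.
  by apply: open_nbhs_nbhs; split; [exact: wstar_isolatedC|move=> /esym].
have [Mf|Mf] := pselect (MK f); last first.
  apply: contrapT => fg; have [A [B [fA gB AB]]] := iso _ _ Mf fg.
  by have [x] := clfg _ _ fA gB; rewrite AB.
have [Mg|Mg] := pselect (MK g); last first.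
  apply: contrapT => fg; have [B [A [gB fA AB]]] := iso _ _ Mg (fun E => fg (esym E)).
  by have [x] := clfg _ _ fA gB; rewrite setIC AB.
apply: lcomp_ramp_ext => // j k k'.
have [p pE] := local_predual (bmeas_tens (bmeas_ramp k) (bmeas_ramp k')) (@wcont_ramp j k k').
rewrite -!pE; apply: (@Rhausdorff R) => A B fA gB.
have [x [xA xB]] := clfg _ _ (pairw_continuous fA) (pairw_continuous gB).
by exists (pairw p x).
Qed.

End LocalSpace.
Arguments lcomp_daniell {R N1 N2 alpha1 alpha2 a1 b1 a2 b2} f j.
Arguments lcomp_concentrated {R N1 N2 alpha1 alpha2 a1 b1 a2 b2} f j.

(** * Control of the null space *)

Lemma nullspaceZ (R : realType) (alpha : R) N (c : R) f : nullspace alpha N f ->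
  nullspace alpha N (fun t => c * f t).
Proof.
move=> [df f0].
have it k : (k <= N)%N -> iter k (Lop1 alpha) (fun t => c * f t) = (fun t => c * iter k (Lop1 alpha) f t).
  elim: k => //= k IH kN; rewrite IH 1?ltnW//; apply/funext => t; rewrite /Lop1.
  have -> : derive1 (fun t0 => c * iter k (Lop1 alpha) f t0) t = c * derive1 (iter k (Lop1 alpha) f) t.
    by rewrite !derive1E (deriveZ c (df k kN t)).
  by ring.
split => [k kN t|]; rewrite it//; last by rewrite f0; apply/funext => t /=; rewrite mulr0.
  by apply: derivableM; [exact: derivable_cst|exact: df].
exact: ltnW.
Qed.

Lemma rV_cvg (R : realType) M (T : Type) (F : set_system T) (u : T -> 'rV[R]_M) (v : 'rV[R]_M) : Filter F ->
  (forall r, u t 0 r @[t --> F] --> v 0 r) -> u @ F --> v.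
Proof.
move=> FF H A /nbhs_ballP[e /= e0 eA].
have : F [set t | forall r, ball (v 0 r) e (u t 0 r)].
  by apply: filter_forall => r; apply: H; exact: nbhsx_ballx.
move=> Fe; suff : F [set t | A (u t)] by [].
by apply: filterS Fe => t tb; apply: eA; split => // i r; rewrite ord1.
Qed.

Lemma rV_norm_coord (R : realType) M (v : 'rV[R]_M) (r : 'I_M) : `|v 0 r| <= `|v|.
Proof.
by rewrite [leRHS]/Num.norm/= mx_normrE; apply/bigmax_geP; right; exists (0, r).
Qed.

Section Polynomial.
Context {R : realType} {N1 N2 : nat}.
Hypotheses (N10 : (0 < N1)%N) (N20 : (0 < N2)%N).
Variables (alpha1 alpha2 a1 b1 a2 b2 : R).
Let L1 := local_system alpha1 N1 a1 b1.
Let L2 := local_system alpha2 N2 a2 b2.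
Let MK := native L1 L2.
Let tL : tame L1 L2 := tame_local N1 N2 alpha1 alpha2 a1 b1 a2 b2.
Notation J := (option 'I_N1 * option 'I_N2)%type.
Notation lcomp := (@lcomp R N1 N2 alpha1 alpha2 a1 b1 a2 b2).
Notation tensN := (tensor_space (nullspace alpha1 N1) (nullspace alpha2 N2)).

Definition null_comp (d : 'M[R]_(N1, N2)) (j : J) (h : R * R -> R) : R :=
  if j is (Some n, Some n') then d n n' * h (0, 0) else 0.

Lemma null_comp_daniell d j : daniell (null_comp d j).
Proof.
case: j => -[n|] [n'|]; try exact: daniell_zero.
by apply: daniell_scale; exact: daniell_eval.
Qed.

Lemma null_comp_concentrated d j : concentrated (jdom L1 L2 j) (null_comp d j).
Proof. by case: j => -[n|] [n'|] h bh h0 //=; rewrite h0 ?mulr0. Qed.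

Lemma null_element (d : 'M[R]_(N1, N2)) : exists f, [/\ MK f, tensN f &
  forall j h, bmeas h -> lcomp f j h = null_comp d j h].
Proof.
have [f Mf fE] := lcomp_onto N10 N20 (null_comp_daniell d) (@null_comp_concentrated d).
exists f; split => //.
pose e (k : 'I_#|{: 'I_N1 * 'I_N2}|) : 'I_N1 * 'I_N2 := enum_val k.
exists #|{: 'I_N1 * 'I_N2}|, (fun k t => d (e k).1 (e k).2 * expmon alpha1 a1 (e k).1 t).
exists (fun k t => expmon alpha2 a2 (e k).2 t); split.
- by move=> k; apply: nullspaceZ; exact: nullspace_expmon.
- by move=> k; exact: nullspace_expmon.
- apply/funext => t1; apply/funext => t2; rewrite (lcompE t1 t2 Mf).
  rewrite (eq_bigr (fun j => null_comp d j (jkern L1 L2 j t1 t2))); last by move=> j _; apply: fE; exact: bmeas_jkern.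
  rewrite big_option2 /= !big1_eq !add0r pair_big/=.
  rewrite [RHS](reindex (@enum_rank ('I_N1 * 'I_N2)%type)) /=; last first.
    by exists enum_val => ? _; rewrite ?enum_rankK ?enum_valK.
  apply: eq_bigr => k _.
  by rewrite /e enum_rankK /jkern /tens /mkern /= /expmon /fundamental_basis indicE mem_set// !mulr1 !mulrA.

Qed.

Lemma lcomp_null f (n : 'I_N1) (n' : 'I_N2) h : bmeas h ->
  lcomp f (Some n, Some n') h = lcomp f (Some n, Some n') (fun=> 1) * h (0, 0).
Proof.
move=> bh; rewrite -(daniellZr (lcomp_daniell _ _)); last exact: bmeas_cst.
apply: (concentrated_eq (lcomp_daniell _ _) (lcomp_concentrated f _)) => //.
  by apply: bmeasM; exact: bmeas_cst.
by move=> [x1 x2] [/= -> ->]; rewrite mul1r.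
Qed.

(** By injectivity, the matrix [A] of [nu] on the null space has independent rows. Its
    pseudo-inverse recovers the unpenalized coordinates from the data minus the penalized
    contribution, and the latter is bounded by the seminorm. *)
Lemma null_coord_bound M (nu : (R -> R -> R) -> 'rV[R]_M) (H : 'I_M -> J -> R * R -> R) :
  (forall r j, bmeas (H r j)) ->
  (forall f r, MK f -> nu f 0 r = \sum_j lcomp f j (H r j)) -> set_inj tensN nu ->
  exists C : R, forall f, MK f -> forall n n',
    `|lcomp f (Some n, Some n') (fun=> 1)| <= C * (`|nu f| + seminorm L1 L2 f).
Proof.
move=> bH nuE inj.
pose I := 'I_#|{: 'I_N1 * 'I_N2}|; pose jd (k : I) : J := (Some (enum_val k).1, Some (enum_val k).2).
pose A : 'M[R]_(#|{: 'I_N1 * 'I_N2}|, M) := \matrix_(k, r) H r (jd k) (0, 0).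
pose dv f : 'rV[R]_(#|{: 'I_N1 * 'I_N2}|) := \row_k lcomp f (jd k) (fun=> 1).
pose w f : 'rV[R]_M := \row_r (nu f 0 r - \sum_(j | penal j) lcomp f j (H r j)).
have wE f : MK f -> w f = dv f *m A.
  move=> Mf; apply/rowP => r; rewrite !mxE nuE// (bigID (@penal N1 N2))/= addrC addrK.
  rewrite (reindex_onto jd (fun j => if j is (Some n, Some n') then enum_rank (n, n') else enum_rank (Ordinal N10, Ordinal N20)))/=.
    apply: eq_big => [k|k _]; first by rewrite /jd /penal /= -surjective_pairing enum_valK eqxx.
    have -> : dv f 0 k = lcomp f (jd k) (fun=> 1) by rewrite mxE.
    by have -> : A k r = H r (jd k) (0, 0); [rewrite mxE|rewrite /jd -lcomp_null].
  by move=> [[n|] [n'|]] // _; rewrite /jd enum_rankK.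
have Af : row_free A.
  apply: inj_row_free => v vA.
  have [f [Mf Tf fE]] := null_element (\matrix_(n, n') v 0 (enum_rank (n, n'))).
  have [g [Mg Tg gE]] := null_element 0.
  have nug : nu g = 0.
    apply/rowP => r; rewrite nuE// mxE big1// => j _; rewrite gE//.
    by case: j => -[n|] [n'|] //=; rewrite mxE mul0r.
  have nuf : nu f = 0.
    have := wE _ Mf; have -> : dv f = v.
      apply/rowP => k; rewrite mxE fE /=; last exact: bmeas_cst.
      by rewrite mxE mulr1 -surjective_pairing enum_valK.
    rewrite vA => w0; apply/rowP => r; have := congr1 (fun u : 'rV[R]_M => u 0 r) w0.
    rewrite !mxE => /eqP; rewrite subr_eq0 => /eqP ->; rewrite big1// => j pj; rewrite fE//.
    by case: j pj => -[n|] [n'|].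
  have fg : f = g by apply: inj; rewrite ?inE// nuf nug.
  apply/rowP => k; rewrite mxE; have := fE (jd k) _ (bmeas_cst 1).
  rewrite fg gE /=; last exact: bmeas_cst.
  by rewrite !mxE !mulr1 -surjective_pairing enum_valK.
have [B HB] : exists B : R, forall r j x, `|H r j x| <= B.
  have Bex r j : {B : R | forall x, `|H r j x| <= B} by apply: cid; have [_] := bH r j.
  exists (\sum_r \sum_j `|sval (Bex r j)|) => r j x.
  apply: (le_trans (svalP (Bex r j) x)); apply: (le_trans (ler_norm _)).
  rewrite (bigD1 r)//= (bigD1 j)//= -addrA lerDl addr_ge0//; first by apply: sumr_ge0.
  by apply: sumr_ge0 => ? _; apply: sumr_ge0.
have B0 : 0 <= `|B| + 1 by rewrite addr_ge0.
exists ((`|B| + 1) * \sum_r \sum_k `|pinvmx A r k|) => f Mf n n'.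
have s0 : 0 <= seminorm L1 L2 f.
  by rewrite (seminorm_lcomp N10 N20 Mf) sumr_ge0// => j _; apply: tvar_ge0; exact: lcomp_daniell.
have wr r : `|w f 0 r| <= (`|B| + 1) * (`|nu f| + seminorm L1 L2 f).
  rewrite mxE; apply: (le_trans (ler_normB _ _)).
  apply: (@le_trans _ _ (`|nu f| + (`|B| + 1) * seminorm L1 L2 f)); last first.
    by rewrite mulrDr lerD2r ler_peMl// lerDr.
  apply: lerD; first exact: rV_norm_coord.
  rewrite (seminorm_lcomp N10 N20 Mf) mulr_sumr; apply: (le_trans (ler_norm_sum _ _ _)).
  apply: ler_sum => j _; apply: tvar_norm => [|//|x]; first exact: lcomp_daniell.
  by apply: (le_trans (HB r j x)); have := ler_norm B; lra.
have -> : lcomp f (Some n, Some n') (fun=> 1) = (w f *m pinvmx A) 0 (enum_rank (n, n')).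
  by rewrite wE// mulmxKp// mxE /jd enum_rankK.
rewrite mxE; apply: (le_trans (ler_norm_sum _ _ _)).
rewrite mulrAC mulr_sumr; apply: ler_sum => r _; rewrite normrM; apply: ler_pM => //.
by rewrite (bigD1 (enum_rank (n, n')))//= lerDl sumr_ge0.
Qed.

End Polynomial.

(** * Minimizers *)

Section Variational.
Context {R : realType} {N1 N2 : nat}.
Hypotheses (N10 : (0 < N1)%N) (N20 : (0 < N2)%N).
Variables (alpha1 alpha2 a1 b1 a2 b2 : R).
Notation L1 := (local_system alpha1 N1 a1 b1).
Notation L2 := (local_system alpha2 N2 a2 b2).
Notation MK := (native L1 L2).
Let tL : tame L1 L2 := tame_local N1 N2 alpha1 alpha2 a1 b1 a2 b2.
Notation J := (option 'I_N1 * option 'I_N2)%type.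
Notation lcomp := (@lcomp R N1 N2 alpha1 alpha2 a1 b1 a2 b2).
Notation pairw := (@pairw R N1 N2 alpha1 alpha2 a1 b1 a2 b2).
Notation tensN := (tensor_space (nullspace alpha1 N1) (nullspace alpha2 N2)).
Implicit Types (f g : R -> R -> R).
Variables (M : nat) (nu : (R -> R -> R) -> 'rV[R]_M) (H : 'I_M -> J -> R * R -> R).
Hypotheses (bH : forall r j, bmeas (H r j)) (cH : forall r j, wcont (jdom L1 L2 j) (H r j)).
Hypothesis nuE : forall f r, MK f -> nu f 0 r = \sum_j lcomp f j (H r j).
Hypotheses (inj : set_inj tensN nu) (surj : nu @` MK = setT).
Variables (E : 'rV[R]_M -> \bar R) (lambda : R).
Hypotheses (E0 : forall z, (0 <= E z)%E) (Eprop : is_proper E) (Ecoer : is_coercive E)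
  (Elsc : lower_semicontinuous E) (Econv : strictly_convex E) (lambda0 : 0 < lambda).

Definition cost f : \bar R := (E (nu f) + (lambda * seminorm L1 L2 f)%:E)%E.

Lemma seminorm_ge0 f : MK f -> 0 <= seminorm L1 L2 f.
Proof.
by move=> Mf; rewrite (seminorm_lcomp N10 N20 Mf) sumr_ge0// => j _; apply: tvar_ge0; exact: lcomp_daniell.
Qed.

Lemma cost_le f (B : R) : (cost f <= B%:E)%E -> exists2 e : R, E (nu f) = e%:E & e + lambda * seminorm L1 L2 f <= B.
Proof.
rewrite /cost; have := E0 (nu f); case: (E (nu f)) => [e| |]//= _.
by rewrite -EFinD lee_fin; exists e.
Qed.

(** Coercivity bounds the data, nonnegativity of [E] bounds the seminorm, and [null_coord_bound]
    then bounds the rest. *)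
Lemma cost_bounded (B : R) : exists D : R, forall f, MK f -> (cost f <= B%:E)%E ->
  forall j, tvar (lcomp f j) <= D.
Proof.
have [C HC] := null_coord_bound N10 N20 bH nuE inj.
have [r Hr] := Ecoer (B + 1).
exists (`|B / lambda| + `|C| * (`|r| + `|B / lambda|)) => f Mf /cost_le[e Ee eB] j.
have e0 : 0 <= e by have := E0 (nu f); rewrite Ee lee_fin.
have s0 := seminorm_ge0 Mf.
have sB : seminorm L1 L2 f <= `|B / lambda|.
  by apply: le_trans (ler_norm _); rewrite ler_pdivlMr//; lra.
have nr : `|nu f| <= `|r|.
  have [rn|/ltW nr] := leP r `|nu f|; last exact: le_trans nr (ler_norm r).
  by have := Hr _ rn; rewrite Ee lee_fin; have := mulr_ge0 (ltW lambda0) s0; lra.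
have C0 : 0 <= `|C| * (`|r| + `|B / lambda|) by rewrite mulr_ge0// addr_ge0.
have [pj|] := boolP (penal j).
  apply: (@le_trans _ _ (seminorm L1 L2 f)); last by lra.
  rewrite (seminorm_lcomp N10 N20 Mf) (bigD1 j)//= lerDl sumr_ge0// => k _.
  by apply: tvar_ge0; exact: lcomp_daniell.
case: j => -[n|] [n'|]// _; apply: tvar_le => [|h bh h1]; first exact: lcomp_daniell.
rewrite lcomp_null//; apply: (le_trans (ler_norm _)); rewrite normrM.
apply: (@le_trans _ _ `|lcomp f (Some n, Some n') (fun=> 1)|); first by rewrite ler_piMr.
apply: (le_trans (HC f Mf n n')); apply: (@le_trans _ _ (`|C| * (`|r| + `|B / lambda|))); last by rewrite lerDr.
by apply: (@le_trans _ _ (`|C| * (`|nu f| + seminorm L1 L2 f))); [apply: ler_wpM2r; [exact: addr_ge0|exact: ler_norm]|apply: ler_wpM2l => //; exact: lerD].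
Qed.

(** Components are passed to the limit one by one. The data converge because [nu] integrates
    continuous functions, and the cost is lower semicontinuous since both of its terms are. *)
Lemma cost_limit (T : Type) (F : set_system T) (f_ : T -> R -> R -> R) (B : R) : UltraFilter F ->
  F [set t | MK (f_ t) /\ (cost (f_ t) <= B%:E)%E] ->
  exists f, [/\ MK f, forall p, pairw p (f_ t) @[t --> F] --> pairw p f &
    forall B' : R, F [set t | (cost (f_ t) <= B'%:E)%E] -> (cost f <= B'%:E)%E].
Proof.
move=> FU FB; have [D HD] := cost_bounded B.
have FM : F [set t | MK (f_ t)] by apply: filterS FB => t [].
have FD j : F [set t | tvar (lcomp (f_ t) j) <= D] by apply: filterS FB => t [Mt Bt]; exact: HD.
have limj j : {L0 | [/\ daniell L0, concentrated (jdom L1 L2 j) L0,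
    forall h, bmeas h -> wcont (jdom L1 L2 j) h -> lcomp (f_ t) j h @[t --> F] --> L0 h &
    tvar L0 <= lim (tvar (lcomp (f_ t) j) @[t --> F])]}.
  apply: cid; have [a [b [c [d jE]]]] := jdom_box alpha1 alpha2 a1 b1 a2 b2 j.
  have cL t : concentrated (box a b c d) (lcomp (f_ t) j).
    by rewrite -jE; exact: lcomp_concentrated.
  have [L0 [d0 c0 h0 t0]] := ultra_limit (fun t => lcomp_daniell (f_ t) j) cL (FD j).
  by exists L0; split => //; rewrite jE// => h bh /wcontP; exact: h0.
have [f Mf fE] : exists2 f, MK f & forall j h, bmeas h -> lcomp f j h = sval (limj j) h.
  by apply: lcomp_onto => // j; case: (limj j) => L0 /= [].
have cvgf j h : bmeas h -> wcont (jdom L1 L2 j) h -> lcomp (f_ t) j h @[t --> F] --> lcomp f j h.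
  by move=> bh ch; rewrite fE//; case: (limj j) => L0 /= [_ _ h0 _]; exact: h0.
exists f; split => // [p|B' FB'].
  apply: (eq_cvgr (fun t => pairwE p (f_ t))); rewrite pairwE; apply: cvg_sumr => j _.
  by apply: cvgf; [exact: bmeas_dualfun|exact: wcont_dualfun].
pose u t : 'rV[R]_M := \row_r \sum_j lcomp (f_ t) j (H r j).
have uf : u @ F --> nu f.
  apply: rV_cvg => r; rewrite nuE//.
  apply: (eq_cvgr (g := fun t => \sum_j lcomp (f_ t) j (H r j))); first by move=> t; rewrite mxE.
  by apply: cvg_sumr => j _; exact: cvgf.
pose S t := \sum_(j | penal j) tvar (lcomp (f_ t) j).
pose l := \sum_(j | penal j) lim (tvar (lcomp (f_ t) j) @[t --> F]).
have Sl : S @ F --> l.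
  apply: cvg_sumr => j _; apply: (@ultra_bounded_cvg _ _ F _ _ D).
  apply: filterS (FD j) => t /= tD; rewrite ger0_norm//; apply: tvar_ge0; exact: lcomp_daniell.
have sl : seminorm L1 L2 f <= l.
  rewrite (seminorm_lcomp N10 N20 Mf); apply: ler_sum => j _.
  rewrite (tvar_eq (lcomp_daniell f j) _ (fE j)); first by case: (limj j) => L0 /= [].
  by case: (limj j) => L0 /= [].
rewrite leNgt; apply/negP => B'f.
(* A value [a < E (nu f)] that leaves room for the seminorm, [B' < a + lambda * l]. It also covers
   an infinite [E (nu f)]. *)
have [a aB' af] : exists2 a : R, B' - lambda * l < a & (a%:E < E (nu f))%E.
  have h : lambda * seminorm L1 L2 f <= lambda * l by rewrite ler_pM2l.
  move: B'f; rewrite /cost; have := E0 (nu f); case: (E (nu f)) => [e| |]//= _ h'.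
    exists ((B' - lambda * l + e) / 2); first by move: h'; rewrite -EFinD lte_fin; lra.
    by rewrite lte_fin; move: h'; rewrite -EFinD lte_fin; lra.
  by exists (B' - lambda * l + 1); [lra|rewrite ltry].
have [V Vf Va] := Elsc af.
have FV : F [set t | V (u t)] := uf _ Vf.
have FS : F [set t | (B' - a) / lambda < S t].
  by apply: (cvgr_gt _ Sl); rewrite ltr_pdivrMr// mulrC; lra.
have [t [[[Vt St] Mt] Bt]] := filter_ex (filterI (filterI (filterI FV FS) FM) FB').
have [e Ee eB] := cost_le Bt.
have nut : nu (f_ t) = u t by apply/rowP => r; rewrite nuE// mxE.
have := Va _ Vt; rewrite -nut Ee lte_fin => ae.
move: St; rewrite /= ltr_pdivrMr// /S -(seminorm_lcomp N10 N20 Mt) mulrC; lra.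
Qed.

Notation V := (argmin MK cost).

(** A minimizing sequence is followed along an ultrafilter. The solution set is described as a
    sublevel set at a finite level, the form in which [cost_limit] controls limits. *)
Lemma argmin_value : exists2 m : R, V !=set0 & forall f, V f <-> MK f /\ (cost f <= m%:E)%E.
Proof.
have [z zfin] := Eprop.
have [f0 Mf0 nuf0] : (nu @` MK) z by rewrite surj.
have [c0 cE0] : exists c0 : R, (cost f0 <= c0%:E)%E.
  move: zfin; rewrite /cost nuf0; have := E0 z; case: (E z) => [e| |]//= _ _.
  by exists (e + lambda * seminorm L1 L2 f0); rewrite EFinD.
pose S := [set r : R | exists2 f, MK f & (cost f <= r%:E)%E].
have lbS : lbound S 0.
  move=> r [f Mf /cost_le[e Ee eB]]; have := E0 (nu f); rewrite Ee lee_fin => e0.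
  by have := mulr_ge0 (ltW lambda0) (seminorm_ge0 Mf); lra.
have hS : has_inf S by split; [exists c0, f0|exists 0].
have fex (n : nat) : {f | MK f /\ (cost f <= (inf S + n.+1%:R^-1)%:E)%E}.
  have n0 : 0 < n.+1%:R^-1 :> R by rewrite invr_gt0.
  apply: cid; have [r [f Mf fr] rn] := inf_adherent n0 hS.
  by exists f; split => //; apply: (le_trans fr); rewrite lee_fin ltW.
have [U [UU oU]] := @ultraFilterLemma nat \oo _.
have bound (B : R) : inf S < B -> U [set n | (cost (sval (fex n)) <= B%:E)%E].
  move=> SB; apply: oU; have : inf S + n.+1%:R^-1 @[n --> \oo] --> inf S + 0.
    by apply: cvgD; [exact: cvg_cst|exact: cvg_harmonic].
  rewrite addr0 => /cvgr_lt /(_ _ SB); apply: filterS => n /ltW nB.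
  by have [_ fn] := svalP (fex n); apply: (le_trans fn); rewrite lee_fin.
have [|f [Mf _ Bf]] := @cost_limit nat U (fun n => sval (fex n)) (inf S + 1) UU.
  have h1 : inf S < inf S + 1 by lra.
  by apply: filterS (bound _ h1) => n nB; split => //; have [] := svalP (fex n).
have fS : (cost f <= (inf S)%:E)%E.
  apply/lee_addgt0Pr => e e0; rewrite -EFinD; apply: Bf; apply: bound; lra.
have Smin g : MK g -> ((inf S)%:E <= cost g)%E.
  move=> Mg; case E1: (cost g) => [c| |]; last 2 first.
  - exact: leey.
  - by have [|e] := @cost_le g 0; [rewrite E1 leNye|move=> Ee _; move: E1; rewrite /cost Ee].
  - by rewrite lee_fin; apply: ge_inf; [exists 0|exists g => //; rewrite E1].
exists (inf S) => [|g]; first by exists f; split => // g Mg; exact: (le_trans fS (Smin g Mg)).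
split => [[Mg gmin]|[Mg gS]]; first by split => //; exact: le_trans (gmin f Mf) fS.
by split => // h Mh; exact: le_trans gS (Smin h Mh).
Qed.

Lemma argmin_compact : compact (V : set (wstar L1 L2)).
Proof.
have [m _ Vm] := argmin_value.
rewrite compact_ultra => F FU FV.
have [|f [Mf pf Bf]] := @cost_limit (wstar L1 L2) F id m FU.
  by apply: filterS FV => f /Vm.
exists f; split; first by apply/Vm; split => //; apply: Bf; apply: filterS FV => g /Vm[].
by apply: wstar_cvg => //; apply: filterS FV => g [].
Qed.

Lemma native0 : MK 0.
Proof.
have [f0 [M0 _ _]] := null_element N10 N20 alpha1 alpha2 a1 b1 a2 b2 0.
by have := native_comb tL (-1) M0 M0; rewrite scaleN1r addNr.
Qed.

Lemma native_lin (a b : R) f g : MK f -> MK g -> MK (a *: f + b *: g).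
Proof.
move=> Mf Mg; apply: (native_comb tL) => //; rewrite -[b *: g]addr0.
by apply: (native_comb tL) => //; exact: native0.
Qed.

Lemma lcomp_zero j h : bmeas h -> lcomp 0 j h = 0.
Proof.
by move=> bh; have := lcomp_lin N10 N20 (-1) j native0 native0 bh; rewrite scaleN1r addNr; lra.
Qed.

Lemma lcomp_lin2 (a b : R) f g j h : MK f -> MK g -> bmeas h ->
  lcomp (a *: f + b *: g) j h = a * lcomp f j h + b * lcomp g j h.
Proof.
move=> Mf Mg bh; have Mbg : MK (b *: g) by rewrite -[b *: g]addr0; apply: (native_comb tL) => //; exact: native0.
rewrite lcomp_lin//; congr (_ + _); rewrite -[b *: g]addr0 lcomp_lin ?lcomp_zero ?addr0//.
exact: native0.
Qed.

Lemma nu_lin2 (a b : R) f g : MK f -> MK g -> nu (a *: f + b *: g) = a *: nu f + b *: nu g.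
Proof.
move=> Mf Mg; apply/rowP => r; rewrite !mxE !nuE//; last exact: native_lin.
by rewrite !mulr_sumr -big_split/=; apply: eq_bigr => j _; rewrite lcomp_lin2.
Qed.

Lemma seminorm_conv (t : R) f g : 0 <= t <= 1 -> MK f -> MK g ->
  seminorm L1 L2 (t *: f + (1 - t) *: g) <= t * seminorm L1 L2 f + (1 - t) * seminorm L1 L2 g.
Proof.
move=> /andP[t0 t1] Mf Mg; rewrite !(seminorm_lcomp N10 N20)//; last exact: native_lin.
rewrite !mulr_sumr -big_split/=; apply: ler_sum => j _.
apply: tvar_le => [|h bh h1]; first exact: lcomp_daniell.
rewrite lcomp_lin2//; apply: lerD; apply: ler_wpM2l; rewrite ?subr_ge0//; apply: le_tvar => //; exact: lcomp_daniell.
Qed.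

Lemma argmin_nu f g : V f -> V g -> nu f = nu g.
Proof.
have [m _ Vm] := argmin_value => Vf Vg; apply/eqP/negPn/negP => fg.
have [[Mf cf] [Mg cg]] := ((Vm f).1 Vf, (Vm g).1 Vg).
have [e Ee em] := cost_le cf; have [e' Ee' em'] := cost_le cg.
have t01 : 0 < (2^-1 : R) < 1 by apply/andP; split; lra.
have := Econv fg t01; rewrite Ee Ee' !ltry => /(_ isT isT).
rewrite -nu_lin2// -!EFinM -EFinD => lt.
pose h := 2^-1 *: f + (1 - 2^-1) *: g.
have Mh : MK h by exact: native_lin.
have sh : seminorm L1 L2 h <= 2^-1 * seminorm L1 L2 f + (1 - 2^-1) * seminorm L1 L2 g.
  by apply: seminorm_conv => //; apply/andP; split; lra.
have {}sh : lambda * seminorm L1 L2 h <= 2^-1 * (lambda * seminorm L1 L2 f) + (1 - 2^-1) * (lambda * seminorm L1 L2 g).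
  by apply: (le_trans (ler_wpM2l (ltW lambda0) sh)); lra.
have [c Ec ch] : exists2 c : R, E (nu h) = c%:E & c < 2^-1 * e + (1 - 2^-1) * e'.
  by move: lt; have := E0 (nu h); rewrite -/h; case: (E (nu h)) => [c| |]// _; rewrite lte_fin; exists c.
have [_ /(_ h Mh) fh] := Vf; have [_ /(_ h Mh) gh] := Vg.
move: fh gh; rewrite /cost Ee Ee' Ec -!EFinD !lee_fin; lra.
Qed.

Lemma argmin_seminorm f g : V f -> V g -> seminorm L1 L2 f = seminorm L1 L2 g.
Proof.
have [m _ Vm] := argmin_value => Vf Vg; have fg := argmin_nu Vf Vg.
have [[Mf cf] [Mg cg]] := ((Vm f).1 Vf, (Vm g).1 Vg).
have [e Ee em] := cost_le cf; have [e' Ee' em'] := cost_le cg.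
have [_ /(_ g Mg) h1] := Vf; have [_ /(_ f Mf) h2] := Vg.
move: h1 h2; rewrite /cost -fg Ee -!EFinD !lee_fin !lerD2l !ler_pM2l// => h1 h2.
by apply/eqP; rewrite eq_le h1.
Qed.

Lemma argmin_mem f g : V f -> MK g -> nu g = nu f -> seminorm L1 L2 g <= seminorm L1 L2 f -> V g.
Proof.
move=> [Mf fmin] Mg gf sgf; split => // h Mh; apply: le_trans (fmin h Mh).
by rewrite /cost gf leeD2l// lee_fin ler_pM2l.
Qed.

Lemma argmin_min f g : V f -> MK g -> nu g = nu f -> seminorm L1 L2 f <= seminorm L1 L2 g.
Proof.
have [m _ Vm] := argmin_value => Vf Mg gf; have [_ /(_ g Mg)] := Vf.
have [e Ee _] := cost_le ((Vm f).1 Vf).2.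
by rewrite /cost gf Ee -!EFinD lee_fin lerD2l ler_pM2l.
Qed.

Lemma argmin_convex f g (t : R) : V f -> V g -> 0 <= t <= 1 -> V (t *: f + (1 - t) *: g).
Proof.
move=> Vf Vg t01; have [[Mf _] [Mg _]] := (Vf, Vg).
apply: (argmin_mem Vf).
- exact: native_lin.
- by rewrite nu_lin2// (argmin_nu Vg Vf) -scalerDl addrC subrK scale1r.
- apply: (le_trans (seminorm_conv t01 Mf Mg)); rewrite (argmin_seminorm Vg Vf); lra.
Qed.

End Variational.

(** * The Krein-Milman theorem *)

Lemma convex_setP (R : realType) (X : lmodType R) (C : set X) : @convex_set R X C <->
  forall f g (t : R), C f -> C g -> 0 <= t <= 1 -> C (t *: f + (1 - t) *: g).
Proof.
split => [cC f g t Cf Cg t01|cC f g l]; last first.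
  by rewrite !inE => Cf Cg; apply: cC => //; rewrite ge0/= le1.
have := cC f g (@Itv01 _ t (proj1 (andP t01)) (proj2 (andP t01))).
by rewrite !inE => /(_ Cf Cg).
Qed.

(* Here V is compact and Hausdorff for the topology generated by the functionals
   l i, which are affine on V.  A point of V outside C is separated from C by a
   finite combination of these; maximizing that combination, and then in turn
   every functional of a countable separating family, leaves a single point of
   V, which is extreme. *)
Section KreinMilman.
Context {R : realType} {X : lmodType R} {I : Type} (V : set X) (l : I -> X -> R).
Context {D : countType} (k : D -> I).
Implicit Types (W C : set X) (f g : X) (F : set_system X).

Definition lcvg F f := forall i, l i @ F --> l i f.

Definition lclosed W := W `<=` V /\ forall F f, UltraFilter F -> F W -> V f -> lcvg F f -> W f.

Definition lcont (L : X -> R) := forall F f, Filter F -> lcvg F f -> L @ F --> L f.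

Definition laffine (L : X -> R) := forall f g (t : R), V f -> V g -> 0 <= t <= 1 ->
  L (t *: f + (1 - t) *: g) = t * L f + (1 - t) * L g.

Hypotheses (lV : forall F, UltraFilter F -> F V -> exists2 f, V f & lcvg F f)
  (la : forall i, laffine (l i))
  (ksep : forall f g, V f -> V g -> (forall n, l (k n) f = l (k n) g) -> f = g).

Lemma lcont_l i : lcont (l i). Proof. by move=> F f _; apply. Qed.

(** A maximizer is a limit along an ultrafilter that contains all superlevel sets of [L] in [W]
    reached by points of [W]. *)
Lemma lclosed_max W (L : X -> R) : lclosed W -> W !=set0 -> lcont L ->
  exists2 f, W f & forall g, W g -> L g <= L f.
Proof.
move=> [WV Wl] [f0 Wf0] cL.
pose F : set_system X := [set A | exists2 h, W h & forall g, W g -> L h <= L g -> A g].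
have FF : ProperFilter F.
  split; first by move=> [h Wh /(_ h Wh)]; apply.
  split.
  - by exists f0.
  - move=> A B [h Wh hA] [h' Wh' hB]; have [hh|/ltW hh] := leP (L h) (L h').
      by exists h' => // g Wg gg; split; [apply: hA => //; exact: le_trans gg|exact: hB].
    by exists h => // g Wg gg; split; [exact: hA|apply: hB => //; exact: le_trans gg].
  - by move=> A B AB [h Wh hA]; exists h => // g Wg gg; apply: AB; exact: hA.
have [G [GU FG]] := ultraFilterLemma FF.
have GW : G W by apply: FG; exists f0.
have [|f Vf Gf] := lV GU; first by apply: filterS GW; exact: WV.
exists f => [|g Wg]; first exact: Wl GU GW Vf Gf.
by apply: (cvgr_to_ge (cL _ _ _ Gf)); apply: FG; exists g.
Qed.

Definition face W (L : X -> R) := [set f | W f /\ forall g, W g -> L g <= L f].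

Lemma lclosed_face W L : lclosed W -> lcont L -> lclosed (face W L).
Proof.
move=> [WV Wl] cL; split => [f [/WV]//|F f FU FW Vf Ff].
have Wf : W f by apply: Wl Ff => //; apply: filterS FW => g [].
split => // g Wg; apply: (cvgr_to_ge (cL _ _ _ Ff)).
by apply: filterS FW => h [_ /(_ g Wg)].
Qed.

Section Faces.
Variables (L : X -> R).
Hypotheses (V0 : V !=set0) (cL : lcont L) (aL : laffine L).

(** [L] comes before the separating family, so that the extreme point found maximizes [L] over all
    of [V]; codes without an index contribute the zero functional. *)
Definition face_functional (n : nat) : X -> R :=
  if n is n'.+1 then (if unpickle n' is Some i then l (k i) else fun=> 0) else L.

Fixpoint faces n := if n is n'.+1 then face (faces n') (face_functional n') else V.

Lemma face_functional_lcont n : lcont (face_functional n).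
Proof.
case: n => [//|n] /=; case: unpickle => [i|]; first exact: lcont_l.
by move=> F f FF _; exact: cvg_cst.
Qed.

Lemma face_functional_affine n : laffine (face_functional n).
Proof.
case: n => [//|n] /=; case: unpickle => [i|]; first exact: la.
by move=> f g t _ _ _; rewrite !mulr0 addr0.
Qed.

Lemma faces_lclosed n : lclosed (faces n) /\ faces n !=set0.
Proof.
elim: n => [|n [IH1 IH0]] /=; first by split => //; split.
split; first exact: (lclosed_face IH1 (@face_functional_lcont n)).
by have [f Wf fmax] := lclosed_max IH1 IH0 (@face_functional_lcont n); exists f.
Qed.

Lemma faces_le m n : (m <= n)%N -> faces n `<=` faces m.
Proof.
elim: n => [|n IH]; first by rewrite leqn0 => /eqP ->.
by rewrite leq_eqVlt => /predU1P[->//|mn] f [/(IH mn)].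
Qed.

(** The nested faces have a common point by compactness. If it is a proper convex combination, an
    affine functional that is maximal there is maximal at both ends, so the ends stay in every face;
    and the separating family is constant on the intersection of the faces. *)
Lemma extreme_max : exists2 f, extreme_points V f & forall g, V g -> L g <= L f.
Proof.
pose u n := sval (cid (faces_lclosed n).2).
have uE n : faces n (u n) by rewrite /u; case: cid.
have [U [UU oU]] := @ultraFilterLemma nat \oo _.
have UW n : (u @ U) (faces n).
  by apply: oU; exists n => // m /= nm; apply: (faces_le nm).
have [f Vf Ff] := lV (ultra_fmap u UU) (UW 0%N).
have ff n : faces n f by have [[_ h] _] := faces_lclosed n; exact: h (ultra_fmap u UU) (UW n) Vf Ff.
exists f => [|g Vg]; last by have [_ h] := ff 1%N; exact: h.
split => // g h t Vg Vh /andP[t0 t1] E.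
have t01 : 0 <= t <= 1 by rewrite !ltW.
suff gh n : faces n g /\ faces n h.
  have eqf e : (forall n, faces n e) -> V e -> e = f.
    move=> fe Ve; apply: ksep => // i.
    have [[_ h1] [_ h2]] := (fe (pickle i).+2, ff (pickle i).+2).
    have := h1 _ (ff (pickle i).+1); have := h2 _ (fe (pickle i).+1).
    by rewrite /face_functional pickleK => a1 a2; apply/eqP; rewrite eq_le a1.
  by split; apply: eqf => // n; have [] := gh n.
elim: n => [//|n [gn hn]] /=.
have [_ fmax] := ff n.+1.
have := face_functional_affine n Vg Vh t01; rewrite -E => Ef.
have [g1 h1] := (fmax _ gn, fmax _ hn).
have [g2 h2] : face_functional n f <= face_functional n g /\ face_functional n f <= face_functional n h.
  move: Ef g1 h1; set a := face_functional n f; set b := face_functional n g; set c := face_functional n h.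
  by move=> Ef g1 h1; split; nra.
by split; split => // e en; [apply: le_trans g2|apply: le_trans h2]; exact: fmax.
Qed.

End Faces.

Lemma lclosed_nbhs C f : lclosed C -> V f -> ~ C f -> exists (T : finType) (s : T -> I) (e : R), 0 < e /\
  forall g, C g -> ~ forall i, `|l (s i) g - l (s i) f| < e.
Proof.
move=> [CV Cl] Vf nCf; apply: contrapT => no; apply: nCf.
pose F : set_system X := [set A | exists (T : finType) (s : T -> I) (e : R), 0 < e /\
  forall g, C g -> (forall i, `|l (s i) g - l (s i) f| < e) -> A g].
have FF : ProperFilter F.
  split.
    move=> [T [s [e [e0 sA]]]]; by apply: no; exists T, s, e.
  split.
  - by exists void, (fun i : void => match i with end), 1.
  - move=> A B [T [s [e [e0 sA]]]] [T' [s' [e' [e'0 sB]]]].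
    exists (T + T')%type, (fun i => match i with inl i => s i | inr i => s' i end), (Num.min e e').
    split; first by rewrite lt_min e0.
    move=> g Cg H; split; first by apply: sA => // i; have := H (inl i); rewrite lt_min => /andP[].
    by apply: sB => // i; have := H (inr i); rewrite lt_min => /andP[].
  - move=> A B AB [T [s [e [e0 sA]]]]; exists T, s, e; split => // g Cg H.
    by apply: AB; exact: sA.
have [G [GU FG]] := ultraFilterLemma FF.
apply: (Cl G) => //; first by apply: FG; exists void, (fun i : void => match i with end), 1.
move=> i; apply/cvgrPdistC_lt => e e0; apply: FG.
by exists unit, (fun=> i), e; split => // g _ /(_ tt).
Qed.

(** The finitely many coordinates [l (s i)] map the problem to a Euclidean space. A point of [C]
    closest to [f] exists by closedness, and the variational inequality there gives the separating
    functional. *)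
Lemma krein_milman C : lclosed C ->
  (forall f g (t : R), C f -> C g -> 0 <= t <= 1 -> C (t *: f + (1 - t) *: g)) ->
  extreme_points V `<=` C -> V `<=` C.
Proof.
move=> Cl Cconv extC f Vf; apply: contrapT => nCf; have [CV _] := Cl.
have V0 : V !=set0 by exists f.
suff [L [cL aL Lf]] : exists L, [/\ lcont L, laffine L & forall g, C g -> L g < L f].
  have [e /extC Ce emax] := extreme_max V0 cL aL.
  by have := lt_le_trans (Lf e Ce) (emax f Vf); rewrite ltxx.
have [[g1 Cg1]|C0] := pselect (C !=set0); last first.
  exists (fun=> 0); split => [F e FF _|e g t _ _ _|e Ce]; first exact: cvg_cst.
    by rewrite !mulr0 addr0.
  by exfalso; apply: C0; exists e.
have [T [s [e [e0 sC]]]] := lclosed_nbhs Cl Vf nCf.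
pose q g := \sum_i (l (s i) g - l (s i) f) ^+ 2.
have [g0 Cg0 gmin] : exists2 g0, C g0 & forall g, C g -> - q g <= - q g0.
  apply: (lclosed_max Cl); first by exists g1.
  move=> F g FF Fg; apply: cvgN; apply: cvg_sumr => i _.
  apply: (eq_cvgr (g := fun h => (l (s i) h - l (s i) f) * (l (s i) h - l (s i) f))).
    by move=> h; rewrite expr2.
  by rewrite expr2; apply: cvgM; (apply: cvgB; [exact: Fg|exact: cvg_cst]).
pose a i := l (s i) g0 - l (s i) f.
have q0 : 0 < q g0.
  rewrite lt_def sumr_ge0 ?andbT => [|i _]; last exact: sqr_ge0.
  apply/negP => /eqP /psumr_eq0P z; apply: (sC _ Cg0) => i.
  have /eqP := z (fun i _ => sqr_ge0 _) i isT; rewrite sqrf_eq0 => /eqP ->.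
  by rewrite normr0.
have var g : C g -> 0 <= \sum_i a i * (l (s i) g - l (s i) g0).
  move=> Cg; pose d i := l (s i) g - l (s i) g0.
  pose A := \sum_i a i * d i; pose B := \sum_i d i ^+ 2.
  have B0 : 0 <= B by apply: sumr_ge0 => i _; exact: sqr_ge0.
  have main t : 0 < t <= 1 -> 0 <= 2 * A + t * B.
    move=> /andP[t0 t1]; have t01 : 0 <= t <= 1 by rewrite ltW.
    have := gmin _ (Cconv _ _ _ Cg Cg0 t01); rewrite lerN2.
    have -> : q (t *: g + (1 - t) *: g0) = q g0 + t * (2 * A + t * B).
      rewrite /q /A /B !mulr_sumr -big_split/= mulr_sumr -big_split/=; apply: eq_bigr => i _.
      rewrite (la (s i) (CV _ Cg) (CV _ Cg0) t01) /a /d; ring.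
    by rewrite lerDl pmulr_rge0.
  rewrite -/A leNgt; apply/negP => A0.
  have BA : 0 < B + 1 - A by lra.
  (* This [t] lies in []0, 1]] and satisfies [t B <= - A], so that [2 A + t B <= A < 0]. *)
  have := main (- A / (B + 1 - A)).
  have h1 : 0 < - A / (B + 1 - A) by rewrite divr_gt0 ?oppr_gt0.
  have h2 : - A / (B + 1 - A) <= 1 by rewrite ler_pdivrMr//; lra.
  rewrite h1 h2 => /(_ isT); rewrite leNgt => /negP; apply.
  have : - A / (B + 1 - A) * B <= - A by rewrite mulrAC ler_pdivrMr//; nra.
  lra.
exists (fun g => - \sum_i a i * l (s i) g); split.
- move=> F g FF Fg; apply: cvgN; apply: cvg_sumr => i _.
  by apply: cvgM; [exact: cvg_cst|exact: Fg].
- move=> g h t Vg Vh t01; rewrite !mulrN -opprD !mulr_sumr -big_split/=; congr (- _).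
  by apply: eq_bigr => i _; rewrite la//; ring.
- move=> g Cg; rewrite ltrN2; have := var g Cg.
  have -> : \sum_i a i * (l (s i) g - l (s i) g0) = \sum_i a i * l (s i) g - \sum_i a i * l (s i) g0.
    by rewrite -sumrB; apply: eq_bigr => i _; rewrite mulrBr.
  have -> : \sum_i a i * l (s i) g0 = \sum_i a i * l (s i) f + q g0.
    by rewrite /q -big_split/=; apply: eq_bigr => i _; rewrite /a; ring.
  lra.
Qed.

End KreinMilman.

(** * Extreme points *)

Lemma indic_comb (R : realType) (X : Type) n (F : nat -> set X) (e : 'I_n -> R) x :
  (forall i j, (i < n)%N -> (j < n)%N -> i != j -> F i `&` F j = set0) ->
  (forall i, `|e i| <= 1) -> `|\sum_i e i * \1_(F i) x| <= 1.
Proof.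
move=> disj e1; have [[i Fi]|no] := pselect (exists i : 'I_n, F i x).
  rewrite (bigD1 i)//= big1 ?addr0 => [|k ki]; first by rewrite indicE mem_set// mulr1.
  rewrite indicE memNset ?mulr0// => Fk.
  by have : (F k `&` F i) x by []; rewrite disj.
rewrite big1 ?normr0// => i _; rewrite indicE memNset ?mulr0// => Fi.
by apply: no; exists i.
Qed.

Section ExtremePoints.
Context {R : realType} {N1 N2 : nat}.
Hypotheses (N10 : (0 < N1)%N) (N20 : (0 < N2)%N).
Variables (alpha1 alpha2 a1 b1 a2 b2 : R).
Notation L1 := (local_system alpha1 N1 a1 b1).
Notation L2 := (local_system alpha2 N2 a2 b2).
Notation MK := (native L1 L2).
Let tL : tame L1 L2 := tame_local N1 N2 alpha1 alpha2 a1 b1 a2 b2.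
Notation J := (option 'I_N1 * option 'I_N2)%type.
Notation lcomp := (@lcomp R N1 N2 alpha1 alpha2 a1 b1 a2 b2).
Implicit Types (f g : R -> R -> R).
Variables (M : nat) (nu : (R -> R -> R) -> 'rV[R]_M) (H : 'I_M -> J -> R * R -> R).
Hypotheses (bH : forall r j, bmeas (H r j)).
Hypothesis nuE : forall f r, MK f -> nu f 0 r = \sum_j lcomp f j (H r j).
Variable V : set (R -> R -> R).
Hypotheses (VM : V `<=` MK)
  (Vmin : forall f g, V f -> MK g -> nu g = nu f -> seminorm L1 L2 f <= seminorm L1 L2 g)
  (Vmem : forall f g, V f -> MK g -> nu g = nu f -> seminorm L1 L2 g <= seminorm L1 L2 f -> V g).
Variables (f : R -> R -> R) (fext : extreme_points V f).

(* The unpenalized components carry no information here and are replaced by a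
   unit mass, so that all components can be treated alike. *)
Definition piece j : (R * R -> R) -> R := if penal j then lcomp f j else fun h => h (0, 0).

Lemma piece_daniell j : daniell (piece j).
Proof. by rewrite /piece; case: ifP => _; [exact: lcomp_daniell|exact: daniell_eval]. Qed.

Lemma piece_concentrated j : concentrated (jdom L1 L2 j) (piece j).
Proof.
rewrite /piece; case: ifP => pj; first exact: lcomp_concentrated.
by case: j pj => -[n|] [n'|] // _ h bh h0; exact: h0.
Qed.

Lemma piece_polar_ex j : {s | polar (piece j) s}.
Proof. by apply: cid; exact: polar_ex (piece_daniell j). Qed.

Definition psign j := sval (piece_polar_ex j).

Lemma psignP j : polar (piece j) (psign j). Proof. exact: svalP (piece_polar_ex j). Qed.

Definition modulus j : (R * R -> R) -> R := fun h => piece j (fun x => psign j x * h x).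

Lemma modulus_daniell j : daniell (modulus j).
Proof. by apply: daniell_mul; [exact: piece_daniell|case: (psignP j)]. Qed.

(** Since [1 + e W] is nonnegative for [e = 1] and [e = -1], the seminorm of [f + e g] is that of
    [f] plus [e] times a constant. Minimality of [f] forces the constant to be 0, so both points are
    minimizers with midpoint [f]. *)
Lemma extreme_zero (W : J -> R * R -> R) g : (forall j, bmeas (W j)) -> (forall j x, `|W j x| <= 1) ->
  MK g -> nu g = 0 ->
  (forall j h, penal j -> bmeas h -> lcomp g j h = lcomp f j (fun x => W j x * h x)) -> g = 0.
Proof.
move=> bW W1 Mg g0 gE; have [Vf fmax] := fext; have Mf := VM Vf.
have sgn j : penal j -> piece j = lcomp f j by rewrite /piece => ->.
have semi (e : R) : `|e| = 1 -> seminorm L1 L2 (1 *: f + e *: g) =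
    seminorm L1 L2 f + e * \sum_(j | penal j) modulus j (W j).
  move=> e1; rewrite !(seminorm_lcomp N10 N20)//; last exact: native_lin.
  rewrite mulr_sumr -big_split/=; apply: eq_bigr => j pj.
  have [bs _ _] := psignP j; have ps := psignP j; rewrite sgn// in ps.
  have bw : bmeas (fun x => 1 + e * W j x) by apply: bmeasD; [exact: bmeas_cst|exact: bmeasZ].
  rewrite (@tvar_eq _ _ _ _ (fun h => lcomp f j (fun x => (1 + e * W j x) * h x)) (lcomp_daniell _ j) (daniell_mul (lcomp_daniell f j) bw)); last first.
    move=> h bh; rewrite lcomp_lin2// gE// mul1r addrC -(daniell_lin (lcomp_daniell f j))//; last exact: bmeasM.
    by congr (lcomp f j); apply/funext => x; ring.
  rewrite (tvar_mul (lcomp_daniell f j) ps bw); last first.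
    move=> x; have := W1 j x; rewrite -[`|W j x|]mul1r -e1 -normrM ler_norml; lra.
  rewrite (tvarE (lcomp_daniell f j) ps) /modulus sgn//.
  rewrite -(daniellZ (lcomp_daniell f j)); last exact: bmeasM.
  rewrite -(daniellD (lcomp_daniell f j))//; last by apply: bmeasZ; exact: bmeasM.
  by congr (lcomp f j); apply/funext => x; ring.
have nue (e : R) : nu (1 *: f + e *: g) = nu f by rewrite (nu_lin2 N10 N20 bH nuE)// g0 scaler0 addr0 scale1r.
pose c := \sum_(j | penal j) modulus j (W j).
have Me (e : R) : MK (1 *: f + e *: g) by exact: native_lin.
have n1 : `|1 : R| = 1 by rewrite normr1.
have nN1 : `|-1 : R| = 1 by rewrite normrN1.
have c0 : c = 0.
  have := Vmin Vf (Me 1) (nue 1); have := Vmin Vf (Me (-1)) (nue (-1)).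
  by rewrite (semi 1)// (semi (-1))// -/c; lra.
have Ve (e : R) : `|e| = 1 -> V (1 *: f + e *: g).
  by move=> e1; apply: (Vmem Vf) => //; rewrite semi// -/c c0 mulr0 addr0.
have half : 0 < (2^-1 : R) < 1 by apply/andP; split; lra.
have [|fg _] := fmax _ _ _ (Ve 1 n1) (Ve (-1) nN1) half.
  apply/funext => t1; apply/funext => t2; rewrite !fctE /GRing.scale /=; lra.
by move: fg; rewrite !scale1r -[X in _ = X]addr0 => /addrI.
Qed.

(** The rows of [A] are the data of the pieces; with more than [M] rows there is a relation, which
    defines a perturbation [g] with [nu g = 0], hence [g = 0]. As each piece is nonnull, the
    relation would be trivial. *)
Lemma extreme_count (n : J -> nat) : (forall j, splits (n j) (modulus j)) -> (\sum_j n j <= M)%N.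
Proof.
move=> sp; rewrite leqNgt; apply/negP => Mn.
pose F j := sval (cid (sp j)).
have [mF dF pF] : [/\ forall j i, measurable (F j i),
    forall j i i', (i < n j)%N -> (i' < n j)%N -> i != i' -> F j i `&` F j i' = set0 &
    forall j i, (i < n j)%N -> 0 < modulus j \1_(F j i)].
  by split => j; rewrite /F; case: cid => G [].
pose Q := {j : J & 'I_(n j)}.
have cQ : #|{: Q}| = \sum_j n j.
  rewrite -sum1_card -(sig_big_dep xpredT (fun _ => xpredT) (fun _ _ => 1%N))/=.
  by apply: eq_bigr => j _; rewrite sum1_card card_ord.
have bI j i : bmeas (\1_(F j i) : R * R -> R) by exact: bmeas_indic.
pose qv (q : 'I_#|{: Q}|) : Q := enum_val q.
pose A : 'M[R]_(#|{: Q}|, M) := \matrix_(q, r)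
  piece (projT1 (qv q)) (fun x => \1_(F (projT1 (qv q)) (projT2 (qv q))) x * H r (projT1 (qv q)) x).
have kA : kermx A != 0.
  rewrite -mxrank_eq0 mxrank_ker subn_eq0 -ltnNge; apply: leq_ltn_trans (rank_leq_col A) _.
  by rewrite cQ.
have /rowV0Pn[v vA v0] := kA; move/sub_kermxP: vA => vA.
pose e j (i : 'I_(n j)) : R := `|v|^-1 * v 0 (enum_rank (existT (fun j => 'I_(n j)) j i)).
have nv : 0 < `|v| by rewrite normr_gt0.
have e1 j i : `|@e j i| <= 1.
  by rewrite /e normrM normfV normr_id mulrC ler_pdivrMr// mul1r rV_norm_coord.
pose W j (x : R * R) := \sum_i @e j i * \1_(F j i) x.
have bW j : bmeas (W j) by apply: bmeas_sum => i; exact: bmeasZ.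
have W1 j x : `|W j x| <= 1 by apply: indic_comb => // i i'; exact: dF.
have [g Mg gE] : exists2 g, MK g & forall j h, bmeas h -> lcomp g j h = piece j (fun x => W j x * h x).
  apply: (lcomp_onto N10 N20) => j; first exact: daniell_mul (piece_daniell j) (bW j).
  move=> h bh h0; apply: piece_concentrated; first exact: bmeasM.
  by move=> x /h0 ->; rewrite mulr0.
have pW j h : bmeas h -> piece j (fun x => W j x * h x) = \sum_i @e j i * piece j (fun x => \1_(F j i) x * h x).
  move=> bh; transitivity (piece j (fun x => \sum_i @e j i * (\1_(F j i) x * h x))).
    by congr (piece j); apply/funext => x; rewrite /W mulr_suml; apply: eq_bigr => i _; rewrite mulrA.
  rewrite (daniell_sum (piece_daniell j)); last by move=> i; apply: bmeasZ; exact: bmeasM.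
  by apply: eq_bigr => i _; rewrite (daniellZ (piece_daniell j))//; exact: bmeasM.
have g0 : nu g = 0.
  apply/rowP => r; rewrite nuE// mxE.
  transitivity (\sum_j \sum_i @e j i * piece j (fun x => \1_(F j i) x * H r j x)).
    by apply: eq_bigr => j _; rewrite gE// pW.
  rewrite (sig_big_dep xpredT (fun _ => xpredT) (fun j i => @e j i * piece j (fun x => \1_(F j i) x * H r j x)))/=.
  have := congr1 (fun u : 'rV[R]_M => `|v|^-1 * u 0 r) vA; rewrite mxE [in RHS]mxE mulr0 => vr.
  rewrite -[RHS]vr mulr_sumr [RHS](reindex (@enum_rank {: Q}))/=; last first.
    by exists enum_val => ? _; rewrite ?enum_rankK ?enum_valK.
  apply: eq_bigr => -[j i] _ /=; rewrite /e -mulrA; congr (_ * (_ * _)).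
  by rewrite mxE /qv enum_rankK.
have gz : g = 0.
  apply: (extreme_zero bW W1 Mg g0) => j h pj bh.
  by rewrite gE// /piece pj.
move/negP: v0; apply; apply/eqP/rowP => q; rewrite mxE -(enum_valK q); case: (enum_val q) => j i.
have [bs s1 _] := psignP j.
(* Testing [g = 0] against the sign on a single piece isolates its coefficient times its mass. *)
have := gE j _ (bmeasM bs (bI j i)); rewrite gz pW; last exact: bmeasM.
rewrite (bigD1 i)//= big1 ?addr0 => [|k ki]; last first.
  suff -> : (fun x => \1_(F j k) x * (psign j x * \1_(F j i) x)) = fun=> 0.
    by rewrite (daniell0 (piece_daniell j)) mulr0.
  apply/funext => x; have := congr1 (fun B => \1_B x : R) (dF j k i (ltn_ord _) (ltn_ord _) ki).
  by rewrite indicI indic0 /= => Fz; rewrite mulrCA Fz mulr0.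
rewrite (lcomp_zero N10 N20 _ _ _ _ _ _ _ (bmeasM bs (bI j i))); have -> : (fun x => \1_(F j i) x * (psign j x * \1_(F j i) x)) = (fun x => psign j x * \1_(F j i) x).
  apply/funext => x; have := congr1 (fun B => \1_B x : R) (setIid (F j i)).
  by rewrite indicI /= => FF; rewrite mulrCA FF.
move/esym/eqP; rewrite mulf_eq0 (gt_eqF (pF j i (ltn_ord i))) orbF /e mulf_eq0 invr_eq0 (gt_eqF nv) /=.
by move/eqP.
Qed.

Lemma extreme_dirac : exists n : J -> nat, (\sum_j (if penal j then n j else 1) <= M)%N /\
  forall j, penal j -> exists (p : 'I_(n j) -> R * R) (w : 'I_(n j) -> R),
    (forall i, jdom L1 L2 j (p i)) /\
    forall h, bmeas h -> lcomp f j h = \sum_i w i * h (p i).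
Proof.
have nn j : nonneg_functional (modulus j) by have [_ _] := psignP j.
have cm j : concentrated (jdom L1 L2 j) (modulus j).
  move=> h bh h0; apply: piece_concentrated; first by apply: bmeasM => //; case: (psignP j).
  by move=> x /h0 ->; rewrite mulr0.
have split0 j : splits 0 (modulus j) by exists (fun=> set0); split.
have dir j : {n | splits n (modulus j) /\ exists (p : nat -> R * R) (w : nat -> R),
    (forall i, (i < n)%N -> jdom L1 L2 j (p i)) /\
    forall h, bmeas h -> modulus j h = \sum_(i < n) w i * h (p i)}.
  apply: cid; have [a [b [c [d jE]]]] := jdom_box alpha1 alpha2 a1 b1 a2 b2 j.
  have := cm j; rewrite jE => cj.
  have [[n [_ [p [w [pK wE]]] sp]]|sp] := dirac_or_split M (modulus_daniell j) (nn j) cj.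
    by exists n; split => //; exists p, w; split.
  (* One component with [M + 1] pieces, and none taken elsewhere, would already exceed the count. *)
  have : (\sum_k (if k == j then M.+1 else 0) <= M)%N.
    by apply: extreme_count => k; case: eqP => [->|].
  by rewrite (bigD1 j)//= eqxx leqNgt ltnS leq_addr.
exists (fun j => sval (dir j)); split => [|j pj].
  apply: extreme_count => j; case: ifPn => pj; first by case: (dir j) => n [].
  (* An unpenalized component is a unit point mass and counts as one piece, the whole plane; its
     sign at the origin is nonnegative and nonzero. *)
  exists (fun=> setT); split => [//|i i'|i _]; first by rewrite !ltnS !leqn0 => /eqP -> /eqP ->.
  rewrite indicT /modulus /piece (negbTE pj) mulr1.
  have [_ s1 ps] := psignP j; have := ps _ (bmeas_cst 1) (fun=> ler01).
  rewrite /piece (negbTE pj) mulr1 le_eqVlt => /predU1P[s0|//].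
  by have := s1 (0, 0); rewrite -s0 mul0r => /eqP; rewrite eq_sym oner_eq0.
case: (dir j) => n [_ [p [w [pK wE]]]] /=; have [bs s1 _] := psignP j.
exists (fun i => p i), (fun i => w i * psign j (p i)); split => [i|h bh]; first exact: pK.
transitivity (modulus j (fun x => psign j x * h x)).
  rewrite /modulus /piece pj; congr (lcomp f j); apply/funext => x.
  by rewrite mulrA s1 mul1r.
by rewrite wE; [apply: eq_bigr => i _; rewrite mulrA|exact: bmeasM].
Qed.

Lemma jkern_dom j x t1 t2 : jdom L1 L2 j x ->
  jkern L1 L2 j t1 t2 x = kern L1 j.1 t1 x.1 * kern L2 j.2 t2 x.2.
Proof. by move=> [x1 x2]; rewrite /jkern /tens /mkern !indicE !mem_set// !mulr1. Qed.

Lemma extreme_spline : exists (K : nat) (k1 : 'I_N1 -> nat) (k2 : 'I_N2 -> nat)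
    (a : 'I_K -> R) (x1 x2 : 'I_K -> R)
    (b s : forall n : 'I_N1, 'I_(k1 n) -> R) (c z : forall n : 'I_N2, 'I_(k2 n) -> R)
    (d : 'M[R]_(N1, N2)),
  [/\ f = (fun t1 t2 =>
        \sum_k a k * green alpha1 N1 (t1 - x1 k) * green alpha2 N2 (t2 - x2 k) +
        \sum_n \sum_m b n m * fundamental_basis alpha1 a1 n t1 * green alpha2 N2 (t2 - s n m) +
        \sum_n' \sum_m' c n' m' * green alpha1 N1 (t1 - z n' m') * fundamental_basis alpha2 a2 n' t2 +
        \sum_n \sum_n' d n n' * fundamental_basis alpha1 a1 n t1 * fundamental_basis alpha2 a2 n' t2),
      (K + \sum_n k1 n + \sum_n' k2 n' <= M - N1 * N2)%N,
      (forall k, (`[a1, b1]%classic `*` `[a2, b2]%classic) (x1 k, x2 k)),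
      (forall n m, `[a2, b2]%classic (s n m)) &
      (forall n' m', `[a1, b1]%classic (z n' m'))].
Proof.
have [Vf _] := fext; have Mf := VM Vf.
have [n [nM nE]] := extreme_dirac.
pose P j (pj : penal j) := sval (cid (nE j pj)).
pose w j (pj : penal j) := sval (cid (svalP (cid (nE j pj)))).
have PW j pj : (forall i, jdom L1 L2 j (@P j pj i)) /\
    forall h, bmeas h -> lcomp f j h = \sum_i @w j pj i * h (@P j pj i) := svalP (cid (svalP (cid (nE j pj)))).
have PD j pj i : jdom L1 L2 j (@P j pj i) := (PW j pj).1 i.
have fE j pj h : bmeas h -> lcomp f j h = \sum_i @w j pj i * h (@P j pj i) := (PW j pj).2 h.
have p0 : @penal N1 N2 (None, None) by [].
have p1 i : @penal N1 N2 (Some i, None) by [].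
have p2 i : @penal N1 N2 (None, Some i) by [].
exists (n (None, None)), (fun i => n (Some i, None)), (fun i => n (None, Some i)).
exists (w _ p0), (fun k => (P _ p0 k).1), (fun k => (P _ p0 k).2).
exists (fun i => w _ (p1 i)), (fun i m => (P _ (p1 i) m).2).
exists (fun i => w _ (p2 i)), (fun i m => (P _ (p2 i) m).1).
exists (\matrix_(i, i') lcomp f (Some i, Some i') (fun=> 1)); split.
- apply/funext => t1; apply/funext => t2; rewrite (lcompE t1 t2 Mf) big_option2.
  congr (_ + _ + _ + _).
  + rewrite (fE _ p0); last exact: bmeas_jkern.
    by apply: eq_bigr => k _; rewrite (jkern_dom _ _ (PD _ p0 k)) mulrA.
  + apply: eq_bigr => i _; rewrite (fE _ (p1 i)); last exact: bmeas_jkern.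
    by apply: eq_bigr => k _; rewrite (jkern_dom _ _ (PD _ (p1 i) k)) mulrA.
  + apply: eq_bigr => i _; rewrite (fE _ (p2 i)); last exact: bmeas_jkern.
    by apply: eq_bigr => k _; rewrite (jkern_dom _ _ (PD _ (p2 i) k)) mulrA.
  + apply: eq_bigr => i _; apply: eq_bigr => i' _; have bk := bmeas_jkern tL (Some i, Some i') t1 t2.
    rewrite [X in _ = X * _ * _]mxE (lcomp_null _ _ _ _ _ _ _ _ _ bk).
    by rewrite jkern_dom// mulrA.
- have cnt : (\sum_j (if penal j then n j else 1) = n (None, None) + \sum_i n (Some i, None) +
      \sum_i n (None, Some i) + N1 * N2)%N.
    rewrite (big_option2 (V := nat)) /=; congr addn.
    by under eq_bigr do rewrite sum1_card card_ord; rewrite sum_nat_const card_ord.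
  (* The count gives [N1 * N2 <= M], so the truncated subtraction is exact. *)
  rewrite cnt in nM; rewrite -(leq_add2r (N1 * N2)) subnK//.
  by apply: leq_trans nM; exact: leq_addl.
- by move=> k; have := PD _ p0 k.
- by move=> i k; have [] := PD _ (p1 i) k.
- by move=> i k; have [] := PD _ (p2 i) k.
Qed.

End ExtremePoints.

(** * The solution set *)

(** Pairings with products of ramps form the countable separating family. [krein_milman] is applied
    to [C] intersected with [V], which is closed along ultrafilters because elements of the native
    space converge weak-star when all pairings do. *)
Lemma convex_hull_extreme (R : realType) (N1 N2 : nat) (alpha1 alpha2 a1 b1 a2 b2 : R)
    (V : set (R -> R -> R)) : (0 < N1)%N -> (0 < N2)%N ->
  let L1 := local_system alpha1 N1 a1 b1 in
  let L2 := local_system alpha2 N2 a2 b2 in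
  V `<=` native L1 L2 -> compact (V : set (wstar L1 L2)) ->
  (forall f g (t : R), V f -> V g -> 0 <= t <= 1 -> V (t *: f + (1 - t) *: g)) ->
  V = wstar_closed_convex_hull L1 L2 (extreme_points V).
Proof.
move=> N10 N20 L1 L2 VM cV Vconv; apply/seteqP; split; last first.
  apply: smallest_sub; last by move=> f [].
  split; last exact/convex_setP.
  exact: compact_closed (wstar_hausdorff N10 N20 (b1:=b1) (b2:=b2)) cV.
move=> f Vf C [[clC /convex_setP convC] extC].
pose l (p : predual L1 L2) := pairw p.
have ramps (j : option 'I_N1 * option 'I_N2) k k' :
    {p | forall f, l p f = lcomp alpha1 alpha2 a1 b1 a2 b2 f j (tens (ramp k) (ramp k'))}.
  by apply: cid; apply: local_predual; [exact: bmeas_tens (bmeas_ramp _) (bmeas_ramp _)|exact: wcont_ramp].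
pose k (i : (option 'I_N1 * option 'I_N2) * ((nat * int) * (nat * int))) :=
  sval (ramps i.1 i.2.1 i.2.2).
suff : V `<=` C `&` V by move=> /(_ f Vf)[].
apply: (@krein_milman _ _ _ V l _ k).
- move=> F FU FV; have := cV; rewrite compact_ultra => /(_ F FU FV)[g [Vg Fg]].
  by exists g => // p A /(pairw_continuous N10 N20 (p := p)) /Fg.
- move=> p g h t Vg Vh _; rewrite /l !pairwE !mulr_sumr -big_split/=; apply: eq_bigr => j _.
  have bp := bmeas_dualfun (tame_local N1 N2 alpha1 alpha2 a1 b1 a2 b2) p j.
  by rewrite (lcomp_lin2 N10 N20 t (1 - t) j (VM _ Vg) (VM _ Vh) bp).
- move=> g h Vg Vh gh; apply: (lcomp_ramp_ext (VM _ Vg) (VM _ Vh)) => j i i'.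
  by have := gh (j, (i, i')); rewrite /k /= !(svalP (ramps j i i')).
- split => [g []//|F g FU FC Vg Fg]; split => //; apply: clC => B gB.
  have Fgw : (id : wstar L1 L2 -> wstar L1 L2) @ F --> (g : wstar L1 L2).
    apply: wstar_cvg => //; last exact: VM.
    by apply: filterS FC => h [_ /VM].
  have FB : F B := Fgw _ gB.
  by have [h [[Ch _] Bh]] := filter_ex (filterI FC FB); exists h.
- by move=> g h t [Cg Vg] [Ch Vh] t01; split; [exact: convC|exact: Vconv].
- by move=> g eg; split; [exact: extC|case: eg].
Qed.

Theorem theorem11 (R : realType) (N1 N2 M : nat)
  (hN1 : (1 <= N1)%N) (hN2 : (1 <= N2)%N)
  (alpha1 alpha2 : R)
  (K1m K1p K2m K2p : R) (hK1 : K1m <= K1p) (hK2 : K2m <= K2p)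
  (q1 phi1 : 'I_N1 -> R -> R) (q2 phi2 : 'I_N2 -> R -> R)
  (hsys1 : biorthogonal_system alpha1 q1 phi1)
  (hsys2 : biorthogonal_system alpha2 q2 phi2)
  (nu : (R -> R -> R) -> 'rV[R]_M)
  (E : 'rV[R]_M -> 'rV[R]_M -> \bar R)
  (y : 'rV[R]_M) (lambda : R) :
  let G1 := global_system alpha1 q1 phi1 in
  let G2 := global_system alpha2 q2 phi2 in
  let MR2 : set (R -> R -> R) := native G1 G2 in
  let K1 : set R := `[K1m, K1p]%classic in
  let K2 : set R := `[K2m, K2p]%classic in
  let L1 := local_system alpha1 N1 K1m K1p in
  let L2 := local_system alpha2 N2 K2m K2p in
  let MK : set (R -> R -> R) := native L1 L2 in
  let g1 := green alpha1 N1 in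
  let g2 := green alpha2 N2 in
  let p1 := @fundamental_basis R alpha1 K1m N1 in
  let p2 := @fundamental_basis R alpha2 K2m N2 in
  linear_on MR2 nu ->
  {within (MR2 : set (wstar G1 G2)), continuous (nu : wstar G1 G2 -> 'rV[R]_M)} ->
  nu @` MR2 = setT ->
  set_inj (tensor_space (nullspace alpha1 N1) (nullspace alpha2 N2)) nu ->
  supported_in MR2 nu (K1 `*` K2) ->
  (forall z z', (0 <= E z z')%E) ->
  (forall z, is_proper (E z)) ->
  (forall z, is_coercive (E z)) ->
  (forall z, lower_semicontinuous (E z)) ->
  (forall z, strictly_convex (E z)) ->
  0 < lambda ->
  let V : set (R -> R -> R) :=
    argmin MK (fun f => E y (nu f) + (lambda * seminorm L1 L2 f)%:E)%E in
  [/\ V !=set0,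
      compact (V : set (wstar L1 L2)),
      V = wstar_closed_convex_hull L1 L2 (extreme_points V) &
      forall f, extreme_points V f ->
        exists (K : nat) (k1 : 'I_N1 -> nat) (k2 : 'I_N2 -> nat)
          (a : 'I_K -> R) (x1 x2 : 'I_K -> R)
          (b s : forall n : 'I_N1, 'I_(k1 n) -> R)
          (c z : forall n : 'I_N2, 'I_(k2 n) -> R)
          (d : 'M[R]_(N1, N2)),
        [/\ f = (fun t1 t2 =>
              \sum_k a k * g1 (t1 - x1 k) * g2 (t2 - x2 k) +
              \sum_n \sum_m b n m * p1 n t1 * g2 (t2 - s n m) +
              \sum_n' \sum_m' c n' m' * g1 (t1 - z n' m') * p2 n' t2 +
              \sum_n \sum_n' d n n' * p1 n t1 * p2 n' t2),
            (K + \sum_n k1 n + \sum_n' k2 n' <= M - N1 * N2)%N,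
            (forall k, (K1 `*` K2) (x1 k, x2 k)),
            (forall n m, K2 (s n m)) &
            (forall n' m', K1 (z n' m'))]].
Proof.
move=> G1 G2 MR2 K1 K2 L1 L2 MK g1 g2 p1 p2 lnu cnu surj inj supp E0 Eprop Ecoer Elsc Econv lambda0 V.
have [H [bH cH HE]] := nu_local_comp K1m K1p K2m K2p hN1 hN2 hsys1 hsys2 lnu cnu.
have nuE f r : MK f -> nu f 0 r = \sum_j lcomp alpha1 alpha2 K1m K1p K2m K2p f j (H r j).
  by move=> Mf; rewrite -{1}(repK Mf) HE.
have surjL : nu @` MK = setT := nu_local_surj hN1 hN2 hsys1 hsys2 lnu cnu surj supp.
have VM : V `<=` MK by move=> f [].
have [m V0 _] := argmin_value hN1 hN2 bH cH nuE inj surjL (E0 y) (Eprop y) (Ecoer y) (Elsc y) lambda0.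
have cV := argmin_compact hN1 hN2 bH cH nuE inj surjL (E0 y) (Eprop y) (Ecoer y) (Elsc y) lambda0.
have Vconv := argmin_convex hN1 hN2 bH cH nuE inj surjL (E0 y) (Eprop y) (Ecoer y) (Elsc y) (Econv y) lambda0.
split => //; first exact: convex_hull_extreme hN1 hN2 VM cV Vconv.
have Vmin := argmin_min hN1 hN2 bH cH nuE inj surjL (E0 y) (Eprop y) (Ecoer y) (Elsc y) lambda0.
have Vmem := @argmin_mem R N1 N2 alpha1 alpha2 K1m K1p K2m K2p M nu (E y) lambda lambda0.
move=> f fext.
have h := @extreme_spline R N1 N2 hN1 hN2 alpha1 alpha2 K1m K1p K2m K2p M nu H bH nuE V VM Vmin Vmem f fext.
exact: h.
Qed.
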